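(* Let $p^*\in U_\beta$. There exists $\eta>0$ such that the following holds with $\mu=\mu_n$ the ERGM on $n$ vertices conditioned on $B^\square_\eta(p^* )$ and $X\sim\mu$. Let $m=m_n$ satisfy $m_n\to\infty$ and $m_n/n\to0$, and for each $n$ let $e^n_1,\dots,e^n_m\in\binom{[n]}2$ be distinct edges such that either (a) for each $n$ they are pairwise vertex-disjoint, or (b) for each $n$ they are all incident on a single common vertex. Define $$S_n=\frac{\sum_{i=1}^mX(e^n_i)-\mathbb{E}_\mu[\sum_{i=1}^mX(e^n_i)]}{\sqrt{\mathrm{Var}_\mu[\sum_{i=1}^mX(e^n_i)]}}.$$ Then $S_n\to\mathcal{N}(0,1)$ in distribution under $\mu$ as $n\to\infty$.
   Context: Setting: $\Omega=\{0,1\}^{\binom{[n]}{2}}$ (simple graphs on $[n]$); fixed graphs $G_i=(V_i,E_i)$, $0\le i\le K$, $G_0$ a single edge; $\beta_0\in\mathbb{R}$, $\beta_1,\dots,\beta_K\ge0$; $N_G(x)$ = number of maps $\sigma:V\to[n]$ with $x(\{\sigma(u),\sigma(v)\})=1$ for all $\{u,v\}\in E$; $H(x)=\sum_i\beta_in^{-(|V_i|-2)}N_{G_i}(x)$; ERGM $\tilde\mu(x)\propto e^{H(x)}$; $L_\beta(p)=\sum_i\beta_ip^{|E_i|}-\frac12p\log p-\frac12(1-p)\log(1-p)$; $U_\beta$ = global maximizers $p^*$ of $L_\beta$ on $[0,1]$ with $L_\beta''(p^* )<0$. $W_x$ step graphon of $x$, $W_p\equiv p$, $\delta_\square$ cut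 distance, $B^\square_\eta(p)=\{x:\delta_\square(W_x,W_p)<\eta\}$; $\mu=\tilde\mu(\cdot\mid B^\square_\eta(p^* ))$. *)

(* Defs.v *)
From HB Require Import structures.
From mathcomp Require Import all_boot all_order all_algebra.
From mathcomp Require Import all_classical all_reals all_analysis.
From mathcomp Require Import normal_distribution.

Unset Implicit Arguments.
Unset Strict Implicit.
Unset Printing Implicit Defensive.

Import Order.TTheory GRing.Theory Num.Theory.
Import numFieldNormedType.Exports.

Local Open Scope classical_set_scope.
Local Open Scope ring_scope.

(* Simple graphs on [n] = 'I_n : a configuration x is a set of edges,
   an edge being a 2-element subset of 'I_n.  x(e) = 1 iff e \in x.   *)
Definition edges (n : nat) : {set {set 'I_n}} :=
  [set e : {set 'I_n} | #|e| == 2%N].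

Definition Omega (n : nat) : {set {set {set 'I_n}}} :=
  [set x : {set {set 'I_n}} | x \subset edges n].

Definition hom_count (v : nat) (E : {set {set 'I_v}}) (n : nat)
    (x : {set {set 'I_n}}) : nat :=
  #|[set s : {ffun 'I_v -> 'I_n} |
      [forall e in E, [forall u in e, [forall w in e,
          (u != w) ==> ([set s u; s w]%SET \in x)]]]]|.

Section ERGM.
Variable R : realType.
Variables (K : nat) (v : 'I_K.+1 -> nat)
          (E : forall i : 'I_K.+1, {set {set 'I_(v i)}})
          (beta : 'I_K.+1 -> R).

Definition hamiltonian (n : nat) (x : {set {set 'I_n}}) : R :=
  \sum_(i < K.+1)
     beta i * ((n%:R : R) ^ (2%:Z - (v i)%:Z)) * (hom_count (v i) (E i) n x)%:R.

(* L_beta(p) = sum_i beta_i p^{|E_i|} - 1/2 p log p - 1/2 (1-p) log (1-p)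
   (with ln 0 = 0 in MathComp-Analysis, i.e. 0 log 0 = 0) *)
Definition Lbeta (p : R) : R :=
  \sum_(i < K.+1) beta i * p ^+ #|E i|
  - 2^-1 * (p * ln p) - 2^-1 * ((1 - p) * ln (1 - p)).

Definition in_Ubeta (p : R) : Prop :=
  [/\ 0 <= p <= 1,
      (forall q : R, 0 <= q <= 1 -> Lbeta q <= Lbeta p)
    & derive1 (derive1 Lbeta) p < 0].

End ERGM.

Section CutDistance.
Variable R : realType.

Definition step_meas (n : nat) (S : set R) (i : 'I_n) : R :=
  fine ((@lebesgue_measure R)
          (S `&` `[(i%:R / n%:R : R), (i.+1%:R / n%:R : R)[%classic)).

(* Integral over S x T of W_x - W_p, where W_x is the step graphon of x
   (value x({i,j}) on I_i x I_j, 0 on diagonal blocks since x has no loops). *)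
Definition cut_integral (n : nat) (x : {set {set 'I_n}}) (p : R)
    (S T : set R) : R :=
  \sum_(i < n) \sum_(j < n)
     ((([set i; j]%SET \in x) : bool)%:R - p) * step_meas n S i * step_meas n T j.

Definition cut_dist (n : nat) (x : {set {set 'I_n}}) (p : R) : R :=
  sup [set r : R | exists S T : set R,
         [/\ measurable S, measurable T,
             S `<=` `[0, 1]%classic, T `<=` `[0, 1]%classic
           & r = `| cut_integral n x p S T |]].

End CutDistance.

Section Conditioned.
Variable R : realType.
Variables (K : nat) (v : 'I_K.+1 -> nat)
          (E : forall i : 'I_K.+1, {set {set 'I_(v i)}})
          (beta : 'I_K.+1 -> R).

Definition cut_ball (n : nat) (eta p : R) : {set {set {set 'I_n}}} :=
  [set x in Omega n | cut_dist R n x p < eta].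

Definition cond_ergm (n : nat) (eta p : R) (x : {set {set 'I_n}}) : R :=
  ((x \in cut_ball n eta p)%:R * expR (hamiltonian R K v E beta n x))
  / \sum_(y in cut_ball n eta p) expR (hamiltonian R K v E beta n y).

Definition Emu (n : nat) (eta p : R) (f : {set {set 'I_n}} -> R) : R :=
  \sum_(x : {set {set 'I_n}}) cond_ergm n eta p x * f x.

Definition Varmu (n : nat) (eta p : R) (f : {set {set 'I_n}} -> R) : R :=
  Emu n eta p (fun x => (f x - Emu n eta p f) ^+ 2).

Definition Pmu_le (n : nat) (eta p : R) (f : {set {set 'I_n}} -> R) (t : R) : R :=
  \sum_(x : {set {set 'I_n}} | f x <= t) cond_ergm n eta p x.

End Conditioned.

Definition edge_sum (R : realType) (n m : nat) (e : 'I_m -> {set 'I_n})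
    (x : {set {set 'I_n}}) : R :=
  \sum_(i < m) ((e i \in x) : bool)%:R.

Definition std_normal_cdf (R : realType) (t : R) : R :=
  fine (normal_prob 0 1 `]-oo, t]%classic).

(* Main.v *)
Require Import Defs.
From HB Require Import structures.
From mathcomp Require Import all_boot all_order all_algebra.
From mathcomp Require Import all_classical all_reals all_analysis.
From mathcomp Require Import normal_distribution perm.
From mathcomp Require Import ring lra zify.
Import Order.TTheory GRing.Theory Num.Theory.
Import numFieldNormedType.Exports.

Set Implicit Arguments.
Unset Strict Implicit.
Unset Printing Implicit Defensive.

Local Open Scope ring_scope.

(** Write p for the optimum and av for averages over vertices. The point is the estimate
    E av_b (av_w (x_bw - p))^2 = O(1/n) for the conditioned measure mu, obtained by an entropy argument.
    Reveal the edges one by one, let theta_e be the conditional probability of e given the past, and split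
    x_e = base_e + drift_e with drift_e = theta_e - p. By the chain rule the entropy of mu is governed by
    the Bernoulli divergences kl p drift_e, while the innovations x_e - theta_e are uncorrelated, so
    that subgraph densities expand in the drift: the constant and linear terms are cancelled by the stationarity
    of p, and what remains are pairs of edges sharing a vertex, up to errors that are small compared with the
    squared drift because mu lives in a small cut ball. Since p maximises L_beta with negative second
    derivative, the divergence strictly dominates these star terms. Comparing with the lower bound for the
    partition function given by the product measure with density p, whose mass outside the ball is O(1/n),
    forces the squared row means of the drift to be O(1/n) on average.

    Exchangeability of the vertices turns this estimate into O(1/n) bounds for the correlation of two
    edges and for the variance of the density of a large star of edges not meeting the given ones.
    Swapping a given edge with an edge of that star is an exchangeable pair, and Stein's method yields
    E [W f(W) - f'(W)] -> 0 for the standardised sum W. Test functions f of compact support suffice: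
    with f(w) = exp(w^2/2) A(Phi w) for a piecewise quadratic A the bracket is a difference of two trapezoids
    in Phi(W), and with Chebyshev's inequality Phi(W) is seen to be asymptotically uniform. *)

(** * Conditional probabilities along a revealing order *)

(** The scale 1/n is forced: the variance of the sum is of order m, and its m^2 covariances, each
    O(1/n), add up to m^2/n, negligible because m/n -> 0. The cut ball alone only makes row means
    small, and energies carry a factor n^2, so the comparison with the partition function must be
    accurate to O(n) in the exponent. The innovations allow this: a product over distinct edges has
    an exact mean, spoilt only by coincidences of vertices, a fraction O(1/n) of all placements.

    The delicate point of the domination is a factor two. L_beta carries half of the divergence, but
    a deviating row reappears as a column and so pays for all of it; correspondingly a star sum can
    approach twice the Bregman gap of the power r. It stays strictly below since two edges already
    cover three vertices. For small row means the disjoint pairs join the shared ones to rebuild the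
    second derivative of the energy, which L_beta'' < 0 controls. The edge G_0, whose coefficient
    may be negative, contains no pair of edges and drops out of these terms. *)

Section FiniteExpectation.
Variables (R : realType) (T : finType).
Implicit Types (mu f g : T -> R).

Definition Ex mu f : R := \sum_x mu x * f x.

Definition is_pmf mu := (forall x, 0 <= mu x) /\ \sum_x mu x = 1.

Lemma eq_Ex {mu} f g : f =1 g -> Ex mu f = Ex mu g.
Proof. by move=> fg; apply: eq_bigr => x _; rewrite fg. Qed.

Lemma eq_Ex_supp {mu} f g : (forall x, mu x != 0 -> f x = g x) ->
  Ex mu f = Ex mu g.
Proof.
move=> fg; apply: eq_bigr => x _; have [->|/fg->//] := eqVneq (mu x) 0.
by rewrite !mul0r.
Qed.

Lemma ExD mu f g : Ex mu (fun x => f x + g x) = Ex mu f + Ex mu g.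
Proof. by rewrite /Ex -big_split /=; apply: eq_bigr => x _; rewrite mulrDr. Qed.

Lemma ExZ mu c f : Ex mu (fun x => c * f x) = c * Ex mu f.
Proof. by rewrite /Ex mulr_sumr; apply: eq_bigr => x _; rewrite mulrCA. Qed.

Lemma ExZr mu c f : Ex mu (fun x => f x * c) = Ex mu f * c.
Proof. by rewrite /Ex mulr_suml; apply: eq_bigr => x _; rewrite mulrA. Qed.

Lemma ExN mu f : Ex mu (fun x => - f x) = - Ex mu f.
Proof. by rewrite /Ex -sumrN; apply: eq_bigr => x _; rewrite mulrN. Qed.

Lemma ExB mu f g : Ex mu (fun x => f x - g x) = Ex mu f - Ex mu g.
Proof. by rewrite ExD ExN. Qed.

Lemma Ex_sum mu (I : Type) (r : seq I) (P : pred I) (F : I -> T -> R) :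
  Ex mu (fun x => \sum_(i <- r | P i) F i x) = \sum_(i <- r | P i) Ex mu (F i).
Proof. by rewrite /Ex exchange_big /=; apply: eq_bigr => x _; rewrite mulr_sumr. Qed.

Lemma Ex_cst mu c : is_pmf mu -> Ex mu (fun=> c) = c.
Proof. by case=> _ m1; rewrite /Ex -mulr_suml m1 mul1r. Qed.

Lemma ler_Ex mu f g : is_pmf mu -> (forall x, mu x != 0 -> f x <= g x) ->
  Ex mu f <= Ex mu g.
Proof.
case=> m0 _ fg; apply: ler_sum => x _; have [->|/fg h] := eqVneq (mu x) 0.
  by rewrite !mul0r.
by rewrite ler_wpM2l.
Qed.

Lemma Ex_ge0 mu f : is_pmf mu -> (forall x, 0 <= f x) -> 0 <= Ex mu f.
Proof. by case=> m0 _ f0; apply: sumr_ge0 => x _; rewrite mulr_ge0. Qed.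

Lemma ler_norm_Ex mu f : is_pmf mu -> `|Ex mu f| <= Ex mu (fun x => `|f x|).
Proof.
case=> m0 _; apply: (le_trans (ler_norm_sum _ _ _)); apply: ler_sum => x _.
by rewrite normrM ger0_norm.
Qed.

Lemma Ex_sqr_le mu f : is_pmf mu -> Ex mu f ^+ 2 <= Ex mu (fun x => f x ^+ 2).
Proof.
move=> pm; set a := Ex mu f.
have : 0 <= Ex mu (fun x => (f x - a) ^+ 2) by apply: Ex_ge0 => // x; exact: sqr_ge0.
rewrite (eq_Ex (g := fun x => (f x ^+ 2 + (- (2 * a)) * f x) + a ^+ 2)); last first.
  by move=> x; ring.
by rewrite !ExD ExZ Ex_cst // -/a; nra.
Qed.

End FiniteExpectation.

Section Revealing.
Variables (R : realType) (T : finType) (mu : {set T} -> R).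
Hypothesis pm : is_pmf mu.
Implicit Types (x y z : {set T}) (e f : T).

(** Coordinates are revealed in the order of [enum_rank]; the classes of [agree k] are the atoms of
    the information available before step [k]. *)
Definition agree (k : nat) (x y : {set T}) : bool :=
  [forall e : T, (enum_rank e < k)%N ==> ((e \in x) == (e \in y))].

Definition adapted (k : nat) (f : {set T} -> R) :=
  forall x y : {set T}, agree k x y -> f x = f y.

Lemma agreeP (k : nat) (x y : {set T}) :
  reflect (forall e : T, (enum_rank e < k)%N -> (e \in x) = (e \in y)) (agree k x y).
Proof.
apply: (iffP forallP) => [h e ek|h e].
  by have /implyP/(_ ek)/eqP := h e.
by apply/implyP => /h ->.
Qed.

Lemma agree_refl k x : agree k x x.
Proof. exact/agreeP. Qed.

Lemma agree_sym k x y : agree k x y = agree k y x.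
Proof. by apply/agreeP/agreeP => h e ek; rewrite h. Qed.

Lemma agree_trans k y x z : agree k x y -> agree k y z -> agree k x z.
Proof. by move=> /agreeP xy /agreeP yz; apply/agreeP => e ek; rewrite xy // yz. Qed.

Lemma agree_le j k x y : (j <= k)%N -> agree k x y -> agree j x y.
Proof. by move=> jk /agreeP h; apply/agreeP => e ej; apply: h; apply: leq_trans jk. Qed.

Lemma agree_cong k x y z : agree k x y -> agree k x z = agree k y z.
Proof.
move=> xy; apply/idP/idP; last exact: agree_trans.
by apply: agree_trans; rewrite agree_sym.
Qed.

Definition cyl (k : nat) (x : {set T}) : R := \sum_(y | agree k x y) mu y.

(** On a cylinder of mass 0 the division convention gives 0, so the value lies in [0,1] for every
    [x], also outside the support. *)
Definition cprob (e : T) (x : {set T}) : R :=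
  (\sum_(y | agree (enum_rank e) x y && (e \in y)) mu y) / cyl (enum_rank e) x.

Lemma cyl_ge0 k x : 0 <= cyl k x.
Proof. by apply: sumr_ge0 => y _; case: pm. Qed.

Lemma mu_le_cyl k x : mu x <= cyl k x.
Proof.
rewrite /cyl (bigD1 x) ?agree_refl //= lerDl.
by apply: sumr_ge0 => y _; case: pm.
Qed.

Lemma cyl_adapted k : adapted k (cyl k).
Proof. by move=> x y xy; apply: eq_bigl => z; apply: agree_cong. Qed.

Lemma cprob_adapted e : adapted (enum_rank e) (cprob e).
Proof.
move=> x y xy; rewrite /cprob (cyl_adapted xy); congr (_ / _).
by apply: eq_bigl => z; rewrite (agree_cong _ xy).
Qed.

Lemma cprob_ge0 e x : 0 <= cprob e x.
Proof.
rewrite divr_ge0 ?cyl_ge0 //.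
by apply: sumr_ge0 => y _; case: pm.
Qed.

Lemma cprob_le1 e x : cprob e x <= 1.
Proof.
have [c0|c0] := eqVneq (cyl (enum_rank e) x) 0.
  by rewrite /cprob c0 invr0 mulr0.
rewrite /cprob ler_pdivrMr ?lt_neqAle ?cyl_ge0 1?eq_sym ?c0 // mul1r.
rewrite /cyl big_mkcondr /=; apply: ler_sum => y _.
by case: ifP => // _; case: pm.
Qed.

Lemma cprob_eq0 e x : (forall y, mu y != 0 -> e \notin y) -> cprob e x = 0.
Proof.
move=> h; rewrite /cprob big1 ?mul0r // => y /andP[_ ey].
by apply/eqP; apply: contraTT ey => /h.
Qed.

(** Martingale difference property of the innovation. The mass of [y] is spread over its cylinder
    with weights [mu x / cyl k y] and the two sums are exchanged; [f] is constant on the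
    cylinder. *)
Lemma Ex_cprob e (f : {set T} -> R) : adapted (enum_rank e) f ->
  Ex mu (fun x => f x * ((e \in x)%:R - cprob e x)) = 0.
Proof.
move=> fa; rewrite (eq_Ex (g := fun x => f x * (e \in x)%:R - f x * cprob e x)); last first.
  by move=> x; rewrite mulrBr.
rewrite ExB; apply/eqP; rewrite subr_eq0; apply/eqP; set k := nat_of_ord (enum_rank e).
transitivity (\sum_y \sum_(x | agree k x y) mu x / cyl k y * (mu y * f y * (e \in y)%:R)).
  apply: eq_bigr => y _; rewrite -!mulr_suml.
  have [my0|my0] := eqVneq (mu y) 0; first by rewrite my0 !mul0r mulr0.
  have cy0 : cyl k y != 0.
    apply: contra_neq my0 => c0; apply/eqP; rewrite eq_le; case: pm => -> _.
    by rewrite andbT -c0 mu_le_cyl.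
  rewrite (eq_bigl (agree k y)); last by move=> x; rewrite agree_sym.
  by rewrite -/(cyl k y) divff // mul1r mulrA.
rewrite (exchange_big_dep xpredT) //=; apply: eq_bigr => x _.
rewrite /cprob -/k big_mkcondr /= mulr_suml !mulr_sumr.
apply: eq_bigr => y xy; rewrite (cyl_adapted xy) (fa x y xy).
by case: (e \in y); rewrite ?mulr1 ?mulr0 ?mul0r ?mulr0 //; ring.
Qed.

Lemma cyl0 x : cyl 0 x = 1.
Proof.
case: pm => _ <-; apply: eq_bigl => y; apply/agreeP => e.
by rewrite ltn0.
Qed.

Lemma cyl_top x : cyl #|T| x = mu x.
Proof.
rewrite /cyl (big_pred1 x) // => y; rewrite /= eq_sym; apply/agreeP/eqP => [h|-> //].
by apply/setP => e; apply: h; apply: ltn_ord.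
Qed.

Lemma cylS (e : T) x : mu x != 0 ->
  cyl (enum_rank e).+1 x =
  cyl (enum_rank e) x * (if e \in x then cprob e x else 1 - cprob e x).
Proof.
move=> mx0; set k := nat_of_ord (enum_rank e).
have cx0 : cyl k x != 0.
  apply: contra_neq mx0 => c0; apply/eqP; rewrite eq_le; case: pm => -> _.
  by rewrite andbT -c0 mu_le_cyl.
have ag y : agree k.+1 x y = agree k x y && ((e \in x) == (e \in y)).
  apply/agreeP/andP => [h|[/agreeP h /eqP h'] f].
    split; last by apply/eqP/h; rewrite ltnS.
    by apply/agreeP => f fk; apply: h; rewrite ltnS ltnW.
  rewrite ltnS leq_eqVlt => /orP[/eqP/ord_inj/enum_rank_inj -> //|]; exact: h.
have E1 : cyl k x * cprob e x = \sum_(y | agree k x y && (e \in y)) mu y.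
  by rewrite /cprob -/k mulrC mulfVK.
rewrite {1}/cyl (eq_bigl _ _ ag); case: ifP => ex.
  by rewrite E1; apply: eq_bigl => y; case: (e \in y).
rewrite mulrBr mulr1 E1 /cyl [X in _ = X - _](bigID (fun y => e \in y)) /= addrAC subrr add0r.
by apply: eq_bigl => y; case: (e \in y).
Qed.

Definition xlnx (u : R) : R := u * ln u.

(** [mu x] is the product of its successive conditional probabilities, and the logarithm turns this
    into a sum. *)
Lemma entropy_chain_rule :
  Ex mu (fun x => ln (mu x)) =
  \sum_e Ex mu (fun x => xlnx (cprob e x) + xlnx (1 - cprob e x)).
Proof.
pose g e (x : {set T}) := ln (if e \in x then cprob e x else 1 - cprob e x).
have step k x : (k <= #|T|)%N -> mu x != 0 ->
    ln (cyl k x) = \sum_(e | (enum_rank e < k)%N) g e x.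
  move=> kT mx0; elim: k kT => [|k IH] kT; first by rewrite cyl0 ln1 big1.
  pose e := enum_val (Ordinal kT).
  have ek : k = enum_rank e by rewrite enum_valK.
  have mxp : 0 < mu x by rewrite lt_neqAle eq_sym mx0; case: pm => ->.
  have c1 : 0 < cyl k.+1 x by apply: lt_le_trans (mu_le_cyl _ _).
  have c0 : 0 < cyl k x by apply: lt_le_trans (mu_le_cyl _ _).
  rewrite (bigD1 e) ?ek //= addrC -[in LHS]ek.
  rewrite ek cylS // -ek lnM ?posrE //; last first.
    by move: c1; rewrite [in X in X -> _]ek cylS // -ek pmulr_rgt0.
  rewrite IH ?(ltnW kT) //; congr (_ + _); apply: eq_bigl => f.
  rewrite [RHS]andbC ltnS [in RHS]leq_eqVlt ek.
  have -> : (enum_rank f == enum_rank e :> nat) = (f == e).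
    by apply/eqP/eqP => [/ord_inj/enum_rank_inj|->].
  by case: eqP => [->|_] /=; rewrite ?ltnn.
rewrite -Ex_sum.
transitivity (Ex mu (fun x => \sum_e g e x)).
  apply: eq_Ex_supp => x mx0; rewrite -cyl_top step //.
  by apply: eq_bigl => e; rewrite ltn_ord.
rewrite !Ex_sum; apply: eq_bigr => e _.
(* With this adapted weight, [Ex_cprob] replaces the indicator of [e] by its conditional
   probability. *)
have := @Ex_cprob e (fun x => ln (cprob e x) - ln (1 - cprob e x)) _.
move=> /(_ _)/wrap[x y xy|h].
  by rewrite (cprob_adapted xy).
apply/eqP; rewrite -subr_eq0 -ExB -h; apply/eqP; apply: eq_Ex => x.
by rewrite /g /xlnx; case: (e \in x) => /=; ring.
Qed.

End Revealing.

Section Innovations.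
Variables (R : realType) (T : finType) (mu : {set T} -> R).
Variable D : T -> {set T} -> R.
Hypothesis pm : is_pmf mu.

(* E prod_{e in S} (c + D_e) = c^|S|: peel off the last revealed coordinate. *)
Definition uncorrelated :=
  forall c (S : seq T), uniq S ->
    Ex mu (fun x => \prod_(e <- S) (c + D e x)) = c ^+ size S.

Lemma innovations_uncorrelated :
  (forall e, adapted (enum_rank e).+1 (D e)) ->
  (forall e f, adapted (enum_rank e) f -> Ex mu (fun x => f x * D e x) = 0) ->
  uncorrelated.
Proof.
move=> Dad D0 c S; have [n] := ubnP (size S); elim: n S => // n IH S.
rewrite ltnS => sn uS; case: S sn uS => [|e0 S0] sn uS.
  by rewrite -[RHS](@Ex_cst _ _ mu (c ^+ 0)) //; apply: eq_Ex => x; rewrite big_nil.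
set S := e0 :: S0 in sn uS *.
have [e eS emax] : exists2 e, e \in S & forall f, f \in S -> (enum_rank f <= enum_rank e)%N.
  have e0S : e0 \in S by rewrite mem_head.
  by case: (arg_maxnP (P := mem S) (fun f => enum_rank f : nat) e0S) => e eS h; exists e.
have pS := perm_to_rem eS.
have uS' : uniq (e :: rem e S) by rewrite -(perm_uniq pS).
have sS : size S = (size (rem e S)).+1 by rewrite (perm_size pS).
rewrite sS exprS.
pose phi x := \prod_(f <- rem e S) (c + D f x).
rewrite (eq_Ex (g := fun x => c * phi x + phi x * D e x)); last first.
  by move=> x; rewrite (perm_big _ pS) big_cons /= -/(phi x) mulrDl [D e x * _]mulrC.
rewrite ExD ExZ D0 ?addr0; last first.
  move=> x y xy; apply: eq_big_seq => f fS; congr (_ + _); apply: Dad.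
  apply: agree_le xy; rewrite ltn_neqAle emax ?(mem_rem fS) // andbT.
  apply: contraTneq fS => /ord_inj/enum_rank_inj ->.
  by case/andP: uS'.
rewrite IH //; last by case/andP: uS'.
by rewrite -sS.
Qed.

End Innovations.

Section RevealingInnovations.
Variables (R : realType) (T : finType) (mu : {set T} -> R).
Hypothesis pm : is_pmf mu.

Lemma mem_adapted (e : T) : adapted (enum_rank e).+1 (fun x => (e \in x)%:R : R).
Proof. by move=> x y /agreeP ->. Qed.

Lemma cprob_uncorrelated : uncorrelated mu (fun e x => (e \in x)%:R - cprob mu e x).
Proof.
apply: innovations_uncorrelated => // [e x y xy|e f fa]; last exact: Ex_cprob.
by rewrite (mem_adapted xy) (cprob_adapted mu (agree_le (leqnSn _) xy)).
Qed.

End RevealingInnovations.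

Section ProductMeasure.
Variables (R : realType) (T : finType) (q : T -> R).
Hypothesis q01 : forall e, 0 <= q e <= 1.

Definition prod_pmf (x : {set T}) : R := \prod_e (if e \in x then q e else 1 - q e).

Lemma prod_pmf_is_pmf : is_pmf prod_pmf.
Proof.
split=> [x|].
  by apply: prodr_ge0 => e _; have /andP[h0 h1] := q01 e; case: ifP => _ //; rewrite subr_ge0.
by rewrite -bigA_distr big1 // => e _ /=; rewrite addrC subrK.
Qed.

(** The conditioned measure with its conditional probabilities and a product measure are both
    [uncorrelated], so one set of moment estimates serves both. Here each factor [c + D e] is
    absorbed into the weight of coordinate [e]. *)
Lemma prod_pmf_uncorrelated : uncorrelated prod_pmf (fun e x => (e \in x)%:R - q e).
Proof.
move=> c S uS; pose F e := q e * (if e \in S then c + 1 - q e else 1).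
pose G e := (1 - q e) * (if e \in S then c - q e else 1).
transitivity (\sum_(x : {set T}) \prod_e (if e \in x then F e else G e)).
  apply: eq_bigr => x _; rewrite big_uniq // big_mkcond -big_split /=.
  apply: eq_bigr => e _; rewrite /F /G; case: (e \in x); case: (e \in S) => //=.
    by rewrite addrA.
  by rewrite sub0r.
rewrite -bigA_distr (eq_bigr (fun e => if e \in S then c else 1)); last first.
  by move=> e _; rewrite /F /G; case: ifP => _ /=; ring.
by rewrite -big_mkcond /= -big_uniq //= big_const_seq count_predT iter_mulr_1.
Qed.

End ProductMeasure.

(** * Uniform averages over vertices and over placements *)

Section Averages.
Variable R : realType.

Definition unif (I : finType) : I -> R := fun=> (#|I|%:R)^-1.

Definition av (I : finType) (F : I -> R) : R := Ex (@unif I) F.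

Lemma unif_pmf (I : finType) : (0 < #|I|)%N -> is_pmf (@unif I).
Proof.
move=> I0; split=> [x|]; first by rewrite invr_ge0.
by rewrite /unif sumr_const -[X in X = _]mulr_natr mulVf // pnatr_eq0 -lt0n.
Qed.

Lemma avE (I : finType) (F : I -> R) : av F = (#|I|%:R)^-1 * \sum_i F i.
Proof. by rewrite /av /Ex mulr_sumr. Qed.

Lemma eq_av (I : finType) (F G : I -> R) : F =1 G -> av F = av G.
Proof. exact: eq_Ex. Qed.

Lemma avD (I : finType) (F G : I -> R) : av (fun i => F i + G i) = av F + av G.
Proof. exact: ExD. Qed.

Lemma avZ (I : finType) c (F : I -> R) : av (fun i => c * F i) = c * av F.
Proof. exact: ExZ. Qed.

Lemma avZr (I : finType) c (F : I -> R) : av (fun i => F i * c) = av F * c.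
Proof. exact: ExZr. Qed.

Lemma avB (I : finType) (F G : I -> R) : av (fun i => F i - G i) = av F - av G.
Proof. exact: ExB. Qed.

Lemma av_exchange (I J : finType) (F : I -> J -> R) :
  av (fun i => av (F i)) = av (fun j => av (F ^~ j)).
Proof.
rewrite /av /Ex; under eq_bigr do rewrite mulr_sumr.
rewrite exchange_big /=; apply: eq_bigr => j _; rewrite mulr_sumr.
by apply: eq_bigr => i _; rewrite mulrCA.
Qed.

Lemma Ex_av (T I : finType) (mu : T -> R) (F : I -> T -> R) :
  Ex mu (fun x => av (F ^~ x)) = av (fun i => Ex mu (F i)).
Proof.
rewrite /av /Ex; under eq_bigr do rewrite mulr_sumr.
rewrite exchange_big /=; apply: eq_bigr => j _; rewrite mulr_sumr.
by apply: eq_bigr => i _; rewrite mulrCA.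
Qed.

Section Nonempty.
Variable I : finType.
Hypothesis I0 : (0 < #|I|)%N.
Let pu := unif_pmf I0.

Lemma av_cst c : av (fun _ : I => c) = c.
Proof. exact: Ex_cst. Qed.

Lemma ler_av (F G : I -> R) : (forall i, F i <= G i) -> av F <= av G.
Proof. by move=> FG; apply: ler_Ex => // x _. Qed.

Lemma av_ge0 (F : I -> R) : (forall i, 0 <= F i) -> 0 <= av F.
Proof. exact: Ex_ge0. Qed.

Lemma ler_norm_av (F : I -> R) : `|av F| <= av (fun i => `|F i|).
Proof. exact: ler_norm_Ex. Qed.

Lemma av_sqr_le (F : I -> R) : av F ^+ 2 <= av (fun i => F i ^+ 2).
Proof. exact: Ex_sqr_le. Qed.

Lemma av_norm_le (F : I -> R) c : (forall i, `|F i| <= c) -> `|av F| <= c.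
Proof.
by move=> Fc; apply: le_trans (ler_norm_av _) _; rewrite -[leRHS]av_cst; apply: ler_av.
Qed.

End Nonempty.

Variables V W : finType.
Hypothesis W0 : (0 < #|W|)%N.

Definition upd (s : {ffun V -> W}) (x : V) (c : W) : {ffun V -> W} :=
  [ffun y => if y == x then c else s y].

Lemma updE s x c y : upd s x c y = if y == x then c else s y.
Proof. by rewrite ffunE. Qed.

Lemma ffun_card_gt0 : (0 < #|{ffun V -> W}|)%N.
Proof. by rewrite card_ffun expn_gt0 W0. Qed.

(** Resampling one coordinate preserves the uniform law: [(s, c) -> (upd s x c, s x)] is an
    involution of pairs. *)
Lemma av_upd (x : V) (F : {ffun V -> W} -> R) :
  av F = av (fun s => av (fun c => F (upd s x c))).
Proof.
pose h (u : {ffun V -> W} * W) := (upd u.1 x u.2, u.1 x).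
have hK : involutive h.
  move=> [s c]; rewrite /h /= updE eqxx; congr (_, _).
  by apply/ffunP => y; rewrite !updE; case: eqP => [->|].
rewrite [RHS]avE; under eq_bigr do rewrite avE.
rewrite -mulr_sumr pair_bigA /= (reindex_inj (inv_inj hK)) /=.
rewrite (eq_bigr (fun u : {ffun V -> W} * W => F u.1)); last first.
  by move=> u _; have := hK u; case: u => s c; rewrite /h /= => -[-> _].
rewrite -(pair_bigA _ (fun s (c : W) => F s)) /= avE; congr (_ * _).
rewrite mulr_sumr; apply: eq_bigr => s _.
by rewrite sumr_const -[X in _ = _ * X]mulr_natl mulKf // pnatr_eq0 -lt0n.
Qed.

Lemma av_coord (x : V) (G : W -> R) : av (fun s : {ffun V -> W} => G (s x)) = av G.
Proof.
rewrite (av_upd x) (eq_av (G := fun=> av G)) ?av_cst ?ffun_card_gt0 // => s.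
by apply: eq_av => c; rewrite updE eqxx.
Qed.

Lemma av_coord2 (x y : V) (G : W -> W -> R) : x != y ->
  av (fun s : {ffun V -> W} => G (s x) (s y)) = av (fun u => av (G u)).
Proof.
move=> xy; rewrite (av_upd y) -(av_coord x); apply: eq_av => s.
by apply: eq_av => c; rewrite !updE eqxx (negbTE xy).
Qed.

End Averages.

(** * Replacing the edges of a subgraph one at a time *)

Section PairTelescope.
Variable R : comRingType.
Implicit Types (X A m : nat -> R).

Definition pair_weight (U : Type) (k l : nat) (X A m : nat -> U) (j : nat) : U :=
  if (j == k) || (j == l) then m j else if (j < k)%N then X j else A j.

Lemma prod_telescope X A m r : (forall j, X j = A j + m j) ->
  \prod_(j < r) X j = \prod_(j < r) A j
    + \sum_(k < r) \prod_(j < r) (if j == k :> nat then m j else if (j < k)%N then X j else A j).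
Proof.
move=> XE; elim: r => [|r IH]; first by rewrite !big_ord0 addr0.
rewrite !big_ord_recr /= (XE r) mulrDr {1}IH mulrDl -addrA; congr (_ + _).
rewrite mulr_suml; congr (_ + _).
  apply: eq_bigr => k _; rewrite big_ord_recr /= gtn_eqF ?ltn_ord //.
  by rewrite ltnNge ltnW.
rewrite eqxx; congr (_ * _); apply: eq_bigr => j _.
by rewrite ltn_eqF ?ltn_ord.
Qed.

(** An exact second-order expansion: in the telescoped product the factors [X] left of the marked
    place are telescoped once more. The remainder is quadratic in [m] and still contains true
    factors [X], so no higher orders appear. *)
Lemma pair_telescope X A m r : (forall j, X j = A j + m j) ->
  \prod_(j < r) X j =
  \prod_(j < r) A j
  + \sum_(l < r) \prod_(j < r) (if j == l :> nat then m j else A j)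
  + \sum_(l < r) \sum_(k < l) \prod_(j < r) pair_weight k l X A m j.
Proof.
move=> XE; elim: r => [|r IH]; first by rewrite !big_ord0 !addr0.
have E1 : \sum_(l < r.+1) \prod_(j < r.+1) (if j == l :> nat then m j else A j) =
    (\sum_(l < r) \prod_(j < r) (if j == l :> nat then m j else A j)) * A r
    + \prod_(j < r) A j * m r.
  rewrite big_ord_recr /= mulr_suml; congr (_ + _).
    by apply: eq_bigr => l _; rewrite big_ord_recr /= gtn_eqF.
  rewrite big_ord_recr /= eqxx; congr (_ * _); apply: eq_bigr => j _.
  by rewrite ltn_eqF.
have E2 : \sum_(l < r.+1) \sum_(k < l) \prod_(j < r.+1) pair_weight k l X A m j =
    (\sum_(l < r) \sum_(k < l) \prod_(j < r) pair_weight k l X A m j) * A r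
    + (\sum_(k < r) \prod_(j < r) (if j == k :> nat then m j else if (j < k)%N then X j else A j)) * m r.
  rewrite big_ord_recr /= !mulr_suml; congr (_ + _).
    apply: eq_bigr => l _; rewrite mulr_suml; apply: eq_bigr => k _.
    rewrite big_ord_recr /= [X in _ * X]/pair_weight.
    have kl := ltn_ord k; have lr := ltn_ord l.
    by rewrite !gtn_eqF ?(ltn_trans kl) //= ltnNge ltnW ?(ltn_trans kl).
  apply: eq_bigr => k _.
  rewrite big_ord_recr /= {2}/pair_weight eqxx orbT; congr (_ * _); apply: eq_bigr => j _.
  by rewrite /pair_weight [X in _ || X]ltn_eqF ?orbF.
rewrite [LHS]big_ord_recr /= (XE r) mulrDr {1}IH (prod_telescope r XE).
rewrite [\prod_(j < r.+1) _]big_ord_recr /= E1 E2.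
ring.
Qed.

End PairTelescope.

Section Replacement.
Variables (R : realType) (V W : finType).
Hypothesis W0 : (0 < #|W|)%N.
Implicit Types (Z : W -> W -> R).

(** Bounds the operator norm of [Z] on L^2 by [eps] (for [eps >= 0]). Unlike the cut norm it accepts
    unbounded test functions and keeps their L^2 sizes, which is how the squared drift enters the
    error terms. *)
Definition bilinear_small (eps : R) Z :=
  forall al be : W -> R,
    (av (fun u => av (fun w => Z u w * (al u * be w)))) ^+ 2
      <= eps ^+ 2 * (av (fun u => al u ^+ 2) * av (fun w => be w ^+ 2)).

Variables (g : nat -> V * V) (r : nat).

Definition touches (j : nat) (c : V) := (c == (g j).1) || (c == (g j).2).

(* The listing g orients each edge arbitrarily; the last clause says that no two indices list the same
   unordered pair. *)
Definition simple_edges :=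
  (forall j, (j < r)%N -> (g j).1 != (g j).2) /\
  (forall i j, (i < r)%N -> (j < r)%N -> i != j ->
     forall c d, c != d -> touches i c -> touches i d -> touches j c -> ~~ touches j d).

Definition ev (M : W -> W -> R) (j : nat) (s : {ffun V -> W}) : R :=
  M (s (g j).1) (s (g j).2).

Lemma prod_le_factor (I : finType) (P : pred I) (y : I -> R) (B : R) (n : nat) k :
  1 <= B -> (#|I| <= n)%N -> (forall i, 0 <= y i <= B) -> P k ->
  \prod_(i | P i) y i <= B ^+ n * y k.
Proof.
move=> B1 In yB Pk; rewrite (bigD1 k) //= mulrC ler_wpM2r //.
  by have /andP[] := yB k.
apply: (@le_trans _ _ (\prod_(i | P i && (i != k)) B)).
  by apply: ler_prod => i _; apply: yB.
rewrite prodr_const ler_weXn2l //; apply: leq_trans In.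
by apply: max_card.
Qed.

Lemma prod_le_bound (I : finType) (P : pred I) (y : I -> R) (B : R) (n : nat) :
  1 <= B -> (#|I| <= n)%N -> (forall i, 0 <= y i <= B) ->
  \prod_(i | P i) y i <= B ^+ n.
Proof.
move=> B1 In yB.
apply: (@le_trans _ _ (\prod_(i | P i) B)).
  by apply: ler_prod => i _; apply: yB.
by rewrite prodr_const ler_weXn2l //; apply: leq_trans In; apply: max_card.
Qed.

Lemma prod_le_factor2 (I : finType) (P : pred I) (y : I -> R) (B : R) (n : nat) k l :
  1 <= B -> (#|I| <= n)%N -> (forall i, 0 <= y i <= B) -> P k -> P l -> k != l ->
  \prod_(i | P i) y i <= B ^+ n * (y k * y l).
Proof.
move=> B1 In yB Pk Pl kl; rewrite (bigD1 k) //= (bigD1 l) /=; last by rewrite Pl eq_sym.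
rewrite mulrA mulrC ler_wpM2r //.
  by have /andP[? _] := yB k; have /andP[? _] := yB l; rewrite mulr_ge0.
apply: (@le_trans _ _ (\prod_(i | P i && (i != k) && (i != l)) B)).
  by apply: ler_prod => i _; apply: yB.
by rewrite prodr_const ler_weXn2l //; apply: leq_trans In; apply: max_card.
Qed.

Hypothesis gs : simple_edges.

Lemma ev_upd_out M j s c w : ~~ touches j c -> ev M j (upd s c w) = ev M j s.
Proof.
rewrite /touches negb_or => /andP[c1 c2].
by rewrite /ev !updE ![_ == c]eq_sym (negbTE c1) (negbTE c2).
Qed.

Lemma upd_comm (s : {ffun V -> W}) y z u w : y != z ->
  upd (upd s y u) z w = upd (upd s z w) y u.
Proof.
move=> yz; apply/ffunP => c; rewrite !updE.
by case: eqP => [->|//]; case: eqP => // zy; rewrite zy eqxx in yz.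
Qed.

(** Only the ends of edge [i] are resampled. The operator norm of [Wt i] yields [eps], and each of
    the two edges carrying [m] must supply its own mean square. This would fail if both met [i] at
    the same end, where the two squares depend on the same variable; the last hypothesis excludes
    that. *)
Lemma replacement_bound (Wt : nat -> W -> W -> R) (m : W -> W -> R) (eps : R)
    (i k l : nat) :
  (i < r)%N -> (k < r)%N -> (l < r)%N -> i != k -> i != l -> k != l ->
  (forall j u w, `|Wt j u w| <= 2) -> Wt k = m -> Wt l = m -> 0 <= eps ->
  bilinear_small eps (Wt i) ->
  (forall c, touches i c -> touches k c -> ~~ touches l c) ->
  `|av (fun s => \prod_(j < r) ev (Wt j) j s)|
     <= eps * 4 ^+ r * av (fun u => av (fun w => m u w ^+ 2)).
Proof.
move=> ir kr lr ik il kl Wb Wk Wl eps0 Wi tc.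
have [gne gdis] := gs.
pose y := (g i).1; pose z := (g i).2; have yz : y != z := gne i ir.
have ty : touches i y by rewrite /touches eqxx.
have tz : touches i z by rewrite /touches eqxx orbT.
pose su (s : {ffun V -> W}) u w := upd (upd s y u) z w.
(* Local energy of edge [e] when only [y] and [z] are resampled; its mean over [s] is the energy of
   [m]. *)
pose S e (s : {ffun V -> W}) := av (fun u => av (fun w => (ev m e (su s u w)) ^+ 2)).
have SE e : (e < r)%N -> av (S e) = av (fun u => av (fun w => m u w ^+ 2)).
  move=> er; rewrite -(av_coord2 W0 (fun u w => m u w ^+ 2) (gne e er)).
  rewrite [RHS](av_upd W0 z) [RHS](av_upd W0 y).
  by apply: eq_av => s; rewrite /S; apply: eq_av => u.
rewrite (av_upd W0 z) (av_upd W0 y).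
apply: (le_trans (ler_norm_av (ffun_card_gt0 V W0) _)).
have -> : eps * 4 ^+ r * av (fun u => av (fun w => m u w ^+ 2)) =
   av (fun s => eps * 4 ^+ r * ((S k s + S l s) / 2)).
  by rewrite avZ avZr avD !SE //; field.
apply: ler_av => [|s]; first exact: ffun_card_gt0.
have S0 e s' : 0 <= S e s'.
  by apply: av_ge0 => // u; apply: av_ge0 => // w; apply: sqr_ge0.
(* No other edge joins [y] to [z], so the remaining product splits into a function of [u] (edges at
   [y]) and a function of [w] (all the others). *)
pose al u := \prod_(j < r | (j != i :> nat) && touches j y) ev (Wt j) j (upd s y u).
pose be w := \prod_(j < r | (j != i :> nat) && ~~ touches j y) ev (Wt j) j (upd s z w).
have fac u w : \prod_(j < r) ev (Wt j) j (su s u w) = Wt i u w * (al u * be w).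
  rewrite (bigD1 (Ordinal ir)) //=; congr (_ * _).
    by rewrite /ev /su !updE -/y -/z (negbTE yz) !eqxx.
  rewrite (bigID (fun j : 'I_r => touches j y)) /=; congr (_ * _).
    apply: eq_bigr => j /andP[ji tj]; rewrite /su ev_upd_out //.
    by apply: (gdis i j _ _ _ y z) => //; rewrite eq_sym.
  by apply: eq_bigr => j /andP[ji tj]; rewrite /su upd_comm // ev_upd_out.
rewrite (eq_av (G := fun u => av (fun w => Wt i u w * (al u * be w)))); last first.
  by move=> u; apply: eq_av => w; rewrite -fac.
set X := av _; have X2 : X ^+ 2 <= _ := Wi al be.
have sq4 e t : 0 <= ev (Wt e) e t ^+ 2 <= 4.
  rewrite sqr_ge0 /=; have := Wb e (t (g e).1) (t (g e).2).
  by rewrite /ev -real_normK ?num_real // => h; have := normr_ge0 (Wt e (t (g e).1) (t (g e).2)); nra.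
have cI : (#|'I_r| <= r)%N by rewrite card_ord.
have one4 : 1 <= 4 :> R by lra.
have al_ge0 : 0 <= av (fun u => al u ^+ 2) by apply: av_ge0 => // u; apply: sqr_ge0.
have be_ge0 : 0 <= av (fun u => be u ^+ 2) by apply: av_ge0 => // u; apply: sqr_ge0.
have al1 : av (fun u => al u ^+ 2) <= 4 ^+ r.
  rewrite -[leRHS](@av_cst R W) //; apply: ler_av => // u.
  by rewrite /al -prodrXl; apply: prod_le_bound.
have alk e : (e < r)%N -> e != i -> Wt e = m -> touches e y ->
    av (fun u => al u ^+ 2) <= 4 ^+ r * S e s.
  move=> er ei We te; rewrite /S -avZ; apply: ler_av => // u.
  rewrite (eq_av (G := fun=> ev m e (upd s y u) ^+ 2)); last first.
    move=> w; rewrite /su ev_upd_out //.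
    by apply: (gdis i e _ _ _ y z) => //; rewrite eq_sym.
  rewrite av_cst // /al -prodrXl -[in X in _ <= X]We.
  pose yy (j : 'I_r) := ev (Wt j) j (upd s y u) ^+ 2.
  by apply: (@prod_le_factor _ _ yy 4 r (Ordinal er)) => // [j|/=];
    rewrite ?ei ?te //; exact: sq4.
have bek e : (e < r)%N -> e != i -> Wt e = m -> ~~ touches e y ->
    av (fun u => be u ^+ 2) <= 4 ^+ r * S e s.
  move=> er ei We te; rewrite /S av_exchange -avZ; apply: ler_av => // w.
  rewrite (eq_av (G := fun=> ev m e (upd s z w) ^+ 2)); last first.
    by move=> u; rewrite /su upd_comm // ev_upd_out.
  rewrite av_cst // /be -prodrXl -[in X in _ <= X]We.
  pose yy (j : 'I_r) := ev (Wt j) j (upd s z w) ^+ 2.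
  by apply: (@prod_le_factor _ _ yy 4 r (Ordinal er)) => // [j|/=];
    rewrite ?ei ?te //; exact: sq4.
(* Both marked edges fall into [be]; the one that misses [z] is constant there and leaves the
   average. *)
have both e f : (e < r)%N -> e != i -> Wt e = m -> ~~ touches e y ->
    (f < r)%N -> f != i -> Wt f = m -> ~~ touches f y -> e != f -> ~~ touches f z ->
    av (fun u => be u ^+ 2) <= 4 ^+ r * (S e s * S f s).
  move=> er ei We te fr fi Wf tf ef tfz.
  have -> : S f s = ev m f s ^+ 2.
    rewrite /S (eq_av (G := fun=> ev m f s ^+ 2)) ?av_cst // => u.
    rewrite (eq_av (G := fun=> ev m f s ^+ 2)) ?av_cst // => w.
    by rewrite /su !ev_upd_out.
  rewrite /S av_exchange -avZr -avZ; apply: ler_av => // w.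
  rewrite (eq_av (G := fun=> ev m e (upd s z w) ^+ 2)); last first.
    by move=> u; rewrite /su upd_comm // ev_upd_out.
  have -> : ev m f s ^+ 2 = ev m f (upd s z w) ^+ 2 by rewrite ev_upd_out.
  rewrite av_cst // /be -prodrXl -[in X in _ <= _ * (X * _)]We -[in X in _ <= _ * (_ * X)]Wf.
  pose yy (j : 'I_r) := ev (Wt j) j (upd s z w) ^+ 2.
  by apply: (@prod_le_factor2 _ _ yy 4 r (Ordinal er) (Ordinal fr)) => // [j|/=|/=];
    rewrite ?ei ?te ?fi ?tf //; exact: sq4.
have key : av (fun u => al u ^+ 2) * av (fun u => be u ^+ 2) <= (4 ^+ r) ^+ 2 * (S k s * S l s).
  have -> : (4 ^+ r) ^+ 2 * (S k s * S l s) = (4 ^+ r * S k s) * (4 ^+ r * S l s) by ring.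
  have ki : k != i by rewrite eq_sym.
  have li : l != i by rewrite eq_sym.
  case: (boolP (touches k y)) => tk.
    by apply: ler_pM => //; [apply: alk|apply: bek => //; apply: tc].
  case: (boolP (touches l y)) => tl.
    by rewrite [leRHS]mulrC; apply: ler_pM => //; [apply: alk|apply: bek].
  have -> : (4 ^+ r * S k s) * (4 ^+ r * S l s) = 4 ^+ r * (4 ^+ r * (S k s * S l s)).
    by ring.
  apply: ler_pM => //.
  case: (boolP (touches l z)) => tlz; last by apply: both.
  rewrite [S k s * _]mulrC; apply: both => //; first by rewrite eq_sym.
  by apply/negP => tkz; have := tc z tz tkz; rewrite tlz.
have fin : X ^+ 2 <= (eps * 4 ^+ r * ((S k s + S l s) / 2)) ^+ 2.
  apply: (le_trans X2).
  have -> : (eps * 4 ^+ r * ((S k s + S l s) / 2)) ^+ 2 =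
     eps ^+ 2 * ((4 ^+ r) ^+ 2 * (((S k s + S l s) / 2) ^+ 2)) by ring.
  rewrite ler_wpM2l ?sqr_ge0 //; apply: (le_trans key).
  rewrite ler_wpM2l ?sqr_ge0 //; have := sqr_ge0 (S k s - S l s); nra.
rewrite -(@ler_pXn2r _ 2) ?nnegrE //; last first.
  by rewrite !mulr_ge0 ?addr_ge0 ?exprn_ge0.
by rewrite real_normK ?num_real.
Qed.

End Replacement.

Lemma hybrid_bound (R : realType) (Q : nat -> R) (r : nat) (c : R) :
  (forall i, (i < r)%N -> `|Q i - Q i.+1| <= c) -> `|Q 0 - Q r| <= r%:R * c.
Proof.
move=> h; elim: r h => [|r IH] h; first by rewrite subrr normr0 mul0r.
have -> : Q 0 - Q r.+1 = (Q 0 - Q r) + (Q r - Q r.+1) by ring.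
apply: (le_trans (ler_normD _ _)); rewrite -natr1 mulrDl mul1r lerD ?h //.
by apply: IH => i ir; apply: h; rewrite ltnS ltnW.
Qed.

Lemma prod_hybrid_diff (R : comRingType) (r i : nat) (x y : nat -> R) : (i < r)%N ->
  \prod_(j < r) (if (j < i)%N then y j else x j)
    - \prod_(j < r) (if (j < i.+1)%N then y j else x j)
  = \prod_(j < r) (if j == i :> nat then x i - y i else if (j < i)%N then y j else x j).
Proof.
move=> ir; have D1 (F : 'I_r -> R) := bigD1 (Ordinal ir) (F := F) (P := xpredT) isT.
rewrite !D1 /= ltnn ltnSn eqxx mulrBl; congr (_ * _ - _ * _);
  apply: eq_bigr => j; rewrite -val_eqE /= => /negbTE ji; rewrite ji //.
by rewrite ltnS leq_eqVlt ji.
Qed.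

Lemma prod_pair_const (R : comRingType) (r k l : nat) (y p : R) :
  (k < r)%N -> (l < r)%N -> k != l ->
  \prod_(j < r) (if (j == k :> nat) || (j == l :> nat) then y else p) = p ^+ (r - 2) * y ^+ 2.
Proof.
move=> kr lr kl; pose P := pred2 (Ordinal kr) (Ordinal lr).
have cP : #|P| = 2 by rewrite card2 -val_eqE /= kl.
have cPC : #|predC P| = (r - 2)%N by rewrite -[r in RHS]card_ord -(cardC P) cP addKn.
rewrite (bigID P) /= mulrC; congr (_ * _).
  rewrite (eq_bigr (fun=> p)); last by move=> j; rewrite /P /= -!val_eqE /= => /negbTE ->.
  by rewrite prodr_const -cPC.
rewrite (eq_bigr (fun=> y)); last by move=> j; rewrite /P /= -!val_eqE /= => ->.
by rewrite prodr_const cP.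
Qed.

Section PairSum.
Variables (R : realType) (V W : finType).
Hypothesis W0 : (0 < #|W|)%N.
Variables (g : nat -> V * V) (r : nat).
Hypothesis gs : simple_edges g r.
Implicit Types (s : {ffun V -> W}).

Definition shares (k l : nat) := [exists c : V, touches g k c && touches g l c].

Definition keep_near (C : pred V) (k l : nat) (Wt : nat -> W -> W -> R) (p : R) (j : nat) :=
  if (j == k) || (j == l) || (C (g j).1 || C (g j).2) then Wt j else fun _ _ => p.

(** A replaced edge avoids [C], hence every common vertex of [k] and [l], which is the last
    hypothesis of [replacement_bound]. *)
Lemma constant_replacement (Wt : nat -> W -> W -> R) (m : W -> W -> R) (p eps : R)
    (k l : nat) (C : pred V) :
  (k < r)%N -> (l < r)%N -> k != l -> 0 <= eps -> 0 <= p <= 1 ->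
  (forall j u w, `|Wt j u w| <= 2) -> (forall j u w, `|Wt j u w - p| <= 2) ->
  Wt k = m -> Wt l = m ->
  (forall j, j != k -> j != l -> bilinear_small eps (fun u w => Wt j u w - p)) ->
  (forall c, touches g k c -> touches g l c -> C c) ->
  `|av (fun s => \prod_(j < r) ev g (Wt j) j s)
    - av (fun s => \prod_(j < r) ev g (keep_near C k l Wt p j) j s)|
    <= r%:R * (eps * 4 ^+ r * av (fun u => av (fun w => m u w ^+ 2))).
Proof.
move=> kr lr kl eps0 p01 Wb Wpb Wk Wl Ws tC; pose Kt := keep_near C k l Wt p; rewrite -/Kt.
pose Q i := av (fun s => \prod_(j < r) ev g (if (j < i)%N then Kt j else Wt j) j s).
have -> : av (fun s => \prod_(j < r) ev g (Kt j) j s) = Q r.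
  by apply: eq_av => s; apply: eq_bigr => j _; rewrite ltn_ord.
apply: (@hybrid_bound _ Q) => i ir.
have S0 : 0 <= eps * 4 ^+ r * av (fun u => av (fun w => m u w ^+ 2)).
  rewrite !mulr_ge0 ?exprn_ge0 //; apply: av_ge0 => // u; apply: av_ge0 => // w.
  exact: sqr_ge0.
pose Wi j := if j == i then (fun u w => Wt i u w - Kt i u w)
             else if (j < i)%N then Kt j else Wt j.
have -> : Q i - Q i.+1 = av (fun s => \prod_(j < r) ev g (Wi j) j s).
  rewrite /Q -avB; apply: eq_av => s.
  pose x j := ev g (Wt j) j s; pose y j := ev g (Kt j) j s.
  rewrite (eq_bigr (fun j : 'I_r => if (j < i)%N then y j else x j)); last first.
    by move=> j _; case: ifP.
  rewrite [X in _ - X](eq_bigr (fun j : 'I_r => if (j < i.+1)%N then y j else x j)); last first.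
    by move=> j _; case: ifP.
  rewrite prod_hybrid_diff //; apply: eq_bigr => j _; rewrite /Wi.
  by case: eqP => [->//|_]; case: ifP.
have [Ki|Ki] := boolP ((i == k) || (i == l) || (C (g i).1 || C (g i).2)).
  rewrite (eq_av (G := fun=> 0)) ?av_cst ?ffun_card_gt0 ?normr0 // => s.
  by rewrite (bigD1 (Ordinal ir)) //= /Wi eqxx /Kt /keep_near Ki /ev subrr mul0r.
move: Ki; rewrite !negb_or => /andP[/andP[ik il] /andP[C1 C2]].
have KiE : Kt i = fun _ _ => p by rewrite /Kt /keep_near (negbTE ik) (negbTE il) (negbTE C1) (negbTE C2).
have pb : `|p| <= 2 by have /andP[? ?] := p01; rewrite ger0_norm //; lra.
have Kb j u w : `|Kt j u w| <= 2 by rewrite /Kt /keep_near; case: ifP.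
apply: (replacement_bound W0 gs ir kr lr) => // [j u w||||c].
- by rewrite /Wi; case: eqP => [_|_]; [rewrite KiE|case: ifP].
- by rewrite /Wi eq_sym (negbTE ik); case: ifP => // _; rewrite /Kt /keep_near eqxx.
- by rewrite /Wi eq_sym (negbTE il); case: ifP => // _; rewrite /Kt /keep_near eqxx orbT.
- by rewrite /Wi eqxx KiE; apply: Ws.
- move=> ti tk; apply/negP => tl; have Cc := tC c tk tl.
  by move: ti; rewrite /touches => /orP[] /eqP E; move: C1 C2; rewrite -E Cc.
Qed.

(** Distinct edges at [c] have distinct other ends, so given the image of [c] their factors are
    independent; the far ends are averaged out one after the other. *)
Lemma star_average (Wt : nat -> W -> W -> R) (q : nat -> R) (c : V) :
  (forall j u w, Wt j u w = Wt j w u) ->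
  av (fun s => \prod_(j < r) (if touches g j c then ev g (Wt j) j s else q j))
  = av (fun b => \prod_(j < r) (if touches g j c then av (Wt j b) else q j)).
Proof.
move=> Wsym; have [gne gdis] := gs.
pose F i j s := if touches g j c then (if (j < i)%N then av (Wt j (s c)) else ev g (Wt j) j s)
                else q j.
pose Q i := av (fun s => \prod_(j < r) F i j s).
have step i : (i < r)%N -> Q i = Q i.+1.
  move=> ir; have [ti|ti] := boolP (touches g i c); last first.
    apply: eq_av => s; apply: eq_bigr => j _; rewrite /F.
    case: ifP => // tj; rewrite [in RHS]ltnS [in RHS]leq_eqVlt; case: eqP => // ji.
    by move: ti; rewrite -ji tj.
  pose o := if c == (g i).1 then (g i).2 else (g i).1.
  have gi := gne i ir.
  have co : c != o.
    move: ti; rewrite /o /touches; case: eqP => [->//|_] /= /eqP ->.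
    by rewrite eq_sym.
  have to : touches g i o by rewrite /o /touches; case: ifP; rewrite eqxx ?orbT.
  have evi s w : ev g (Wt i) i (upd s o w) = Wt i (s c) w.
    move: ti co; rewrite /ev /touches /o !updE; case: eqP => [-> _ _|_ /= /eqP -> _].
      by rewrite eqxx (negbTE gi).
    by rewrite eqxx eq_sym (negbTE gi) Wsym.
  rewrite {1}/Q (av_upd W0 o); apply: eq_av => s.
  pose rest := \prod_(j < r | j != Ordinal ir) F i j s.
  rewrite (eq_av (G := fun w => Wt i (s c) w * rest)); last first.
    move=> w; rewrite (bigD1 (Ordinal ir)) //= {1}/F /= ti ltnn evi; congr (_ * _).
    apply: eq_bigr => j ji; rewrite /F; case: ifP => // tj.
    rewrite updE (negbTE co); case: ifP => // _; rewrite ev_upd_out //.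
    by apply: (gdis i j _ _ _ c o) => //; rewrite eq_sym.
  rewrite avZr [RHS](bigD1 (Ordinal ir)) //= {1}/F /= ti ltnSn; congr (_ * _).
  apply: eq_bigr => j ji; rewrite /F [in RHS]ltnS [in RHS]leq_eqVlt.
  by move: ji; rewrite -val_eqE /= => /negbTE ->.
have QE i : (i <= r)%N -> Q 0 = Q i.
  by elim: i => // i IH ir; rewrite (IH (ltnW ir)) step.
transitivity (Q 0).
  by apply: eq_av => s; apply: eq_bigr => j _; rewrite /F ltn0.
rewrite (QE r) // /Q.
rewrite -(av_coord W0 c (fun b => \prod_(j < r) (if touches g j c then av (Wt j b) else q j))).
by apply: eq_av => s; apply: eq_bigr => j _; rewrite /F ltn_ord.
Qed.

Lemma edge_average (M : W -> W -> R) (F : {ffun V -> W} -> R) k : (k < r)%N ->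
  (forall s c w, touches g k c -> F (upd s c w) = F s) ->
  av (fun s => ev g M k s * F s) = av (fun u => av (M u)) * av F.
Proof.
have [gne _] := gs; move=> kr Finv; have gk := gne k kr.
have t1 : touches g k (g k).1 by rewrite /touches eqxx.
have t2 : touches g k (g k).2 by rewrite /touches eqxx orbT.
rewrite (av_upd W0 (g k).2) (av_upd W0 (g k).1) -avZ; apply: eq_av => s.
rewrite -avZr; apply: eq_av => u; rewrite -avZr; apply: eq_av => w.
by rewrite !Finv // /ev !updE eqxx (negbTE gk) eqxx.
Qed.

Lemma disjoint_pair_average (m : W -> W -> R) (p : R) k l :
  (k < r)%N -> (l < r)%N -> k != l -> ~~ shares k l ->
  av (fun s => \prod_(j < r) ev g (if (j == k :> nat) || (j == l :> nat) then m else fun _ _ => p) j s)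
  = p ^+ (r - 2) * av (fun u => av (m u)) ^+ 2.
Proof.
move=> kr lr kl /existsPn nsh.
rewrite -(prod_pair_const _ _ kr lr kl).
have lk : Ordinal lr != Ordinal kr by rewrite -val_eqE /= eq_sym.
rewrite [RHS](bigD1 (Ordinal kr)) //= eqxx [X in _ = _ * X](bigD1 (Ordinal lr)) //= eqxx orbT.
set P := \prod_(j < r | _) _.
rewrite (eq_av (G := fun s => ev g m k s * (ev g m l s * P))); last first.
  move=> s; rewrite (bigD1 (Ordinal kr)) //= eqxx; congr (_ * _).
  rewrite (bigD1 (Ordinal lr)) //= eqxx orbT; congr (_ * _); apply: eq_bigr => j.
  rewrite -!val_eqE /= => /andP[/negbTE -> /negbTE ->] //.
rewrite (edge_average _ kr); last first.
  move=> s c w tk; congr (_ * _); apply: ev_upd_out.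
  by have := nsh c; rewrite tk.
congr (_ * _); rewrite avZr; congr (_ * _); rewrite -[LHS]mulr1.
rewrite (eq_av (G := fun s => ev g m l s * 1)); last by move=> s; rewrite mulr1.
by rewrite (edge_average _ lr) // av_cst ?ffun_card_gt0 // !mulr1.
Qed.

Variable p : R.
Hypothesis p01 : 0 <= p <= 1.

(** Value of a marked pair once each factor at [c] is replaced by its mean along a row with drift
    mean [t], and all others by [p]. It is 0 unless both marked edges contain [c], so a sum over all
    [c] singles out the shared vertex. *)
Definition star_term (k l : nat) (c : V) (t : R) : R :=
  \prod_(j < r) pair_weight k l (fun j => p + t * (touches g j c)%:R) (fun=> p)
                   (fun j => t * (touches g j c)%:R) j.

Lemma star_term_shared k l c t : (k < r)%N -> (l < r)%N -> k != l ->
  touches g k c -> touches g l c ->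
  \sum_d star_term k l d t = star_term k l c t.
Proof.
move=> kr lr kl tk tl; have [_ gdis] := gs.
rewrite (bigD1 c) //= big1 ?addr0 // => d dc; rewrite /star_term.
have [td|td] := boolP (touches g k d); last first.
  by rewrite (bigD1 (Ordinal kr)) //= /pair_weight eqxx (negbTE td) mulr0 mul0r.
have ntd : ~~ touches g l d by apply: (gdis k l _ _ _ c d) => //; rewrite eq_sym.
by rewrite (bigD1 (Ordinal lr)) //= /pair_weight eqxx orbT (negbTE ntd) mulr0 mul0r.
Qed.

Lemma star_term_disjoint k l t : (k < r)%N -> (l < r)%N -> ~~ shares k l ->
  \sum_d star_term k l d t = 0.
Proof.
move=> kr lr /existsPn nsh; rewrite big1 // => d _; rewrite /star_term.
have [td|td] := boolP (touches g k d); last first.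
  by rewrite (bigD1 (Ordinal kr)) //= /pair_weight eqxx (negbTE td) mulr0 mul0r.
have := nsh d; rewrite td /= => ntd.
by rewrite (bigD1 (Ordinal lr)) //= /pair_weight eqxx orbT (negbTE ntd) mulr0 mul0r.
Qed.

Variables (X A m : W -> W -> R) (eps : R).
Hypothesis XE : forall u w, X u w = A u w + m u w.
Hypotheses (Asym : forall u w, A u w = A w u) (msym : forall u w, m u w = m w u).
Hypotheses (Xb : forall u w, `|X u w| <= 2) (Ab : forall u w, `|A u w| <= 2).
Hypothesis mb : forall u w, `|m u w| <= 1.
Hypotheses (Xpb : forall u w, `|X u w - p| <= 2) (Apb : forall u w, `|A u w - p| <= 2).
Hypotheses (eps0 : 0 <= eps)
  (Xs : bilinear_small eps (fun u w => X u w - p))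
  (As : bilinear_small eps (fun u w => A u w - p)).

Definition row (b : W) : R := av (m b).
Definition noise (b : W) : R := av (fun w => A b w - p).
Definition energy : R := av (fun u => av (fun w => m u w ^+ 2)).

Lemma row_bound b : `|row b| <= 1.
Proof. exact: av_norm_le. Qed.

Definition pair_average (k l : nat) : R :=
  av (fun s => \prod_(j < r) ev g (pair_weight k l (fun=> X) (fun=> A) (fun=> m) j) j s).

(** Every factor away from a shared vertex becomes [p] at a cost of [eps] times the energy. At a
    shared vertex the surviving factors average to row means; dropping the noise from one of them
    costs [|noise| |row|], because a marked factor still supplies a row mean. *)
Lemma pair_average_bound k l : (k < l)%N -> (l < r)%N ->
  pair_average k l <=
    (if shares k l then av (fun b => \sum_c star_term k l c (row b))
     else p ^+ (r - 2) * av row ^+ 2)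
    + r%:R * (eps * 4 ^+ r * energy)
    + r%:R * (2 ^+ r * av (fun b => `|noise b| * `|row b|)).
Proof.
move=> kl lr; have kr := ltn_trans kl lr; have knl : k != l by rewrite ltn_eqF.
have [p0 p1] := andP p01.
pose Wt := pair_weight k l (fun=> X) (fun=> A) (fun=> m).
have Wk : Wt k = m by rewrite /Wt /pair_weight eqxx.
have Wl : Wt l = m by rewrite /Wt /pair_weight eqxx orbT.
have Wb j u w : `|Wt j u w| <= 2.
  rewrite /Wt /pair_weight; case: ifP => _; last by case: ifP.
  by apply: le_trans (mb _ _) _; lra.
have Wpb j u w : `|Wt j u w - p| <= 2.
  rewrite /Wt /pair_weight; case: ifP => _; last by case: ifP.
  by have := mb u w; rewrite !ler_norml => /andP[? ?]; lra.
have Ws j : j != k -> j != l -> bilinear_small eps (fun u w => Wt j u w - p).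
  by move=> /negbTE jk /negbTE jl; rewrite /Wt /pair_weight jk jl; case: ifP.
have Wsym j u w : Wt j u w = Wt j w u.
  by rewrite /Wt /pair_weight; case: ifP => // _; case: ifP; rewrite ?XE 1?Asym 1?msym.
have N0 : 0 <= r%:R * (2 ^+ r * av (fun b => `|noise b| * `|row b|)).
  by rewrite !mulr_ge0 ?exprn_ge0 //; apply: av_ge0 => // b; rewrite mulr_ge0.
case: ifPn => [/existsP[c /andP[tk tl]]|nsh]; last first.
  have tC c : touches g k c -> touches g l c -> pred0 c.
    by move=> tk tl; move/existsPn: nsh => /(_ c); rewrite tk tl.
  have := constant_replacement kr lr knl eps0 p01 Wb Wpb Wk Wl Ws tC.
  rewrite /= [X in `|_ - X|](_ : _ = p ^+ (r - 2) * av row ^+ 2); last first.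
    rewrite -(disjoint_pair_average m p kr lr knl nsh); apply: eq_av => s.
    apply: eq_bigr => j _. rewrite /keep_near /= orbF /Wt /pair_weight. by case: ifP => h; rewrite ?h.
  rewrite ler_norml lerBlDl => /andP[_ h]; rewrite -/energy in h.
  by apply: le_trans h _; rewrite lerDl.
have [_ gdis] := gs.
have tC d : touches g k d -> touches g l d -> pred1 c d.
  move=> dk dl; apply/negPn/negP => /= dc.
  by have := gdis k l kr lr knl d c dc dk tk dl; rewrite tl.
have := constant_replacement kr lr knl eps0 p01 Wb Wpb Wk Wl Ws tC.
rewrite /= [X in `|_ - X|](_ : _ =
    av (fun b => \prod_(j < r) (if touches g j c then av (Wt j b) else p))); last first.
  rewrite -(star_average _ c Wsym); apply: eq_av => s; apply: eq_bigr => j _.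
  rewrite /keep_near /=.
  have -> : ((g j).1 == c) || ((g j).2 == c) = touches g j c.
    by rewrite /touches ![c == _]eq_sym.
  case: (boolP (touches g j c)) => [_|tj]; first by rewrite orbT.
  rewrite orbF; case: ifP => // /orP[] /eqP E.
    by rewrite E tk in tj.
  by rewrite E tl in tj.
rewrite ler_norml lerBlDl => /andP[_ h]; rewrite -/energy in h.
apply: (le_trans h); rewrite -addrA [X in _ <= _ + X]addrC addrA lerD2r.
rewrite -!avZ -avD; apply: ler_av => // b; rewrite (star_term_shared _ kr lr knl tk tl).
pose P j := if touches g j c then av (Wt j b) else p.
pose P' j := pair_weight k l (fun j => p + row b * (touches g j c)%:R) (fun=> p)
                   (fun j => row b * (touches g j c)%:R) j.
have rb := row_bound b.
have avA : av (A b) = p + noise b by rewrite /noise avB av_cst // addrC subrK.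
have avX : av (X b) = p + row b + noise b.
  by rewrite (eq_av (XE b)) avD avA /row addrAC.
have Pb j : `|P j| <= 2.
  rewrite /P; case: ifP => _; first exact: av_norm_le.
  by rewrite ger0_norm //; lra.
have P'b j : `|P' j| <= 2.
  move: rb; rewrite /P' /pair_weight ler_norml => /andP[? ?].
  case: ifP => _; first by rewrite ler_norml; case: (touches g j c) => /=; apply/andP; split; lra.
  case: ifP => _; last by rewrite ger0_norm //; lra.
  by rewrite ler_norml; case: (touches g j c) => /=; apply/andP; split; lra.
have PkE : P k = row b by rewrite /P tk Wk.
have P'kE : P' k = row b by rewrite /P' /pair_weight eqxx tk mulr1.
have PlE : P l = row b by rewrite /P tl Wl.
have P'lE : P' l = row b by rewrite /P' /pair_weight eqxx orbT tl mulr1.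
have dP j : j != k -> j != l -> `|P j - P' j| <= `|noise b|.
  move=> /negbTE jk /negbTE jl; rewrite /P /P' /Wt /pair_weight jk jl.
  case: ifP => tj; last by case: ifP => _; rewrite ?mulr0 ?addr0 subrr normr0.
  case: ifP => _; first by rewrite avX mulr1 addrAC subrr add0r.
  by rewrite avA addrAC subrr add0r.
have : `|\prod_(j < r) P j - \prod_(j < r) P' j| <= r%:R * (2 ^+ r * (`|noise b| * `|row b|)).
  pose Q i := \prod_(j < r) (if (j < i)%N then P' j else P j).
  have -> : \prod_(j < r) P' j = Q r.
    by apply: eq_bigr => j _; rewrite ltn_ord.
  apply: (@hybrid_bound _ Q) => i ir; rewrite prod_hybrid_diff //.
  have B0 : 0 <= 2 ^+ r * (`|noise b| * `|row b|) by rewrite !mulr_ge0 ?exprn_ge0.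
  have [ik|ik] := eqVneq i k.
    have z0 : P i - P' i = 0 by rewrite ik PkE P'kE subrr.
    by rewrite (bigD1 (Ordinal ir)) //= eqxx z0 mul0r normr0.
  have [il|il] := eqVneq i l.
    have z0 : P i - P' i = 0 by rewrite il PlE P'lE subrr.
    by rewrite (bigD1 (Ordinal ir)) //= eqxx z0 mul0r normr0.
  have nb2 : `|P i - P' i| <= `|noise b| by exact: dP.
  pose z j := if j == i then `|noise b| else
     if (j < i)%N then `|P' j| else `|P j|.
  have noise2 : `|noise b| <= 2 by apply: av_norm_le.
  have zb (j : 'I_r) : 0 <= z j <= 2.
    by rewrite /z; case: ifP => _; [|case: ifP => _]; rewrite normr_ge0 /=.
  rewrite normr_prod.
  apply: (@le_trans _ _ (\prod_(j < r) z j)).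
    apply: ler_prod => j _; rewrite normr_ge0 /= /z.
    by case: ifP => // _; case: ifP.
  have one2 : 1 <= 2 :> R by lra.
  have zi : z i = `|noise b| by rewrite /z eqxx.
  have zk : z k = `|row b|.
    by rewrite /z eq_sym (negbTE ik); case: ifP; rewrite ?PkE ?P'kE.
  have := @prod_le_factor2 R _ xpredT (fun j : 'I_r => z j) 2 r (Ordinal ir) (Ordinal kr)
    one2 _ zb isT isT _.
  by rewrite /= zi zk; apply; rewrite ?card_ord // -val_eqE.
by rewrite ler_norml lerBlDl => /andP[_ +].
Qed.

End PairSum.

(** * Star contributions *)

Section PowerInequalities.
Variable R : realFieldType.
Implicit Types (p q x y : R).

Lemma pow_tangent (d : nat) x y : 0 <= x -> 0 <= y ->
  x ^+ d + d%:R * x ^+ d.-1 * (y - x) <= y ^+ d.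
Proof.
move=> x0 y0; elim: d => [|d IH]; first by rewrite !expr0 !mul0r addr0.
have [->|d0] := posnP d; first by rewrite expr0 !expr1; lra.
have E : x ^+ d = x * x ^+ d.-1 by rewrite -exprS prednK.
rewrite /= exprS [leRHS]exprS -natr1.
have h : y * (x ^+ d + d%:R * x ^+ d.-1 * (y - x)) <= y * y ^+ d by rewrite ler_wpM2l.
apply: le_trans h; rewrite E -subr_ge0.
have -> : y * (x * x ^+ d.-1 + d%:R * x ^+ d.-1 * (y - x)) -
  (x * (x * x ^+ d.-1) + (d%:R + 1) * (x * x ^+ d.-1) * (y - x)) =
  d%:R * x ^+ d.-1 * (y - x) ^+ 2 by ring.
by rewrite mulr_ge0 ?sqr_ge0 // mulr_ge0 ?ler0n ?exprn_ge0.
Qed.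

(* With b_d(q) = q^d - p^d - d p^{d-1} (q - p), the quotient b_d / ((d-1) p^d) increases with d. *)
Lemma bregman_pow_le (d r : nat) p q : (0 < d <= r)%N -> 0 <= p -> 0 <= q ->
  (r.-1)%:R * (p ^+ (r - d) * (q ^+ d - p ^+ d - d%:R * p ^+ d.-1 * (q - p)))
   <= (d.-1)%:R * (q ^+ r - p ^+ r - r%:R * p ^+ r.-1 * (q - p)).
Proof.
move=> /andP[d0 dr] p0 q0.
pose b k := q ^+ k - p ^+ k - k%:R * p ^+ k.-1 * (q - p).
have b_ge0 k : 0 <= b k by have := pow_tangent k p0 q0; rewrite /b; lra.
have step k : k.+1%:R * (p * b k.+1) <= k%:R * b k.+2.
  case: k => [|k]; first by rewrite /b /= !expr1 expr0; nra.
  rewrite -subr_ge0 /b /=.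
  (* The difference is [q] times the gap between the power [k + 2] and its tangent at [q], evaluated
     at [p]. *)
  have -> : k.+1%:R * (q ^+ k.+3 - p ^+ k.+3 - k.+3%:R * p ^+ k.+2 * (q - p)) -
     k.+2%:R * (p * (q ^+ k.+2 - p ^+ k.+2 - k.+2%:R * p ^+ k.+1 * (q - p))) =
     q * (p ^+ k.+2 - (q ^+ k.+2 + k.+2%:R * q ^+ k.+1 * (p - q))).
    rewrite !exprS -[k.+3%:R]natr1 -[k.+2%:R]natr1 -[k.+1%:R]natr1; ring.
  by rewrite mulr_ge0 // subr_ge0; apply: (pow_tangent k.+2 q0 p0).
rewrite -/(b d) -/(b r) -[in X in _ <= X](subnK dr) -[in X in X%:R * _ <= _](subnK dr).
elim: (r - d)%N => [|e IH]; first by rewrite add0n expr0 mul1r.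
case: d d0 {dr} IH => // d _; rewrite !addnS /= => IH.
have st := step (e + d)%N.
have [ed|ed] := posnP (e + d)%N.
  move/eqP: ed; rewrite addn_eq0 => /andP[/eqP -> /eqP ->] /=.
  by rewrite /b /= !expr1 expr0 !mul1r subrr !mulr0 mul0r.
rewrite -(@ler_pM2l _ (e + d)%:R) ?ltr0n //.
apply: (@le_trans _ _ (d%:R * ((e + d).+1%:R * (p * b (e + d).+1)))); last first.
  by rewrite [leRHS]mulrCA ler_wpM2l.
have -> : (e + d)%:R * ((e + d).+1%:R * (p ^+ e.+1 * b d.+1)) =
  ((e + d).+1%:R * p) * ((e + d)%:R * (p ^+ e * b d.+1)) by rewrite exprS; ring.
have -> : d%:R * ((e + d).+1%:R * (p * b (e + d).+1)) =
  ((e + d).+1%:R * p) * (d%:R * b (e + d).+1) by ring.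
by rewrite ler_wpM2l // mulr_ge0.
Qed.

End PowerInequalities.

Section StarSum.
Variables (R : realType) (V : finType) (g : nat -> V * V) (r : nat).
Hypothesis gs : simple_edges g r.
Variable p : R.
Hypothesis p01 : 0 < p < 1.
Let p0 : 0 < p. Proof. by have /andP[] := p01. Qed.

Definition deg (c : V) : nat := #|[pred j : 'I_r | touches g j c]|.

Definition star_sum (t : R) : R :=
  \sum_(l < r) \sum_(k < l) \sum_c star_term g r p k l c t.

Definition bregman (d : nat) (x y : R) : R := y ^+ d - x ^+ d - d%:R * x ^+ d.-1 * (y - x).

Lemma bregman_ge0 d x y : 0 <= x -> 0 <= y -> 0 <= bregman d x y.
Proof. by move=> x0 y0; have := pow_tangent d x0 y0; rewrite /bregman; lra. Qed.

Lemma deg_le c : (deg c <= r)%N.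
Proof. by rewrite -[X in (_ <= X)%N]card_ord max_card. Qed.

(** [pair_telescope] read backwards with constant factors [p]: the second-order part is the product
    minus its constant and linear parts, that is a Bregman gap of the power [deg c]. *)
Lemma star_sumE t :
  star_sum t = \sum_c p ^+ (r - deg c) * bregman (deg c) p (p + t).
Proof.
rewrite /star_sum; under eq_bigr do rewrite exchange_big /=.
rewrite exchange_big /=; apply: eq_bigr => c _.
pose X j := p + t * (touches g j c)%:R.
have := @pair_telescope R X (fun=> p) (fun j => t * (touches g j c)%:R) r (fun=> erefl).
rewrite -/X => E.
have -> : \sum_(l < r) \sum_(k < l) star_term g r p k l c t =
  \prod_(j < r) X j - \prod_(j < r) p
   - \sum_(l < r) \prod_(j < r) (if j == l :> nat then t * (touches g j c)%:R else p).
  by rewrite E /star_term; ring.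
have cC : #|predC [pred j : 'I_r | touches g j c]| = (r - deg c)%N.
  by rewrite -[r in RHS]card_ord -(cardC [pred j : 'I_r | touches g j c]) addKn.
have -> : \prod_(j < r) X j = p ^+ (r - deg c) * (p + t) ^+ deg c.
  rewrite (bigID [pred j : 'I_r | touches g j c]) /= mulrC; congr (_ * _).
    rewrite (eq_bigr (fun=> p)) => [|j /negbTE tj]; last by rewrite /X tj mulr0 addr0.
    by rewrite prodr_const -cC.
  rewrite (eq_bigr (fun=> p + t)) => [|j tj]; last by rewrite /X tj mulr1.
  by rewrite prodr_const.
have -> : \prod_(j < r) p = p ^+ (r - deg c) * p ^+ deg c.
  by rewrite prodr_const card_ord -exprD subnK // deg_le.
have -> : \sum_(l < r) \prod_(j < r) (if j == l :> nat then t * (touches g j c)%:R else p)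
   = (deg c)%:R * (t * p ^+ r.-1).
  rewrite (eq_bigr (fun l : 'I_r => if touches g l c then t * p ^+ r.-1 else 0)); last first.
    move=> l _; rewrite (bigD1 l) //= eqxx (eq_bigr (fun=> p)) => [|j]; last first.
      by rewrite -val_eqE /= => /negbTE ->.
    rewrite prodr_const cardC1 card_ord.
    by case: ifP => _; rewrite ?mulr1 ?mulr0 ?mul0r.
  by rewrite -big_mkcond /= sumr_const mulr_natl.
rewrite /bregman; have [->|d0] := posnP (deg c); first by rewrite !mul0r !expr0; ring.
have -> : r.-1 = (r - deg c + (deg c).-1)%N by have := deg_le c; lia.
by rewrite exprD; ring.
Qed.

(** Convexity in tangent form, inherited from the Bregman gaps in [star_sumE], whose weights are
    nonnegative. *)
Lemma star_sum_tangent y : 0 <= p + y ->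
  exists a, forall z, 0 <= p + z -> star_sum y + a * (z - y) <= star_sum z.
Proof.
move=> y0.
exists (\sum_c p ^+ (r - deg c) *
         ((deg c)%:R * (p + y) ^+ (deg c).-1 - (deg c)%:R * p ^+ (deg c).-1)) => z z0.
rewrite !star_sumE mulr_suml -big_split /=; apply: ler_sum => c _.
rewrite -mulrA -mulrDr ler_wpM2l ?exprn_ge0 ?(ltW p0) //.
have := pow_tangent (deg c) y0 z0; rewrite /bregman.
set a := (p + y) ^+ _; set b := (p + y) ^+ _.-1; set e := (p + z) ^+ _.
by lra.
Qed.

Definition shared_pairs : nat := \sum_(l < r) \sum_(k < l) shares g k l.
Definition disjoint_pairs : nat := \sum_(l < r) \sum_(k < l) ~~ shares g k l.

Lemma pair_count : (shared_pairs + disjoint_pairs = 'C(r, 2))%N.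
Proof.
rewrite /shared_pairs /disjoint_pairs -big_split /= -triangular_sum big_mkord.
apply: eq_bigr => l _; rewrite -big_split /= (eq_bigr (fun=> 1%N)).
  by rewrite sum1_card card_ord.
by move=> k _; case: shares.
Qed.

Lemma star_sum_local t :
  star_sum t <= shared_pairs%:R * (p + `|t|) ^+ (r - 2) * t ^+ 2.
Proof.
rewrite /star_sum /shared_pairs natr_sum !mulr_suml; apply: ler_sum => l _.
rewrite natr_sum !mulr_suml; apply: ler_sum => k _.
have kl := ltn_ord k; have lr := ltn_ord l; have kr := ltn_trans kl lr.
have knl : (k : nat) != l by rewrite ltn_eqF.
case: (boolP (shares g k l)) => [/existsP[c /andP[tk tl]]|nsh]; last first.
  by rewrite (star_term_disjoint _ _ kr lr) // !mul0r.
rewrite (star_term_shared gs _ _ kr lr knl tk tl) mul1r.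
apply: (le_trans (ler_norm _)); rewrite /star_term normr_prod.
rewrite -[t ^+ 2]real_normK ?num_real // -(prod_pair_const _ _ kr lr knl).
have t0 := normr_ge0 t.
apply: ler_prod => j _; rewrite normr_ge0 /= /pair_weight; case: ifP => _.
  by rewrite normrM; case: (touches g j c); rewrite /= ?normr1 ?normr0 ?mulr1 ?mulr0.
have pn : `|p| = p by rewrite ger0_norm // ltW.
case: ifP => _; last by rewrite pn lerDl.
apply: (le_trans (ler_normD _ _)); rewrite pn lerD2l normrM.
by case: (touches g j c); rewrite /= ?normr1 ?normr0 ?mulr1 ?mulr0.
Qed.

Lemma star_sum_small t : (r <= 1)%N -> star_sum t = 0.
Proof.
move=> r1; rewrite /star_sum big1 // => l _; rewrite big1 // => k _.
have kl := ltn_ord k; have l0 := leq_trans (ltn_ord l) r1.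
by exfalso; move: (leq_trans kl l0).
Qed.

Lemma sum_deg : (\sum_c deg c = 2 * r)%N.
Proof.
have [gne _] := gs.
rewrite (eq_bigr (fun c => \sum_(j < r) touches g j c)%N); last first.
  move=> c _; rewrite /deg -sum1_card big_mkcond /=; apply: eq_bigr => j _.
  by rewrite inE; case: (touches g j c).
rewrite exchange_big /= (eq_bigr (fun=> 2%N)) ?sum_nat_const ?card_ord 1?mulnC // => j _.
have gj := gne j (ltn_ord j).
rewrite (eq_bigr (fun c => ((c == (g j).1) + (c == (g j).2))%N)); last first.
  move=> c _; rewrite /touches; case: eqP => [->|_] //=.
  by rewrite (negbTE gj).
have one x : (\sum_(c : V) (c == x) = 1)%N.
  by rewrite (bigD1 x) //= eqxx big1 // => d /negbTE ->.
by rewrite big_split /= !one.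
Qed.

(** [bregman_pow_le] bounds the term at [c] by [(deg c - 1) / (r - 1)] Bregman gaps of the power
    [r]. The degrees add up to [2 r] and at least three vertices are covered, whence [2 r - 3],
    strictly less than [2 (r - 1)]. *)
Lemma star_sum_global t : (1 < r)%N -> 0 <= p + t ->
  r.-1%:R * star_sum t <= (2 * r - 3)%:R * bregman r p (p + t).
Proof.
move=> r2 pt; have [gne gdis] := gs.
have r0 : (0 < r)%N by apply: ltnW.
have b0 : 0 <= bregman r p (p + t) by apply: bregman_ge0; rewrite // ltW.
apply: (@le_trans _ _ ((\sum_c (deg c).-1)%N%:R * bregman r p (p + t))).
  rewrite star_sumE mulr_sumr natr_sum mulr_suml; apply: ler_sum => c _.
  have [d0|d0] := posnP (deg c).
    by rewrite d0 /bregman !expr0 subrr !mul0r subr0 mulr0 mulr0.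
  by apply: (bregman_pow_le _ (ltW p0) pt); rewrite d0 deg_le.
rewrite ler_wpM2r // ler_nat.
have e0 : (0 < r)%N := r0; have e1 : (1 < r)%N := r2.
have [c c1] : exists c, touches g 1 c /\ ~~ touches g 0 c.
  case: (boolP (touches g 0 (g 1).1)) => h; last by exists (g 1).1; rewrite /touches eqxx.
  exists (g 1).2; split; first by rewrite /touches eqxx orbT.
  apply: (gdis 1%N 0%N _ _ _ (g 1).1) => //; first exact: gne.
    by rewrite /touches eqxx.
  by rewrite /touches eqxx orbT.
have degp j d : (j < r)%N -> touches g j d -> (0 < deg d)%N.
  by move=> jr tj; apply/card_gt0P; exists (Ordinal jr).
pose a := (g 0).1; pose b := (g 0).2; have ab : a != b := gne 0%N r0.
have ta : touches g 0 a by rewrite /touches eqxx.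
have tb : touches g 0 b by rewrite /touches eqxx orbT.
case: c1 => tc ntc.
have ca : c != a by apply: contraNneq ntc => ->.
have cb : c != b by apply: contraNneq ntc => ->.
have S3 : (3 + \sum_d (deg d).-1 <= \sum_d deg d)%N.
  rewrite (bigD1 a) //= (bigD1 b) 1?eq_sym //= (bigD1 c) ?ca //=.
  rewrite [in X in (_ <= X)%N](bigD1 a) //= [in X in (_ <= _ + X)%N](bigD1 b) 1?eq_sym //=.
  rewrite [in X in (_ <= _ + (_ + X))%N](bigD1 c) ?ca //=.
  have h : (\sum_(i | [&& i != a, i != b & i != c]) (deg i).-1 <=
            \sum_(i | [&& i != a, i != b & i != c]) deg i)%N.
    by apply: leq_sum => d _; apply: leq_pred.
  have := degp _ _ r0 ta; have := degp _ _ r0 tb; have := degp _ _ r2 tc.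
  under eq_bigl do rewrite -andbA.
  under [X in (_ <= _ + (_ + (_ + X)))%N]eq_bigl do rewrite -andbA.
  move: h; move: (\sum_(i | _) _)%N (\sum_(i | _) _)%N (deg a) (deg b) (deg c) => k l da db dc.
  by clear; lia.
by move: S3; rewrite sum_deg; move: (\sum_d _)%N => k; clear; lia.
Qed.

End StarSum.

(* Rows with a large mean are few, so against the other rows they pay for their full divergence;
   the remaining rows only pay one half of it, but there a quadratic comparison is available. *)
Lemma divergence_dominates (R : realType) (W : finType) (m : W -> W -> R) (I : R -> Prop)
    (D G : R -> R) (c tau kd B e' e : R) :
  (0 < #|W|)%N ->
  (forall u w, m u w = m w u) -> (forall u w, I (m u w)) -> (forall u, I (av (m u))) ->
  (forall z, I z -> `|z| <= 1) ->
  0 < c -> 0 <= tau -> 0 <= kd -> 0 < e' -> 0 <= e ->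
  (forall z, I z -> 0 <= D z <= B) ->
  (forall z, I z -> G z + c * z ^+ 2 <= D z) ->
  (forall y, I y -> exists a, forall z, I z -> G y + a * (z - y) <= G z) ->
  (forall y z : R, `|y| <= e' -> I z -> tau * (2 * y * z - y ^+ 2) <= D z) ->
  (forall y, I y -> `|y| <= e' -> G y + kd * y ^+ 2 <= (tau / 2 - c) * y ^+ 2) ->
  (2^-1 * B / e' + tau + 2 * kd) * e <= c / 2 * e' ^+ 2 ->
  av (fun b => `|av (m b)|) <= e ->
  av (fun b => G (av (m b))) + kd * av (fun b => av (m b)) ^+ 2
    + c / 2 * av (fun b => av (m b) ^+ 2)
  <= 2^-1 * av (fun u => av (fun w => D (m u w))).
Proof.
move=> W0 msym Im Irow I1 c0 tau0 kd0 e'0 e0 DB DG Gtan Dquad Gloc small rowe.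
pose y b := av (m b); rewrite -/y.
pose O b : R := (~~ (`|y b| <= e'))%:R; pose N b : R := ((`|y b| <= e')%R : bool)%:R.
have ON b : O b + N b = 1 by rewrite /O /N; case: (leP `|y b| e') => _ /=; rewrite ?addr0 ?add0r.
have O01 b : 0 <= O b <= 1 by rewrite /O; case: (leP `|y b| e') => _ /=; rewrite ?lexx ?ler01.
have N01 b : 0 <= N b <= 1 by rewrite /N; case: (leP `|y b| e') => _ /=; rewrite ?lexx ?ler01.
pose o := av O.
have o0 : 0 <= o by apply: av_ge0 => // b; case/andP: (O01 b).
have oe : o * e' <= e.
  apply: le_trans rowe; rewrite /o -avZr; apply: ler_av => // b; rewrite -/(y b) /O.
  by case: (leP `|y b| e') => /= h; rewrite ?mul0r // mul1r ltW.
have y1 b : `|y b| <= 1 by apply/I1/Irow.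
have DB0 u w := DB _ (Im u w).
(* By symmetry half of the total is [OO + ON - OO / 2 + NN / 2]: outlying rows receive their full
   divergence at the price of [OO], which is quadratic in their frequency [o]. *)
pose DD (F H : W -> R) := av (fun u => av (fun w => F u * H w * D (m u w))).
have DDsym F H : DD F H = DD H F.
  rewrite /DD av_exchange; apply: eq_av => u; apply: eq_av => w.
  by rewrite msym [H u * _]mulrC.
have split_ : av (fun u => av (fun w => D (m u w))) = DD O O + DD O N + DD N O + DD N N.
  rewrite /DD -!avD; apply: eq_av => u; rewrite -!avD; apply: eq_av => w.
  rewrite -[LHS]mul1r -[X in X * _](mulr1 1) -{1}(ON u) -(ON w); ring.
have rowO : DD O O + DD O N = av (fun u => O u * av (fun w => D (m u w))).
  rewrite /DD -avD; apply: eq_av => u; rewrite -avD -avZ; apply: eq_av => w.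
  by rewrite -mulrDl -mulrDr ON mulr1.
have OOle : DD O O <= B * o * o.
  have -> : B * o * o = av (fun u => av (fun w => O u * O w * B)).
    rewrite (eq_av (G := fun u => O u * (o * B))) => [|u].
      by rewrite avZr -/o; ring.
    by rewrite /o -avZr -avZ; apply: eq_av => w; rewrite mulrA.
  apply: ler_av => // u; apply: ler_av => // w.
  have /andP[? ?] := O01 u; have /andP[? ?] := O01 w; have /andP[_ h] := DB0 u w.
  by rewrite ler_wpM2l // mulr_ge0.
(* Jensen: averaged along the row, the tangent of [G] at the row mean gives back [G (y u)]. *)
have rowOge : av (fun u => O u * (G (y u) + c * y u ^+ 2)) <= av (fun u => O u * av (fun w => D (m u w))).
  apply: ler_av => // u; have /andP[Ou _] := O01 u; rewrite ler_wpM2l //.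
  have [a ha] := Gtan (y u) (Irow u).
  apply: (@le_trans _ _ (av (fun w => G (y u) + a * (m u w - y u) + c * m u w ^+ 2))).
    rewrite !avD avZ avB !av_cst // -/(y u) subrr mulr0 addr0 lerD2l avZ ler_wpM2l ?(ltW c0) //.
    exact: av_sqr_le.
  apply: ler_av => // w; apply: le_trans (DG _ (Im u w)); rewrite lerD2r; exact: ha.
(* The parabola [tau z^2] is replaced by its tangent at the row mean. Removing the outlying columns
   harms only the linear part, since the constant [- y^2] has the favourable sign; the cost is
   [2 tau e o]. *)
have NNge : tau * av (fun u => N u * y u ^+ 2) - 2 * tau * e * o <= DD N N.
  apply: (@le_trans _ _ (av (fun u => N u * (tau * (y u ^+ 2 - 2 * `|y u| * o))))).
    rewrite [leRHS](eq_av (G := fun u => tau * (N u * y u ^+ 2) - 2 * tau * o * (N u * `|y u|)));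
      last by move=> u; ring.
    have -> : 2 * tau * e * o = 2 * tau * o * e by ring.
    rewrite avB !avZ lerD2l lerN2 ler_wpM2l ?mulr_ge0 //.
    apply: le_trans rowe; apply: ler_av => // u.
    by have /andP[? ?] := N01 u; rewrite ler_piMl.
  apply: ler_av => // u.
  rewrite (eq_av (G := fun w => N u * (N w * D (m u w)))); last by move=> w; rewrite mulrA.
  rewrite avZ; rewrite {1 2}/N; case: (leP `|y u| e') => yu /=; last by rewrite !mul0r.
  rewrite !mul1r.
  apply: (@le_trans _ _ (av (fun w => N w * (tau * (2 * y u * m u w - y u ^+ 2))))).
    rewrite (eq_av (G := fun w => tau * 2 * y u * m u w - tau * y u ^+ 2
        - O w * (tau * (2 * y u * m u w - y u ^+ 2)))); last first.
      move=> w; have -> : N w = 1 - O w; last by ring.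
      by have := ON w; lra.
    rewrite !avB avZ av_cst // -/(y u).
    have : av (fun w => O w * (tau * (2 * y u * m u w - y u ^+ 2))) <= 2 * tau * `|y u| * o.
      rewrite /o -avZ; apply: ler_av => // w; have /andP[Ow _] := O01 w.
      rewrite [leRHS]mulrC ler_wpM2l //.
      have h1 : y u * m u w <= `|y u|.
        apply: (le_trans (ler_norm _)); rewrite normrM ler_piMr //; exact: I1.
      have h2 := sqr_ge0 (y u).
      by rewrite [2 * tau]mulrC -!mulrA ler_wpM2l //; lra.
    by lra.
  apply: ler_av => // w; have /andP[? ?] := N01 w; rewrite ler_wpM2l //.
  exact: Dquad.
have sq : av y ^+ 2 <= av (fun u => N u * y u ^+ 2) + 2 * o * e.
  pose a := av (fun u => N u * y u); pose b := av (fun u => O u * y u).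
  have s_ab : av y = a + b.
    by rewrite /a /b -avD; apply: eq_av => u; rewrite -mulrDl addrC ON mul1r.
  have a2 : a ^+ 2 <= av (fun u => N u * y u ^+ 2).
    apply: (le_trans (av_sqr_le W0 _)); apply: ler_av => // u.
    by rewrite /N; case: (leP `|y u| e') => _; rewrite /= ?mul1r // !mul0r expr0n.
  have bo : `|b| <= o.
    apply: (le_trans (ler_norm_av W0 _)); apply: ler_av => // u.
    by have /andP[Ou _] := O01 u; rewrite normrM ger0_norm // ler_piMr.
  have se : `|av y| <= e by apply: (le_trans (ler_norm_av W0 _)).
  have E : av y ^+ 2 = a ^+ 2 + 2 * (b * av y) - b ^+ 2 by rewrite s_ab; ring.
  have h : b * av y <= o * e.
    by apply: (le_trans (ler_norm _)); rewrite normrM ler_pM.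
  by rewrite E; have := sqr_ge0 b; lra.
have Gsplit (F : W -> R) : av F = av (fun u => O u * F u) + av (fun u => N u * F u).
  by rewrite -avD; apply: eq_av => u; rewrite -mulrDl ON mul1r.
have locN : av (fun u => N u * G (y u)) + kd * av (fun u => N u * y u ^+ 2)
            + c * av (fun u => N u * y u ^+ 2) <= tau / 2 * av (fun u => N u * y u ^+ 2).
  rewrite -!avZ -!avD; apply: ler_av => // u.
  rewrite /N; case: (leP `|y u| e') => yu /=; rewrite ?mul0r ?mulr0 ?addr0 // !mul1r.
  by have := Gloc _ (Irow u) yu; rewrite -/(y u); lra.
(* On outlying rows [y^2] exceeds [e'^2], so the spare [c / 2] pays for all errors of size [e o];
   this is the purpose of the smallness hypothesis on [e]. *)
have bigO : (2^-1 * B / e' + tau + 2 * kd) * e * o <= c / 2 * av (fun u => O u * y u ^+ 2).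
  apply: (@le_trans _ _ (c / 2 * e' ^+ 2 * o)); first by rewrite ler_wpM2r.
  rewrite -mulrA ler_wpM2l ?divr_ge0 ?(ltW c0) // /o -avZ; apply: ler_av => // u.
  rewrite /O; case: (leP `|y u| e') => yu /=; rewrite ?mulr0 ?mul0r // mulr1 mul1r.
  by rewrite -[leRHS]real_normK ?num_real // ler_pXn2r ?nnegrE ?(ltW e'0) // ltW.
have B0 : 0 <= B.
  by have /card_gt0P[u _] := W0; have /andP[h1 h2] := DB0 u u; apply: le_trans h1 h2.
have OO2 : B * o * o <= B / e' * e * o.
  rewrite ler_wpM2r // -mulrA ler_wpM2l // mulrC ler_pdivlMr //.
rewrite split_ (DDsym N O).
rewrite (Gsplit (fun b => G (y b))) (Gsplit (fun b => y b ^+ 2)).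
move: rowOge; rewrite -rowO.
rewrite (eq_av (G := fun u => O u * G (y u) + c * (O u * y u ^+ 2))); last by move=> u; ring.
rewrite avD avZ => rowOge.
have yN0 : 0 <= av (fun u => N u * y u ^+ 2).
  by apply: av_ge0 => // u; have /andP[? ?] := N01 u; rewrite mulr_ge0 ?sqr_ge0.
have kdsq : kd * av y ^+ 2 <= kd * (av (fun u => N u * y u ^+ 2) + 2 * o * e).
  by rewrite ler_wpM2l.
set aN := av (fun u => N u * y u ^+ 2) in NNge locN yN0 kdsq *.
set aO := av (fun u => O u * y u ^+ 2) in rowOge bigO *.
set gN := av (fun u => N u * G (y u)) in locN *.
set gO := av (fun u => O u * G (y u)) in rowOge *.
set dOO := DD O O in OOle rowOge *; set dON := DD O N in rowOge *; set dNN := DD N N in NNge *.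
have E1 : (2^-1 * B / e' + tau + 2 * kd) * e * o =
   2^-1 * (B / e' * e * o) + tau * e * o + 2 * (kd * o * e).
  by field; rewrite gt_eqF.
rewrite E1 in bigO.
have caN : 0 <= c * aN by rewrite mulr_ge0 ?(ltW c0).
have E2 : kd * (aN + 2 * o * e) = kd * aN + 2 * (kd * o * e) by ring.
rewrite E2 in kdsq.
lra.
Qed.

(** * Drift and innovations *)

Lemma set2_neq (W : finType) (a b c d : W) :
  a != c -> a != d -> [set a; b]%SET != [set c; d]%SET.
Proof.
move=> ac ad; apply/eqP => /setP/(_ a).
by rewrite !inE eqxx (negbTE ac) (negbTE ad).
Qed.

Section InnovationMatrices.
Variables (R : realType) (n : nat).
Hypothesis n0 : (0 < n)%N.
Local Notation W := 'I_n.
Local Notation T := {set 'I_n}.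
Variables (mu : {set T} -> R) (theta : T -> {set T} -> R) (p : R).
Hypothesis pm : is_pmf mu.
Hypothesis muO : forall x, mu x != 0 -> x \in Omega n.
Hypothesis th01 : forall e x, 0 <= theta e x <= 1.
Hypothesis unc : uncorrelated mu (fun e x => (e \in x)%:R - theta e x).
Hypothesis p01 : 0 < p < 1.

Definition adj (x : {set T}) (u w : W) : R := ([set u; w]%SET \in x)%:R.
(** Set to 0 on the diagonal, where no edge can be: the diagonal then carries no divergence, and
    [innov] is [- p] there on [Omega]. *)
Definition drift (x : {set T}) (u w : W) : R :=
  if u == w then 0 else theta [set u; w]%SET x - p.
Definition base (x : {set T}) (u w : W) : R := adj x u w - drift x u w.
Definition innov (x : {set T}) (u w : W) : R := base x u w - p.

Let W0 : (0 < #|W|)%N. Proof. by rewrite card_ord. Qed.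

Lemma adj_sym x u w : adj x u w = adj x w u.
Proof. by rewrite /adj finset.setUC. Qed.

Lemma drift_sym x u w : drift x u w = drift x w u.
Proof. by rewrite /drift eq_sym finset.setUC. Qed.

Lemma base_sym x u w : base x u w = base x w u.
Proof. by rewrite /base adj_sym drift_sym. Qed.

Lemma adj01 x u w : 0 <= adj x u w <= 1.
Proof. by rewrite /adj; case: (_ \in _) => /=; rewrite ?lexx ?ler01. Qed.

Lemma drift_range x u w : - p <= drift x u w <= 1 - p.
Proof.
have /andP[? ?] := p01; have /andP[? ?] := th01 [set u; w]%SET x.
by rewrite /drift; case: ifP => _; apply/andP; split; lra.
Qed.

Lemma adj_diag x u : x \in Omega n -> adj x u u = 0.
Proof.
rewrite /Omega inE => /fintype.subsetP xE; rewrite /adj finset.setUid.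
case: (boolP (_ \in x)) => // /xE; by rewrite /edges inE cards1.
Qed.

Lemma innov_off x u w : u != w -> innov x u w = ([set u; w]%SET \in x)%:R - theta [set u; w]%SET x.
Proof. by move=> /negbTE uw; rewrite /innov /base /drift uw /adj; ring. Qed.

Lemma innov_le1 x u w : x \in Omega n -> `|innov x u w| <= 1.
Proof.
move=> xO; have /andP[? ?] := p01; have [->|uw] := eqVneq u w.
  by rewrite /innov /base /drift eqxx adj_diag // subr0 sub0r normrN ger0_norm; lra.
rewrite innov_off //; have /andP[? ?] := th01 [set u; w]%SET x.
by rewrite ler_norml; case: (_ \in _) => /=; apply/andP; split; lra.
Qed.

Lemma base_le2 x u w : `|base x u w| <= 2.
Proof.
have /andP[? ?] := p01; have /andP[? ?] := drift_range x u w.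
have /andP[? ?] := adj01 x u w.
by rewrite /base ler_norml; apply/andP; split; lra.
Qed.

Lemma innov_le2 x u w : `|innov x u w| <= 2.
Proof.
have /andP[? ?] := p01; have [->|uw] := eqVneq u w.
  have /andP[? ?] := adj01 x w w.
  by rewrite /innov /base /drift eqxx ler_norml; apply/andP; split; lra.
rewrite innov_off //; have /andP[? ?] := th01 [set u; w]%SET x.
by rewrite ler_norml; case: (_ \in _) => /=; apply/andP; split; lra.
Qed.

Lemma Ex_prod_innov (J : finType) (P : pred J) (q : J -> W * W) (c : R) :
  (forall j, P j -> (q j).1 != (q j).2) ->
  (forall i j, P i -> P j -> i != j ->
     [set (q i).1; (q i).2]%SET != [set (q j).1; (q j).2]%SET) ->
  Ex mu (fun x => \prod_(j | P j) (c + innov x (q j).1 (q j).2)) = c ^+ #|P|.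
Proof.
move=> q1 q2; pose S := [seq [set (q j).1; (q j).2]%SET | j <- enum P].
have uS : uniq S.
  rewrite map_inj_in_uniq ?enum_uniq // => i j; rewrite !mem_enum => Pi Pj E.
  by apply/eqP/negPn/negP => ij; have := q2 i j Pi Pj ij; rewrite E eqxx.
rewrite cardE -(size_map (fun j => [set (q j).1; (q j).2]%SET)) -/S -(unc c uS).
apply: eq_Ex => x; rewrite /S big_map big_enum /=; apply: eq_bigr => j Pj.
by rewrite innov_off // q1.
Qed.

Lemma av_coincide (c : W) : av (fun u : W => (u == c)%:R) = n%:R^-1 :> R.
Proof. by rewrite avE card_ord (bigD1 c) //= eqxx big1 ?addr0 ?mulr1 // => d /negbTE ->. Qed.

Lemma av_coincide2 : av (fun u : W => av (fun c : W => (u == c)%:R)) = n%:R^-1 :> R.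
Proof.
rewrite -(av_cst W0 (n%:R^-1)); apply: eq_av => u; rewrite -(av_coincide u).
by apply: eq_av => c; rewrite eq_sym.
Qed.

Lemma Ex_norm_le (f : {set T} -> R) (k : R) :
  (forall x, x \in Omega n -> `|f x| <= k) -> `|Ex mu f| <= k.
Proof.
move=> fk; apply: (le_trans (ler_norm_Ex _ pm)); rewrite -[leRHS](Ex_cst k pm).
by apply: ler_Ex => // x /muO /fk.
Qed.

(** After expanding the square, two distinct edges have uncorrelated innovations. A nonzero term
    needs a coincidence among three vertices, and each of the three possible ones has frequency
    [1 / n]. In the same way the six coincidences among four vertices give [6 / n] in
    [four_cycle_moment]. *)
Lemma noise_moment :
  Ex mu (fun x => av (fun b => av (innov x b) ^+ 2)) <= 3 * n%:R^-1.
Proof.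
pose F b w w' x := innov x b w * innov x b w'.
have -> : Ex mu (fun x => av (fun b => av (innov x b) ^+ 2)) =
  av (fun b => av (fun w => av (fun w' => Ex mu (F b w w')))).
  rewrite Ex_av; apply: eq_av => b.
  rewrite (eq_Ex (g := fun x => av (fun w => av (fun w' => F b w w' x)))); last first.
    move=> x; rewrite expr2 -avZr; apply: eq_av => w; rewrite mulrC -avZr.
    by apply: eq_av => w'; rewrite mulrC.
  by rewrite Ex_av; apply: eq_av => w; rewrite Ex_av.
pose cnt (b w w' : W) : nat := ((b == w) + (b == w') + (w == w'))%N.
apply: (@le_trans _ _ (av (fun b => av (fun w => av (fun w' => (cnt b w w')%:R))))).
  apply: ler_av => // b; apply: ler_av => // w; apply: ler_av => // w'.
  apply: (le_trans (ler_norm _)).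
  have [c0|c0] := posnP (cnt b w w'); last first.
    apply: (@le_trans _ _ 1); last by rewrite ler1n.
    apply: Ex_norm_le => x xO; rewrite normrM.
    by rewrite -[leRHS]mulr1 ler_pM // innov_le1.
  move: c0; rewrite /cnt; case: eqVneq => // bw; case: eqVneq => // bw'; case: eqVneq => // ww' _.
  rewrite (eq_Ex (g := fun x => \prod_(j : bool) (0 + innov x b (if j then w else w')))); last first.
    by move=> x; rewrite big_bool /= !add0r.
  rewrite (@Ex_prod_innov bool xpredT (fun j => (b, if j then w else w'))) /=.
  - by rewrite card_bool expr0n normr0.
  - by move=> [].
  - by move=> [] [] // _ _ _; rewrite ![[set b; _]%SET]finset.setUC set2_neq // 1?eq_sym.
rewrite /cnt (eq_av (G := fun b => av (fun w => (b == w)%:R) + n%:R^-1 + n%:R^-1)); last first.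
  move=> b; rewrite -[X in _ = _ + X]av_coincide2 -[X in _ + X + _](av_cst W0) -!avD.
  apply: eq_av => w; rewrite -[X in _ + X + _](av_coincide b) -[X in X + _ + _](av_cst W0) -!avD.
  by apply: eq_av => w'; rewrite !natrD [w' == b]eq_sym.
by rewrite !avD !av_cst // av_coincide2; lra.
Qed.

(** For symmetric [Z] the density of four-cycles, or trace of the fourth power. It dominates the
    fourth power of the operator norm and, being a polynomial, has a computable mean. *)
Definition four_cycle (Z : W -> W -> R) : R :=
  av (fun u => av (fun w => av (fun c => Z u c * Z w c) ^+ 2)).

Lemma four_cycle_moment :
  Ex mu (fun x => four_cycle (innov x)) <= 6 * n%:R^-1.
Proof.
pose F u w c f x := innov x u c * innov x w c * (innov x u f * innov x w f).
have -> : Ex mu (fun x => four_cycle (innov x)) =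
  av (fun u => av (fun w => av (fun c => av (fun f => Ex mu (F u w c f))))).
  rewrite Ex_av; apply: eq_av => u; rewrite Ex_av; apply: eq_av => w.
  rewrite (eq_Ex (g := fun x => av (fun c => av (fun f => F u w c f x)))); last first.
    move=> x; rewrite expr2 -avZr; apply: eq_av => c; rewrite mulrC -avZr.
    by apply: eq_av => f; rewrite mulrC.
  by rewrite Ex_av; apply: eq_av => c; rewrite Ex_av.
pose cnt (u w c f : W) : nat :=
  ((u == w) + (u == c) + (u == f) + (w == c) + (w == f) + (c == f))%N.
apply: (@le_trans _ _ (av (fun u => av (fun w => av (fun c => av (fun f => (cnt u w c f)%:R)))))).
  apply: ler_av => // u; apply: ler_av => // w; apply: ler_av => // c; apply: ler_av => // f.
  apply: (le_trans (ler_norm _)).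
  have [c0|c0] := posnP (cnt u w c f); last first.
    apply: (@le_trans _ _ 1); last by rewrite ler1n.
    apply: Ex_norm_le => x xO; rewrite !normrM.
    by rewrite -[leRHS]mulr1 ler_pM ?mulr_ge0 // -[leRHS]mulr1 ler_pM // innov_le1.
  move: c0; rewrite /cnt; case: eqVneq => // uw; case: eqVneq => // uc; case: eqVneq => // uf.
  case: eqVneq => // wc; case: eqVneq => // wf; case: eqVneq => // cf _.
  pose q (j : bool * bool) := (if j.1 then u else w, if j.2 then c else f).
  rewrite (eq_Ex (g := fun x => \prod_(j : bool * bool) (0 + innov x (q j).1 (q j).2))); last first.
    move=> x; rewrite -(pair_bigA _ (fun a b => 0 + innov x (if a then u else w) (if b then c else f))).
    by rewrite /= !big_bool /= !add0r; rewrite /F; ring.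
  rewrite Ex_prod_innov.
  - by rewrite card_prod card_bool expr0n normr0.
  - by move=> [[] []].
  - move=> [a b] [a' b'] _ _; rewrite xpair_eqE negb_and /q /=.
    have [->|aa'] := eqVneq a a' => /=.
      move=> bb'; rewrite ![[set _; (if _ then c else f)]%SET]finset.setUC.
      by case: a'; case: b bb'; case: b' => // _; rewrite set2_neq // 1?eq_sym.
    by move=> _; case: a aa'; case: a' => // _; case: b; case: b'; rewrite set2_neq // 1?eq_sym.
have E : av (fun u => av (fun w => av (fun c => av (fun f => (cnt u w c f)%:R : R)))) =
  av (fun u : W => av (fun w => av (fun c => av (fun f => (u == w)%:R + (u == c)%:R + (u == f)%:R
     + (w == c)%:R + (w == f)%:R + (c == f)%:R)))).
  by apply: eq_av => u; apply: eq_av => w; apply: eq_av => c; apply: eq_av => f; rewrite !natrD.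
rewrite E.
under eq_av do under eq_av do under eq_av do rewrite !avD !(av_cst W0).
under eq_av do under eq_av do rewrite !avD !(av_cst W0) !av_coincide2.
under eq_av do rewrite !avD !(av_cst W0) !av_coincide2.
rewrite !avD !(av_cst W0) !av_coincide2; lra.
Qed.

End InnovationMatrices.

Section LowOrderTerms.
Variables (R : realType) (n : nat).
Hypothesis n0 : (0 < n)%N.
Local Notation W := 'I_n.
Local Notation T := {set 'I_n}.
Variables (mu : {set T} -> R) (theta : T -> {set T} -> R) (p : R).
Hypothesis pm : is_pmf mu.
Hypothesis muO : forall x, mu x != 0 -> x \in Omega n.
Hypothesis th01 : forall e x, 0 <= theta e x <= 1.
Hypothesis unc : uncorrelated mu (fun e x => (e \in x)%:R - theta e x).
Hypothesis p01 : 0 < p < 1.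
Variables (V : finType) (g : nat -> V * V) (r : nat).
Hypothesis gs : simple_edges g r.

Let W0 : (0 < #|W|)%N. Proof. by rewrite card_ord. Qed.
Let F0 : (0 < #|{ffun V -> W}|)%N. Proof. exact: ffun_card_gt0. Qed.
Let base_b x u w : `|base theta p x u w| <= 2 := base_le2 th01 p01 x u w.

Definition collisions (s : {ffun V -> W}) : nat :=
  (\sum_(c : V) \sum_(d : V | d != c) (s c == s d))%N.

Lemma collisions_eq0 s : collisions s = 0%N -> injective s.
Proof.
move=> /eqP; rewrite /collisions sum_nat_eq0 => /forallP h c d E.
apply/eqP/negPn/negP => cd; have := h c; rewrite implyTb sum_nat_eq0 => /forallP/(_ d).
by rewrite eq_sym cd implyTb E eqxx.
Qed.

Lemma natr_mul_inv (k : nat) : (\sum_(c : V) n%:R^-1 : R) = #|V|%:R * n%:R^-1.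
Proof. by rewrite sumr_const mulr_natl. Qed.

Lemma av_sum (I J : finType) (P : pred J) (F : J -> I -> R) :
  av (fun i => \sum_(j | P j) F j i) = \sum_(j | P j) av (F j).
Proof. exact: Ex_sum. Qed.

Lemma av_collisions :
  av (fun s : {ffun V -> W} => (collisions s)%:R) <= (#|V| ^ 2)%N%:R * n%:R^-1 :> R.
Proof.
rewrite (eq_av (G := fun s : {ffun V -> W} => \sum_c \sum_(d | d != c) (s c == s d)%:R)); last first.
  by move=> s; rewrite natr_sum; apply: eq_bigr => c _; rewrite natr_sum.
rewrite av_sum expnS expn1 natrM -mulrA -!natr_mul_inv // mulr_sumr.
rewrite mulr_natl -sumr_const; apply: ler_sum => c _.
rewrite av_sum big_mkcond /= natr_mul_inv // -natr_mul_inv //; apply: ler_sum => d _.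
case: ifPn => [dc|_]; last by rewrite invr_ge0.
by rewrite (av_coord2 W0 (fun u w => (u == w)%:R)) 1?eq_sym // av_coincide2.
Qed.

Lemma simple_image (s : {ffun V -> W}) i j : injective s -> (i < r)%N -> (j < r)%N -> i != j ->
  [set s (g i).1; s (g i).2]%SET != [set s (g j).1; s (g j).2]%SET.
Proof.
move=> sI ir jr ij; have [gne gdis] := gs; apply/eqP => E.
have ti c : touches g i c -> touches g j c.
  move=> tc; have : s c \in [set s (g i).1; s (g i).2]%SET.
    by rewrite !inE; case/orP: tc => /eqP ->; rewrite eqxx ?orbT.
  by rewrite E !inE => /orP[] /eqP/sI ->; rewrite /touches eqxx ?orbT.
have t1 : touches g i (g i).1 by rewrite /touches eqxx.
have t2 : touches g i (g i).2 by rewrite /touches eqxx orbT.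
by have := gdis i j ir jr ij _ _ (gne i ir) t1 t2 (ti _ t1); rewrite ti.
Qed.

(** For an injective placement the mean is exactly [p ^+ r]; the other placements have frequency at
    most [|V|^2 / n] and are bounded trivially. *)
Lemma zeroth_order :
  `|Ex mu (fun x => av (fun s => \prod_(j < r) ev g (base theta p x) j s)) - p ^+ r|
    <= (2 ^+ r + 1) * (#|V| ^ 2)%N%:R * n%:R^-1.
Proof.
have [gne gdis] := gs; have /andP[p0 p1] := p01.
have pr1 : 0 <= p ^+ r <= 1 by rewrite exprn_ge0 ?(ltW p0) //= exprn_ile1 ?(ltW p0) ?(ltW p1).
rewrite Ex_av -[X in _ - X](av_cst F0 (p ^+ r)) -avB.
apply: (le_trans (ler_norm_av F0 _)); rewrite -mulrA.
apply: le_trans (ler_wpM2l _ av_collisions); last by rewrite addr_ge0 ?exprn_ge0.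
rewrite -avZ; apply: ler_av => // s.
have [c0|c0] := posnP (collisions s); last first.
  apply: (@le_trans _ _ (2 ^+ r + 1)).
    apply: (le_trans (ler_normB _ _)); rewrite lerD //; last first.
      by case/andP: pr1 => ? ?; rewrite ger0_norm.
    apply: (Ex_norm_le pm muO) => x _; rewrite normr_prod.
    rewrite -[r in leRHS]card_ord -prodr_const; apply: ler_prod => j _.
    by rewrite normr_ge0 base_b.
  by rewrite ler_peMr ?addr_ge0 ?exprn_ge0 // ler1n.
have sI := collisions_eq0 c0.
rewrite c0 mulr0 (eq_Ex (g := fun x => \prod_(j : 'I_r) (p + innov theta p x
     (s (g j).1) (s (g j).2)))); last first.
  by move=> x; apply: eq_bigr => j _; rewrite /innov /ev addrC subrK.
rewrite (Ex_prod_innov p unc (P := xpredT) (q := fun j : 'I_r => (s (g j).1, s (g j).2))) /=.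
- by rewrite card_ord subrr normr0.
- by move=> j _; rewrite (inj_eq sI) gne.
- by move=> i j _ _ ij; apply: simple_image.
Qed.

Variable l : nat.
Hypothesis lr : (l < r)%N.
Let y := (g l).1.
Let z := (g l).2.
Let yz : y != z. Proof. by have [h _] := gs; apply: h. Qed.

Definition plug (s : {ffun V -> W}) (u w : W) := upd (upd s y u) z w.

Definition others (x : {set T}) (s : {ffun V -> W}) : R :=
  \prod_(j < r | j != l :> nat) ev g (base theta p x) j s.

(** Counts the coincidences that can break the factorisation in [others_covariance]. As an integer
    it dominates the indicator of a bad quadruple, and its mean is computed term by term. *)
Definition cross_collisions (s t : {ffun V -> W}) (u w : W) : nat :=
  ((u == w) + (\sum_(c : V) ((s c == u) + (s c == w) + (t c == u) + (t c == w))) +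
   collisions s + collisions t + \sum_(c : V) \sum_(d : V) (s c == t d))%N.

Lemma plug_inj s u w : u != w -> collisions s = 0%N ->
  (forall c, s c != u) -> (forall c, s c != w) -> injective (plug s u w).
Proof.
move=> uw /collisions_eq0 sI su sw c d; rewrite /plug !updE.
case: (c =P z) => cz; case: (d =P z) => dz; case: (c =P y) => cy; case: (d =P y) => dy E;
  first [by rewrite cz dz | by rewrite cy dy | by rewrite E eqxx in uw
       | by move: (sw d); rewrite -E eqxx | by move: (sw c); rewrite E eqxx
       | by move: (su d); rewrite -E eqxx | by move: (su c); rewrite E eqxx | exact: sI].
Qed.

Lemma others_bound x s : `|others x s| <= 2 ^+ r.
Proof.
rewrite /others normr_prod; apply: prod_le_bound; rewrite ?card_ord // ?ler1n // => j.
by rewrite normr_ge0 base_b.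
Qed.

Lemma card_others : #|[pred j : 'I_r | j != l :> nat]| = r.-1.
Proof.
rewrite -[r in RHS]card_ord -(cardC1 (Ordinal lr)); apply: eq_card => j.
by rewrite !inE.
Qed.

Lemma others_mean (s : {ffun V -> W}) : injective s -> Ex mu (fun x => others x s) = p ^+ r.-1.
Proof.
move=> sI; have [gne gdis] := gs.
rewrite (eq_Ex (g := fun x => \prod_(j : 'I_r | j != l :> nat) (p + innov theta p x
     (s (g j).1) (s (g j).2)))); last first.
  by move=> x; apply: eq_bigr => j _; rewrite /innov /ev addrC subrK.
rewrite (Ex_prod_innov p unc (P := fun j : 'I_r => j != l :> nat)
   (q := fun j : 'I_r => (s (g j).1, s (g j).2))) /=.
- by rewrite card_others.
- by move=> j _; rewrite (inj_eq sI) gne.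
- by move=> i j _ _ ij; apply: simple_image.
Qed.

(** Each edge other than [l] has an end outside [y] and [z], whose image under one placement is not
    hit by the other. The two copies therefore have no edge in common and the moment factorises. *)
Lemma others_covariance s t u w : cross_collisions s t u w = 0%N ->
  Ex mu (fun x => (others x (plug s u w) - p ^+ r.-1) * (others x (plug t u w) - p ^+ r.-1)) = 0.
Proof.
have [gne gdis] := gs.
move=> /eqP; rewrite /cross_collisions !addn_eq0 => /andP[/andP[/andP[/andP[uw cst] cs] ct] st].
have {}uw : u != w by move: uw; case: (u == w).
have cs0 c : [&& s c != u, s c != w, t c != u & t c != w].
  move: cst; rewrite sum_nat_eq0 => /forallP/(_ c); rewrite implyTb !addn_eq0.
  by case: (s c == u); case: (s c == w); case: (t c == u); case: (t c == w).
have st0 c d : s c != t d.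
  move: st; rewrite sum_nat_eq0 => /forallP/(_ c); rewrite implyTb sum_nat_eq0 => /forallP/(_ d).
  by rewrite implyTb; case: (s c == t d).
have sI : injective (plug s u w).
  by apply: plug_inj => //; [exact/eqP|move=> c|move=> c]; have /and4P[] := cs0 c.
have tI : injective (plug t u w).
  by apply: plug_inj => //; [exact/eqP|move=> c|move=> c]; have /and4P[] := cs0 c.
pose q (j : bool * 'I_r) := ((if j.1 then plug s u w else plug t u w) (g j.2).1,
                             (if j.1 then plug s u w else plug t u w) (g j.2).2).
have bI b : injective (if b then plug s u w else plug t u w) by case: b.
have crossing c d i : (i < r)%N -> i != l -> touches g i c -> c != y -> c != z ->
    plug s u w c != plug t u w d.
  move=> ir il tc cy cz; rewrite /plug !updE (negbTE cz) (negbTE cy).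
  by have /and4P[h1 h2 _ _] := cs0 c; case: ifP => // _; case: ifP.
have two : Ex mu (fun x => others x (plug s u w) * others x (plug t u w)) = p ^+ r.-1 * p ^+ r.-1.
  rewrite (eq_Ex (g := fun x => \prod_(j : bool * 'I_r | j.2 != l :> nat)
       (p + innov theta p x (q j).1 (q j).2))); last first.
    move=> x; rewrite -(pair_big_dep xpredT (fun _ (i : 'I_r) => i != l :> nat)
      (fun b i => p + innov theta p x (q (b, i)).1 (q (b, i)).2)) /= big_bool /=.
    by congr (_ * _); apply: eq_bigr => j _; rewrite /innov /ev addrC subrK.
  rewrite (Ex_prod_innov p unc (P := fun j : bool * 'I_r => j.2 != l :> nat)).
  - have -> : #|[pred j : bool * 'I_r | j.2 != l :> nat]| = (r.-1 + r.-1)%N.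
      rewrite -card_others -sum1_card.
      rewrite -(pair_big_dep xpredT (fun _ (i : 'I_r) => i != l :> nat) (fun _ _ => 1%N)) /=.
      by rewrite big_bool /= !sum1_card.
    by rewrite exprD.
  - by move=> [b j] /= _; rewrite (inj_eq (bI b)) gne.
  - have escape i : (i < r)%N -> i != l ->
      exists c, [/\ touches g i c, c != y & c != z].
      move=> ir il; have gi := gne i ir.
      have ti1 : touches g i (g i).1 by rewrite /touches eqxx.
      have ti2 : touches g i (g i).2 by rewrite /touches eqxx orbT.
      case: (boolP (touches g l (g i).1)) => t1; last first.
        by exists (g i).1; move: t1; rewrite {1}/touches negb_or => /andP[].
      have t2 := gdis i l ir lr il _ _ gi ti1 ti2 t1.
      by exists (g i).2; move: t2; rewrite {1}/touches negb_or => /andP[].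
    have main i j : (i < r)%N -> i != l ->
      [set plug s u w (g i).1; plug s u w (g i).2]%SET !=
      [set plug t u w (g j).1; plug t u w (g j).2]%SET.
      move=> ir il; have [c [tc cy cz]] := escape i ir il; apply/eqP => /setP/(_ (plug s u w c)).
      rewrite !inE !(negbTE (crossing _ _ i ir il tc cy cz)) /=.
      by case/orP: tc => /eqP ->; rewrite eqxx ?orbT.
    move=> [a i] [b j] /= il jl; rewrite xpair_eqE negb_and /q /=.
    have [->|ab] := eqVneq a b => /=; first by move=> ij; apply: simple_image.
    move=> _; case: a b ab => [] [] // _; first exact: main.
    by rewrite eq_sym; apply: main.
rewrite (eq_Ex (g := fun x => others x (plug s u w) * others x (plug t u w)
   - p ^+ r.-1 * others x (plug s u w) - p ^+ r.-1 * others x (plug t u w)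
   + p ^+ r.-1 * p ^+ r.-1)); last by move=> x; ring.
rewrite ExD !ExB !ExZ two !others_mean // Ex_cst //; ring.
Qed.

Lemma av_cross_collisions :
  av (fun s : {ffun V -> W} => av (fun t => av (fun u => av (fun w => (cross_collisions s t u w)%:R))))
   <= (1 + 4 * #|V| + 3 * #|V| ^ 2)%N%:R * n%:R^-1 :> R.
Proof.
rewrite (eq_av (G := fun s => (1 + 4 * #|V|)%N%:R * n%:R^-1 + (collisions s)%:R
    + av (fun t : {ffun V -> W} => (collisions t)%:R) + (#|V| ^ 2)%N%:R * n%:R^-1)).
  rewrite !avD !av_cst //; have := av_collisions.
  rewrite [X in _ -> _ <= X * _]natrD [X in _ -> _ <= (_ + X) * _]natrM.
  by set K := (1 + _)%N%:R; set A := av _; set L := (_ ^ 2)%N%:R; nra.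
move=> s.
rewrite (eq_av (G := fun t => (1 + 4 * #|V|)%N%:R * n%:R^-1 + (collisions s)%:R
    + (collisions t)%:R + \sum_c \sum_d (s c == t d)%:R)); last first.
  move=> t.
  rewrite (eq_av (G := fun u => n%:R^-1 + (\sum_c ((s c == u)%:R + (t c == u)%:R)
      + \sum_(c : V) (n%:R^-1 + n%:R^-1)) +
      (collisions s)%:R + (collisions t)%:R + \sum_c \sum_d (s c == t d)%:R)); last first.
    move=> u.
    rewrite (eq_av (G := fun w => (u == w)%:R + (\sum_c ((s c == u)%:R + (t c == u)%:R)
      + \sum_c ((s c == w)%:R + (t c == w)%:R)) +
      (collisions s)%:R + (collisions t)%:R + \sum_c \sum_d (s c == t d)%:R)); last first.
      move=> w; rewrite !natrD; congr (_ + _ + _ + _ + _).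
        rewrite -big_split natr_sum /=; apply: eq_bigr => c _; rewrite !natrD; ring.
      by rewrite natr_sum; apply: eq_bigr => c _; rewrite natr_sum.
    rewrite !avD !av_cst // av_sum; congr (_ + (_ + _) + _ + _ + _).
      by rewrite -(av_coincide R u); apply: eq_av => w; rewrite eq_sym.
    apply: eq_bigr => c _; rewrite avD.
    by congr (_ + _); apply: etrans (av_coincide R _); apply: eq_av => w; rewrite eq_sym.
  rewrite !avD !av_cst // av_sum natrD natrM.
  rewrite (eq_bigr (fun=> n%:R^-1 + n%:R^-1)) => [|c _]; last first.
    rewrite avD.
    by congr (_ + _); apply: etrans (av_coincide R _); apply: eq_av => w; rewrite eq_sym.
  rewrite big_split /= !natr_mul_inv //; ring.
rewrite !avD !av_cst //; congr (_ + _ + _ + _).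
rewrite av_sum expnS expn1 natrM -mulrA -natr_mul_inv // mulr_natl -sumr_const.
apply: eq_bigr => c _; rewrite av_sum; apply: eq_bigr => d _.
rewrite (av_coord W0 d (fun v => (s c == v)%:R)) -[RHS](av_coincide R (s c)).
by apply: eq_av => v; rewrite eq_sym.
Qed.

Definition drift_energy (x : {set T}) : R := energy (drift theta p x).

(** The drift at edge [l] depends on the other factors, so the mean does not factorise. The
    deviation [B] of its coefficient from [p ^+ r.-1] is separated by AM-GM with weight [delta]: the
    drift energy is absorbed later, and the mean square of [B] is O(1/n) by [others_covariance]. *)
Lemma first_order (delta : R) : 0 < delta ->
  `|Ex mu (fun x => av (fun s => \prod_(j < r)
       (if j == l :> nat then ev g (drift theta p x) j s else ev g (base theta p x) j s)))
    - p ^+ r.-1 * Ex mu (fun x => av (fun u => av (drift theta p x u)))|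
  <= delta * Ex mu drift_energy
     + (2 ^+ r + 1) ^+ 2 * (1 + 4 * #|V| + 3 * #|V| ^ 2)%N%:R * n%:R^-1 / (4 * delta).
Proof.
move=> d0; have /andP[p0 p1] := p01.
pose B x u w := av (fun s => others x (plug s u w) - p ^+ r.-1).
have pr1 : 0 <= p ^+ r.-1 <= 1 by rewrite exprn_ge0 ?(ltW p0) //= exprn_ile1 ?(ltW p0) ?(ltW p1).
have E x : av (fun s => \prod_(j < r)
       (if j == l :> nat then ev g (drift theta p x) j s else ev g (base theta p x) j s)) -
    p ^+ r.-1 * av (fun u => av (drift theta p x u)) =
    av (fun u => av (fun w => drift theta p x u w * B x u w)).
  rewrite (av_upd W0 z) (av_upd W0 y).
  rewrite (eq_av (G := fun s => av (fun u => av (fun w =>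
     drift theta p x u w * others x (plug s u w))))); last first.
    move=> s; apply: eq_av => u; apply: eq_av => w.
    rewrite (bigD1 (Ordinal lr)) //= eqxx /ev -/y -/z !updE eqxx (negbTE yz) eqxx; congr (_ * _).
    apply: eq_big => j; first by rewrite -val_eqE.
    by rewrite -val_eqE /= => /negbTE ->.
  rewrite av_exchange -avZ -avB; apply: eq_av => u.
  rewrite av_exchange -avZ -avB; apply: eq_av => w.
  by rewrite avZ /B avB av_cst // mulrBr [p ^+ _ * _]mulrC.
rewrite -ExZ -ExB (eq_Ex E).
apply: (le_trans (ler_norm_Ex _ pm)).
apply: (@le_trans _ _ (Ex mu (fun x => delta * drift_energy x +
   (4 * delta)^-1 * av (fun u => av (fun w => B x u w ^+ 2))))).
  apply: ler_Ex => // x _; apply: (le_trans (ler_norm_av W0 _)).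
  rewrite /drift_energy /energy -!avZ -avD; apply: ler_av => // u.
  apply: (le_trans (ler_norm_av W0 _)); rewrite -!avZ -avD; apply: ler_av => // w.
  set a := drift _ _ _ _ _; set b := B _ _ _.
  have h (e : R) : e = a * b \/ e = - (a * b) -> e <= delta * a ^+ 2 + (4 * delta)^-1 * b ^+ 2.
    move=> he; rewrite -subr_ge0.
    have sq1 : 0 <= delta * (a - b / (2 * delta)) ^+ 2 by rewrite mulr_ge0 ?sqr_ge0 // ltW.
    have sq2 : 0 <= delta * (a + b / (2 * delta)) ^+ 2 by rewrite mulr_ge0 ?sqr_ge0 // ltW.
    have E1 : delta * (a - b / (2 * delta)) ^+ 2 = delta * a ^+ 2 + (4 * delta)^-1 * b ^+ 2 - a * b.
      by field; rewrite gt_eqF.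
    have E2 : delta * (a + b / (2 * delta)) ^+ 2 = delta * a ^+ 2 + (4 * delta)^-1 * b ^+ 2 + a * b.
      by field; rewrite gt_eqF.
    by case: he => ->; rewrite ?opprK -?E1 -?E2.
  by apply: h; case: (ger0P (a * b)); [left|right].
rewrite ExD !ExZ lerD2l [leRHS]mulrC ler_wpM2l ?invr_ge0 ?mulr_ge0 ?(ltW d0) //.
pose FF s t u w := Ex mu (fun x => (others x (plug s u w) - p ^+ r.-1) *
                                  (others x (plug t u w) - p ^+ r.-1)).
(* The square is an average over two independent placements [s] and [t] that share the image of edge
   [l]. *)
have -> : Ex mu (fun x => av (fun u => av (fun w => B x u w ^+ 2))) =
   av (fun s => av (fun t => av (fun u => av (fun w => FF s t u w)))).
  rewrite [RHS](eq_av (G := fun s => av (fun u => av (fun w => av (fun t => FF s t u w))))); last first.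
    by move=> s; rewrite av_exchange; apply: eq_av => u; rewrite av_exchange.
  rewrite [RHS]av_exchange Ex_av; apply: eq_av => u.
  rewrite [RHS]av_exchange Ex_av; apply: eq_av => w.
  rewrite /FF (eq_Ex (g := fun x => av (fun s => av (fun t =>
     (others x (plug s u w) - p ^+ r.-1) * (others x (plug t u w) - p ^+ r.-1))))); last first.
    move=> x; rewrite expr2 /B -avZr; apply: eq_av => s; rewrite mulrC -avZr.
    by apply: eq_av => t; rewrite mulrC.
  by rewrite Ex_av; apply: eq_av => s; rewrite Ex_av.
rewrite -mulrA.
apply: le_trans (ler_wpM2l _ av_cross_collisions); last by rewrite sqr_ge0.
rewrite -avZ; apply: ler_av => // s; rewrite -avZ; apply: ler_av => // t.
rewrite -avZ; apply: ler_av => // u; rewrite -avZ; apply: ler_av => // w.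
have [c0|c0] := posnP (cross_collisions s t u w).
  by rewrite /FF others_covariance // c0 mulr0.
apply: (@le_trans _ _ ((2 ^+ r + 1) ^+ 2)); last by rewrite ler_peMr ?sqr_ge0 // ler1n.
apply: (le_trans (ler_norm _)); apply: (Ex_norm_le pm muO) => x _.
have ob t' : `|others x t' - p ^+ r.-1| <= 2 ^+ r + 1.
  apply: (le_trans (ler_normB _ _)); rewrite lerD ?others_bound //.
  by case/andP: pr1 => ? ?; rewrite ger0_norm.
by rewrite normrM expr2 ler_pM.
Qed.

End LowOrderTerms.

(** * Four-cycles, cut distance and vertex relabelling *)

Section FourCycles.
Variables (R : realType) (n : nat).
Hypothesis n0 : (0 < n)%N.
Local Notation W := 'I_n.
Implicit Types (Z : W -> W -> R) (f h : W -> R).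
Let W0 : (0 < #|W|)%N. Proof. by rewrite card_ord. Qed.

Lemma av_cauchy_schwarz f h :
  av (fun i => f i * h i) ^+ 2 <= av (fun i => f i ^+ 2) * av (fun i => h i ^+ 2).
Proof.
have : 0 <= av (fun i => av (fun j => (f i * h j - f j * h i) ^+ 2)).
  by apply: av_ge0 => // i; apply: av_ge0 => // j; apply: sqr_ge0.
rewrite (eq_av (G := fun i => f i ^+ 2 * av (fun j => h j ^+ 2)
   - 2 * (f i * h i) * av (fun j => f j * h j) + h i ^+ 2 * av (fun j => f j ^+ 2))); last first.
  move=> i; rewrite -!avZ -avB -avD; apply: eq_av => j; ring.
by rewrite avD avB !avZr avZ; set a := av _; set b := av _; set c := av _; nra.
Qed.

(** Cauchy-Schwarz repeatedly: the form is bounded through the kernel [K] of [Z] composed with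
    itself, and that through the mean square of its entries, which is [four_cycle Z]. *)
Lemma bilinear_of_four_cycle (eps : R) Z : 0 <= eps ->
  (forall u w, Z u w = Z w u) -> four_cycle Z <= eps ^+ 4 -> bilinear_small eps Z.
Proof.
move=> eps0 Zs Z4 al be.
pose A := av (fun u => al u ^+ 2); pose B := av (fun u => be u ^+ 2).
pose K w w' := av (fun u => Z w u * Z w' u).
have A0 : 0 <= A by apply: av_ge0 => // u; apply: sqr_ge0.
have B0 : 0 <= B by apply: av_ge0 => // u; apply: sqr_ge0.
pose Q := av (fun u => av (fun w => Z u w * be w) ^+ 2).
have Q0 : 0 <= Q by apply: av_ge0 => // u; apply: sqr_ge0.
have h1 : av (fun u => av (fun w => Z u w * (al u * be w))) ^+ 2 <= A * Q.
  rewrite (eq_av (G := fun u => al u * av (fun w => Z u w * be w))).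
    exact: av_cauchy_schwarz.
  by move=> u; rewrite -avZ; apply: eq_av => w; ring.
have QE : Q = av (fun w => be w * av (fun w' => be w' * K w w')).
  rewrite /Q (eq_av (G := fun u => av (fun w => av (fun w' => be w * (be w' * (Z w u * Z w' u)))))).
    rewrite av_exchange; apply: eq_av => w; rewrite -avZ av_exchange; apply: eq_av => w'.
    by rewrite /K -!avZ.
  move=> u; rewrite expr2 -avZr; apply: eq_av => w; rewrite mulrC -avZr.
  by apply: eq_av => w'; rewrite (Zs u w) (Zs u w'); ring.
have Q2 : Q ^+ 2 <= B * (B * four_cycle Z).
  rewrite {1}QE; apply: (le_trans (av_cauchy_schwarz _ _)).
  rewrite ler_wpM2l // /four_cycle -avZ; apply: ler_av => // w.
  exact: av_cauchy_schwarz.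
have QB : Q <= eps ^+ 2 * B.
  rewrite -(@ler_pXn2r _ 2) ?nnegrE ?mulr_ge0 ?exprn_ge0 //.
  apply: (le_trans Q2); have -> : (eps ^+ 2 * B) ^+ 2 = B * (B * eps ^+ 4) by ring.
  by rewrite !ler_wpM2l.
apply: (le_trans h1); rewrite -/A -/B.
have -> : eps ^+ 2 * (A * B) = A * (eps ^+ 2 * B) by ring.
by rewrite ler_wpM2l.
Qed.

(* Cut norm controls bilinear forms: split the test functions into positive and negative parts. *)
Lemma bilinear_cut Z (k : R) :
  (forall al be : W -> R, (forall u, 0 <= al u <= 1) -> (forall u, 0 <= be u <= 1) ->
     `|av (fun u => av (fun w => Z u w * (al u * be w)))| <= k) ->
  forall al be : W -> R, (forall u, `|al u| <= 1) -> (forall u, `|be u| <= 1) ->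
     `|av (fun u => av (fun w => Z u w * (al u * be w)))| <= 4 * k.
Proof.
move=> h al be ha hb.
pose pos (f : W -> R) u := Num.max 0 (f u); pose neg (f : W -> R) u := Num.max 0 (- f u).
have fE (f : W -> R) u : f u = pos f u - neg f u.
  rewrite /pos /neg; case: (leP 0 (f u)) => h1; case: (leP 0 (- f u)) => h2; lra.
have p01 (f : W -> R) : (forall u, `|f u| <= 1) -> forall u, 0 <= pos f u <= 1.
  move=> hf u; have := hf u; rewrite /pos ler_norml => /andP[? ?].
  by case: (leP 0 (f u)) => ?; apply/andP; split; lra.
have n01 (f : W -> R) : (forall u, `|f u| <= 1) -> forall u, 0 <= neg f u <= 1.
  move=> hf u; have := hf u; rewrite /neg ler_norml => /andP[? ?].
  by case: (leP 0 (- f u)) => ?; apply/andP; split; lra.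
pose Q (f g : W -> R) := av (fun u => av (fun w => Z u w * (f u * g w))).
have -> : av (fun u => av (fun w => Z u w * (al u * be w))) =
   Q (pos al) (pos be) - Q (pos al) (neg be) - Q (neg al) (pos be) + Q (neg al) (neg be).
  rewrite /Q -!avB -avD; apply: eq_av => u; rewrite -!avB -avD; apply: eq_av => w.
  rewrite {1}(fE al u) {1}(fE be w); ring.
have := h _ _ (p01 _ ha) (p01 _ hb); have := h _ _ (p01 _ ha) (n01 _ hb).
have := h _ _ (n01 _ ha) (p01 _ hb); have := h _ _ (n01 _ ha) (n01 _ hb).
rewrite -/(Q (neg al) (neg be)) -/(Q (neg al) (pos be)) -/(Q (pos al) (neg be)) -/(Q (pos al) (pos be)).
rewrite !ler_norml => /andP[? ?] /andP[? ?] /andP[? ?] /andP[? ?].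
by apply/andP; split; lra.
Qed.

(** Once [w] and [q] are fixed, the four-cycle is a bilinear form in [u], [c] with kernel [Z] and
    test functions [Z u q], [Z w c], which are bounded by 1. *)
Lemma four_cycle_cut Z (k : R) : 0 <= k ->
  (forall u w, Z u w = Z w u) -> (forall u w, `|Z u w| <= 1) ->
  (forall al be : W -> R, (forall u, 0 <= al u <= 1) -> (forall u, 0 <= be u <= 1) ->
     `|av (fun u => av (fun w => Z u w * (al u * be w)))| <= k) ->
  four_cycle Z <= 4 * k.
Proof.
move=> k0 Zs Z1 h.
have -> : four_cycle Z = av (fun w : W => av (fun q : W => Z w q *
     av (fun u : W => av (fun c : W => Z u c * (Z u q * Z w c))))).
  rewrite /four_cycle av_exchange; apply: eq_av => w.
  rewrite [RHS](eq_av (G := fun q : W => av (fun u => av (fun c => Z w q * (Z u c * (Z u q * Z w c)))))).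
    rewrite [RHS]av_exchange; apply: eq_av => u.
    rewrite [RHS]av_exchange.
    rewrite expr2 -avZr; apply: eq_av => c; rewrite mulrC -avZr; apply: eq_av => q; ring.
  by move=> q; rewrite -avZ; apply: eq_av => u; rewrite -avZ.
apply: (le_trans (ler_norm _)); apply: av_norm_le => // w; apply: av_norm_le => // q.
rewrite normrM -[leRHS]mul1r ler_pM //.
exact: (bilinear_cut h).
Qed.

Lemma small_row_means (eps : R) Z : 0 <= eps -> bilinear_small eps Z ->
  av (fun b => `|av (Z b)|) <= eps.
Proof.
move=> eps0 Zb; pose al b : R := Num.sg (av (Z b)).
have := Zb al (fun=> 1).
have -> : av (fun u => av (fun w => Z u w * (al u * 1))) = av (fun b => `|av (Z b)|).
  by apply: eq_av => u; rewrite avZr mulr1 mulrC /al -normrEsg.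
have -> : av (fun _ : W => 1 ^+ 2 : R) = 1 by rewrite av_cst // expr1n.
move=> h; have a1 : av (fun u => al u ^+ 2) <= 1.
  rewrite -[leRHS](@av_cst R W) //; apply: ler_av => // u; rewrite /al.
  by case: (sgrP (av (Z u))) => _; rewrite ?expr0n ?expr1n ?sqrrN ?expr1n ?lexx ?ler01.
rewrite -(@ler_pXn2r _ 2) ?nnegrE //; last by apply: av_ge0.
apply: (le_trans h); rewrite mulr1 ler_piMr ?sqr_ge0 //.
Qed.

End FourCycles.

Section CutBall.
Variables (R : realType) (n : nat).
Hypothesis n0 : (0 < n)%N.
Let nR0 : 0 < n%:R :> R. Proof. by rewrite ltr0n. Qed.
Local Notation W := 'I_n.
Local Notation T := {set 'I_n}.
Let W0 : (0 < #|W|)%N. Proof. by rewrite card_ord. Qed.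

Definition block (i : nat) : set R := `[(i%:R / n%:R : R), (i.+1%:R / n%:R : R)[%classic.

Lemma measure_co (a b : R) : a <= b ->
  lebesgue_measure (`[a, b[%classic : set R) = (b - a)%:E.
Proof.
move=> ab; rewrite lebesgue_measure_itv /= lte_fin; case: ltP => h; first by rewrite EFinB.
by congr (_%:E); have := le_anti (introT andP (conj ab h)) => ->; rewrite subrr.
Qed.

Lemma block_width (i : nat) : i.+1%:R / n%:R - i%:R / n%:R = n%:R^-1 :> R.
Proof. by rewrite -mulrBl -natr1 addrC addKr mul1r. Qed.

Lemma block_le (i : nat) : i%:R / n%:R <= i.+1%:R / n%:R :> R.
Proof. by rewrite -subr_ge0 block_width invr_ge0. Qed.

Lemma step_meas_bound (S : set R) (i : W) : measurable S ->
  0 <= step_meas R n S i <= n%:R^-1.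
Proof.
move=> mS; rewrite /step_meas -/(block i).
have mB : measurable (block i) by exact: measurable_itv.
have le : (lebesgue_measure (S `&` block i) <= (n%:R^-1)%:E :> \bar R)%E.
  rewrite -(block_width i) -(measure_co (block_le i)); apply: le_measure.
  - by rewrite inE; exact: measurableI.
  - by rewrite inE.
  - exact: subIsetr.
have ge : (0 <= lebesgue_measure (S `&` block i) :> \bar R)%E by apply: measure_ge0.
by case: (lebesgue_measure _) le ge => [r||] //=; rewrite !lee_fin => -> ->.
Qed.

(** Only the fraction of each block occupied by a set enters the cut integral. This set realises
    prescribed fractions by filling each block from its left end, so the supremum over sets becomes
    one over weights in [0,1]. *)
Definition fill (s : W -> R) : set R :=
  [set t | exists i : W, i%:R / n%:R <= t < (i%:R + s i) / n%:R]%classic.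

Lemma fill_block (s : W -> R) (i : W) : (forall i, 0 <= s i <= 1) ->
  (fill s `&` block i)%classic = `[(i%:R / n%:R : R), ((i%:R + s i) / n%:R : R)[%classic.
Proof.
move=> s01; apply/seteqP; split=> t /=; rewrite !in_itv /=.
  move=> [[j /andP[j1 j2]]]; rewrite /block /= in_itv /= => /andP[i1 i2].
  suff -> : i = j by rewrite j1 j2.
  have /andP[_ sj] := s01 j; apply/ord_inj/eqP; rewrite eqn_leq.
  have h1 : (j%:R / n%:R < i.+1%:R / n%:R :> R) by apply: le_lt_trans i2.
  have h2 : (i%:R / n%:R < j.+1%:R / n%:R :> R).
    apply: (le_lt_trans i1); apply: (lt_le_trans j2).
    by rewrite ler_pM2r ?invr_gt0 // -natr1 lerD2l.
  move: h1 h2; rewrite !ltr_pM2r ?invr_gt0 // !ltr_nat !ltnS => -> ->; by [].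
move=> /andP[t1 t2]; split; first by exists i; rewrite t1.
rewrite /block /= in_itv /= t1 /=; apply: (lt_le_trans t2).
have /andP[_ si] := s01 i.
by rewrite ler_pM2r ?invr_gt0 // -natr1 lerD2l.
Qed.

Lemma fill_measurable (s : W -> R) : measurable (fill s).
Proof.
have -> : fill s = (\bigcup_(i in [set: W]) `[(i%:R / n%:R : R), ((i%:R + s i) / n%:R : R)[)%classic.
  apply/seteqP; split=> t /=.
    by move=> [i hi]; exists i => //=; rewrite in_itv.
  by move=> [i _ /=]; rewrite in_itv /= => hi; exists i.
apply: fin_bigcup_measurable => [|i _]; [exact: finite_finset|exact: measurable_itv].
Qed.

Lemma fill_sub (s : W -> R) : (forall i, 0 <= s i <= 1) -> (fill s `<=` `[0, 1])%classic.
Proof.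
move=> s01 t /= [i /andP[t1 t2]]; rewrite in_itv /=; apply/andP; split.
  by apply: le_trans t1; rewrite divr_ge0.
apply: (le_trans (ltW t2)); rewrite ler_pdivrMr // mul1r.
have /andP[_ si] := s01 i; apply: (@le_trans _ _ (i.+1%:R)); first by rewrite -natr1 lerD2l.
by rewrite ler_nat.
Qed.

Lemma step_meas_fill (s : W -> R) (i : W) : (forall i, 0 <= s i <= 1) ->
  step_meas R n (fill s) i = s i / n%:R.
Proof.
move=> s01; rewrite /step_meas -/(block i) fill_block //.
have /andP[s0 _] := s01 i.
rewrite measure_co /=; first by rewrite mulrDl addrC addKr.
by rewrite ler_pM2r ?invr_gt0 // lerDl.
Qed.

Definition cut_form (x : {set T}) (p : R) (s t : W -> R) : R :=
  av (fun u => av (fun w => (adj R x u w - p) * (s u * t w))).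

Lemma cut_integral_form (x : {set T}) (p : R) (A B : set R) (s t : W -> R) :
  (forall i, step_meas R n A i = s i / n%:R) -> (forall i, step_meas R n B i = t i / n%:R) ->
  cut_integral R n x p A B = cut_form x p s t.
Proof.
move=> hs ht; rewrite /cut_integral /cut_form avE card_ord mulr_sumr.
apply: eq_bigr => i _; rewrite avE card_ord mulrA mulr_sumr; apply: eq_bigr => j _.
by rewrite hs ht /adj; ring.
Qed.

Definition cut_values (x : {set T}) (p : R) : set R :=
  [set r | exists s t : W -> R, [/\ forall i, 0 <= s i <= 1, forall i, 0 <= t i <= 1
     & r = `|cut_form x p s t|]]%classic.

Lemma cut_distE (x : {set T}) (p : R) : cut_dist R n x p = sup (cut_values x p).
Proof.
rewrite /cut_dist; congr sup; apply/seteqP; split=> r /=.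
  move=> [A [B [mA mB _ _ ->]]].
  exists (fun i => n%:R * step_meas R n A i), (fun i => n%:R * step_meas R n B i); split.
  - move=> i; have /andP[h1 h2] := step_meas_bound i mA.
    by rewrite mulr_ge0 //= -ler_pdivlMl // mulr1.
  - move=> i; have /andP[h1 h2] := step_meas_bound i mB.
    by rewrite mulr_ge0 //= -ler_pdivlMl // mulr1.
  - by congr `|_|; apply: cut_integral_form => i; rewrite mulrC mulKf ?gt_eqF.
move=> [s [t [s01 t01 ->]]]; exists (fill s), (fill t); split.
- exact: fill_measurable.
- exact: fill_measurable.
- exact: fill_sub.
- exact: fill_sub.
- by congr `|_|; apply/esym/cut_integral_form => i; exact: step_meas_fill.
Qed.

Lemma cut_form_bound (x : {set T}) (p : R) (s t : W -> R) : 0 <= p <= 1 ->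
  (forall i, 0 <= s i <= 1) -> (forall i, 0 <= t i <= 1) -> `|cut_form x p s t| <= 1.
Proof.
move=> /andP[p0 p1] s01 t01; apply: av_norm_le => // u; apply: av_norm_le => // w.
have /andP[? ?] := s01 u; have /andP[? ?] := t01 w; have /andP[? ?] := adj01 R x u w.
rewrite !normrM -[leRHS]mul1r ler_pM //; first by rewrite ler_norml; apply/andP; split; lra.
by rewrite -[leRHS]mul1r ler_pM ?normr_ge0 // ger0_norm.
Qed.

Lemma cut_form_le (x : {set T}) (p : R) (s t : W -> R) : 0 <= p <= 1 ->
  (forall i, 0 <= s i <= 1) -> (forall i, 0 <= t i <= 1) ->
  `|cut_form x p s t| <= cut_dist R n x p.
Proof.
move=> p01 s01 t01; rewrite cut_distE; apply: ub_le_sup; last by exists s, t.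
by exists 1 => r /= [s' [t' [h1 h2 ->]]]; apply: cut_form_bound.
Qed.

Lemma cut_dist_le (x : {set T}) (p k : R) :
  (forall s t : W -> R, (forall i, 0 <= s i <= 1) -> (forall i, 0 <= t i <= 1) ->
     `|cut_form x p s t| <= k) -> cut_dist R n x p <= k.
Proof.
move=> h; rewrite cut_distE; apply: ge_sup.
  by exists `|cut_form x p (fun=> 0) (fun=> 0)|, (fun=> 0), (fun=> 0); split => // i;
    rewrite lexx ler01.
by move=> r /= [s [t [h1 h2 ->]]]; apply: h.
Qed.

(** Cut distance and four-cycle density control each other. This direction is applied on the support
    of the conditioned measure; the converse shows that most of the product measure lies in the
    ball. *)
Lemma four_cycle_of_cut (x : {set T}) (p : R) : 0 <= p <= 1 ->
  four_cycle (fun u w => adj R x u w - p) <= 4 * cut_dist R n x p.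
Proof.
move=> p01; have /andP[p0 p1] := p01; apply: four_cycle_cut => //.
- have z01 (i : W) : 0 <= (fun=> 0 : R) i <= 1 by rewrite lexx ler01.
  exact: (le_trans (normr_ge0 _) (cut_form_le x p01 z01 z01)).
- by move=> u w; rewrite adj_sym.
- move=> u w; have /andP[? ?] := adj01 R x u w.
  by rewrite ler_norml; apply/andP; split; lra.
- by move=> s t s01 t01; apply: cut_form_le.
Qed.

Lemma cut_of_four_cycle (x : {set T}) (p eps : R) : 0 <= eps ->
  four_cycle (fun u w => adj R x u w - p) <= eps ^+ 4 -> cut_dist R n x p <= eps.
Proof.
move=> eps0 h4; apply: cut_dist_le => s t s01 t01.
have sym u w : adj R x u w - p = adj R x w u - p by rewrite adj_sym.
have b := bilinear_of_four_cycle n0 eps0 sym h4 s t.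
have sq1 (f : W -> R) : (forall i, 0 <= f i <= 1) -> av (fun u => f u ^+ 2) <= 1.
  move=> f01; rewrite -[leRHS](@av_cst R W) //; apply: ler_av => // u.
  by have /andP[? ?] := f01 u; rewrite exprn_ile1.
have sq0 (f : W -> R) : 0 <= av (fun u => f u ^+ 2) by apply: av_ge0 => // u; apply: sqr_ge0.
rewrite -(@ler_pXn2r _ 2) ?nnegrE // real_normK ?num_real //.
apply: (le_trans b); rewrite ler_piMr ?sqr_ge0 // -[leRHS]mul1r ler_pM ?sq1 //.
Qed.

Lemma permute_adj (s : W -> W) (x : {set T}) u w : injective s ->
  adj R ((fun e : T => [set s i | i in e]%SET) @: x)%SET (s u) (s w) = adj R x u w.
Proof.
move=> sI0; have sI : injective (fun e : T => [set s i | i in e]%SET) by apply: imset_inj.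
rewrite /adj; congr ((nat_of_bool _)%:R).
have -> : [set s u; s w]%SET = [set s i | i in [set u; w]%SET]%SET.
  by rewrite finset.imsetU1 finset.imset_set1.
by rewrite mem_imset.
Qed.

End CutBall.

(** * Homomorphism densities and invariance under relabelling *)

Lemma mem_mkset_bool (T : Type) (P : pred T) (t : T) : (t \in [set u | P u]%classic) = P t.
Proof. by apply/idP/idP => [/set_mem|/mem_set]. Qed.

Section HomDensity.
Variable R : realType.

Definition density (V : finType) (g : nat -> V * V) (r n : nat) (x : {set {set 'I_n}}) : R :=
  av (fun s : {ffun V -> 'I_n} => \prod_(j < r) ev g (adj R x) j s).

(* A nonempty vertex type, so that the dummy value of the listing exists even when v = 0. *)
Lemma hom_count_density (v : nat) (E : {set {set 'I_v}}) : E \subset edges v ->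
  exists g : nat -> 'I_v.-1.+1 * 'I_v.-1.+1, simple_edges g #|E| /\
    forall n (x : {set {set 'I_n}}), (0 < n)%N ->
      (hom_count v E n x)%:R = n%:R ^+ v * density g #|E| x.
Proof.
case: v E => [|v] E /fintype.subsetP EE.
  exists (fun=> (ord0, ord0)).
  have -> : E = finset.set0.
    apply/setP => e; rewrite !inE; apply/negP => /EE; rewrite /edges inE => /eqP e2.
    by have := max_card (mem e); rewrite e2 card_ord.
  rewrite cards0; split; first by split.
  move=> n x n0; rewrite expr0 mul1r /density (eq_av (G := fun=> 1)); last by move=> s; rewrite big_ord0.
  rewrite av_cst ?ffun_card_gt0 ?card_ord // /hom_count.
  rewrite (eq_card (B := predT)) => [|s].
    by rewrite card_ffun !card_ord expn0.
  rewrite mem_mkset_bool; by apply/forallP => e; apply/implyP; rewrite finset.in_set0.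
rewrite /=; pose V := 'I_v.+1.
pose l := enum E.
pose pr (e : {set V}) : V * V :=
  if [pick q : V * V | (q.1 != q.2) && (e == [set q.1; q.2]%SET)] is Some q then q else (ord0, ord0).
have prP e : e \in E -> (pr e).1 != (pr e).2 /\ e = [set (pr e).1; (pr e).2]%SET.
  move=> /EE; rewrite /edges inE => /cards2P[a [b [ab eE]]]; rewrite /pr.
  case: pickP => [q /andP[q1 /eqP q2]|/(_ (a, b))]; first by split.
  by rewrite /= ab eE eqxx.
pose g j := pr (nth finset.set0 l j).
have sl : size l = #|E| by rewrite -cardE.
have gE j : (j < #|E|)%N -> nth finset.set0 l j \in E.
  by move=> jr; rewrite -mem_enum mem_nth // sl.
exists g; split.
  split=> [j jr|i j ir jr ij c d cd ic id jc]; first by have [] := prP _ (gE j jr).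
  apply/negP => jd; have [gi Ei] := prP _ (gE i ir); have [gj Ej] := prP _ (gE j jr).
  have sub k (kr : (k < #|E|)%N) : touches g k c -> touches g k d ->
      nth finset.set0 l k = [set c; d]%SET.
    have [gk Ek] := prP _ (gE k kr).
    move=> kc kd; rewrite Ek; move: kc kd gk; rewrite /touches -/(g k).
    case/orP=> /eqP c1; case/orP=> /eqP d1 _.
    - by move: cd; rewrite c1 d1 eqxx.
    - by rewrite -c1 -d1.
    - by rewrite -c1 -d1 finset.setUC.
    - by move: cd; rewrite c1 d1 eqxx.
  have E1 := sub i ir ic id; have E2 := sub j jr jc jd.
  move: ij; rewrite -(nth_uniq finset.set0 (s := l)) ?sl ?enum_uniq //.
  by rewrite E1 E2 eqxx.
move=> n x n0; rewrite /density avE card_ffun !card_ord natrX mulrA divff ?mul1r; last first.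
  by rewrite expf_neq0 // pnatr_eq0 -lt0n.
rewrite /hom_count -sum1_card natr_sum big_mkcond /=; apply: eq_bigr => s _.
rewrite mem_mkset_bool.
have -> : \prod_(j < #|E|) ev g (adj R x) j s =
   ([forall j : 'I_#|E|, [set s (g j).1; s (g j).2]%SET \in x])%:R.
  case: forallP => h; first by rewrite big1 // => j _; rewrite /ev /adj h.
  have /existsP[j hj] : [exists j : 'I_#|E|, [set s (g j).1; s (g j).2]%SET \notin x].
    by rewrite -negb_forall; apply/negP => /forallP.
  by rewrite (bigD1 j) //= /ev /adj (negbTE hj) mul0r.
have -> : [forall e in E, [forall u in e, [forall w in e,
          (u != w) ==> ([set s u; s w]%SET \in x)]]] =
   [forall j : 'I_#|E|, [set s (g j).1; s (g j).2]%SET \in x].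
  apply/forall_inP/forallP => [h j|h e eE].
    have [gj Ej] := prP _ (gE j (ltn_ord j)).
    have /forall_inP := h _ (gE j (ltn_ord j)) => /(_ (g j).1); rewrite {1}Ej !inE eqxx => /(_ isT).
    by move=> /forall_inP/(_ (g j).2); rewrite {1}Ej !inE eqxx orbT => /(_ isT) /implyP; apply.
  have ir : (index e l < #|E|)%N by rewrite -sl index_mem mem_enum.
  have hj := h (Ordinal ir); have eN : nth finset.set0 l (index e l) = e by rewrite nth_index // mem_enum.
  have [ge Ee] := prP e eE.
  have gi : g (index e l) = pr e by rewrite /g eN.
  move: hj; rewrite /= gi => hj.
  apply/forall_inP => u ue; apply/forall_inP => w we; apply/implyP => uw.
  move: ue we uw; rewrite Ee !inE => /orP[] /eqP -> /orP[] /eqP -> //; rewrite ?eqxx // => _.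
  by rewrite finset.setUC.
by case: forallP.
Qed.

Section Relabel.
Variables (n : nat) (f : 'I_n -> 'I_n).
Hypotheses (n0 : (0 < n)%N) (fK : involutive f).

(** Involutions suffice, since only transpositions and products of two disjoint ones are used later;
    because such a map is its own inverse, a one-sided inequality already yields invariance. *)
Definition relabel (x : {set {set 'I_n}}) : {set {set 'I_n}} :=
  ((fun e : {set 'I_n} => [set f i | i in e]) @: x)%SET.

Lemma relabelK : involutive relabel.
Proof.
have fe (e : {set 'I_n}) : [set f i | i in [set f i | i in e]]%SET = e.
  rewrite -imset_comp (eq_imset (g := id)) ?imset_id // => i; exact: fK.
move=> x; rewrite /relabel -imset_comp (eq_imset (g := id)) ?imset_id // => e; exact: fe.
Qed.

Lemma relabel_Omega x : x \in Omega n -> relabel x \in Omega n.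
Proof.
rewrite /Omega !inE => /fintype.subsetP xE; apply/fintype.subsetP => _ /imsetP[e ex ->].
by have := xE e ex; rewrite /edges !inE card_imset //; apply: inv_inj.
Qed.

Lemma adj_relabel x u w : adj R (relabel x) (f u) (f w) = adj R x u w.
Proof. by apply: permute_adj; apply: inv_inj. Qed.

Lemma av_relabel (F : 'I_n -> R) : av (fun u => F (f u)) = av F.
Proof. by rewrite !avE [in RHS](reindex_inj (inv_inj fK)). Qed.

Lemma density_relabel (V : finType) (g : nat -> V * V) r x :
  density g r (relabel x) = density g r x.
Proof.
rewrite /density !avE; congr (_ * _).
pose h (s : {ffun V -> 'I_n}) : {ffun V -> 'I_n} := [ffun c => f (s c)].
have hK : involutive h by move=> s; apply/ffunP => c; rewrite !ffunE fK.
rewrite (reindex_inj (inv_inj hK)) /=; apply: eq_bigr => s _; apply: eq_bigr => j _.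
by rewrite /ev !ffunE adj_relabel.
Qed.

Lemma cut_dist_relabel_le x p : 0 <= p <= 1 -> cut_dist R n (relabel x) p <= cut_dist R n x p.
Proof.
move=> p01; apply: cut_dist_le => // s t s01 t01.
have -> : cut_form (relabel x) p s t = cut_form x p (fun u => s (f u)) (fun u => t (f u)).
  rewrite /cut_form -av_relabel; apply: eq_av => u; rewrite -av_relabel; apply: eq_av => w.
  by rewrite adj_relabel.
by apply: cut_form_le.
Qed.

Lemma cut_ball_relabel x p eta : 0 <= p <= 1 ->
  (relabel x \in cut_ball R n eta p) = (x \in cut_ball R n eta p).
Proof.
move=> p01.
have imp y : y \in cut_ball R n eta p -> relabel y \in cut_ball R n eta p.
  have ballE z : (z \in cut_ball R n eta p) = (z \in Omega n) && (cut_dist R n z p < eta).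
    by rewrite {1}/cut_ball finset.in_set.
  rewrite !ballE => /andP[yO yd]; rewrite relabel_Omega //=; exact: le_lt_trans (cut_dist_relabel_le y p01) yd.
by apply/idP/idP; [rewrite -{2}(relabelK x)|]; apply: imp.
Qed.

End Relabel.

Section Energy.
Variables (K : nat) (v : 'I_K.+1 -> nat) (E : forall i : 'I_K.+1, {set {set 'I_(v i)}})
  (beta : 'I_K.+1 -> R).
Variable g : forall i : 'I_K.+1, nat -> 'I_(v i).-1.+1 * 'I_(v i).-1.+1.
Hypothesis gE : forall i n (x : {set {set 'I_n}}), (0 < n)%N ->
  (hom_count (v i) (E i) n x)%:R = n%:R ^+ (v i) * density (@g i) #|E i| x.

Lemma hamiltonian_density n (x : {set {set 'I_n}}) : (0 < n)%N ->
  hamiltonian R K v E beta n x = n%:R ^+ 2 * \sum_i beta i * density (@g i) #|E i| x.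
Proof.
move=> n0; rewrite /hamiltonian mulr_sumr; apply: eq_bigr => i _.
have nz : n%:R != 0 :> R by rewrite pnatr_eq0 -lt0n.
rewrite (gE i x n0) -mulrA [in RHS]mulrCA; congr (_ * _); rewrite mulrA; congr (_ * _).
by rewrite !exprnP -expfzDr // subrK.
Qed.

Lemma cond_ergm_relabel n (f : 'I_n -> 'I_n) (eta p : R) x : (0 < n)%N -> involutive f ->
  0 <= p <= 1 ->
  cond_ergm R K v E beta n eta p (relabel f x) = cond_ergm R K v E beta n eta p x.
Proof.
move=> n0 fK p01; rewrite /cond_ergm (cut_ball_relabel n0 fK x eta p01).
have -> // : hamiltonian R K v E beta n (relabel f x) = hamiltonian R K v E beta n x.
rewrite (hamiltonian_density _ n0) (hamiltonian_density x n0); congr (_ * _).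
by apply: eq_bigr => i _; rewrite density_relabel.
Qed.

End Energy.
End HomDensity.

(** * Bernoulli divergence and the optimum *)

Section Divergence.
Variable R : realType.
Implicit Types p q x : R.

Lemma is_derive_xlnx x : 0 < x -> is_derive x 1 (@xlnx R) (ln x + 1).
Proof.
move=> x0; rewrite /xlnx; have h := is_derive1_ln x0; apply: is_derive_eq.
by rewrite /GRing.scale /= mulr1 addrC mulfV ?gt_eqF.
Qed.

Lemma is_derive_ln1m x : x < 1 -> is_derive x 1 (fun u : R => ln (1 - u)) (- (1 - x)^-1).
Proof.
move=> x1; have x0 : 0 < 1 - x by rewrite subr_gt0.
have h := is_derive1_ln x0.
have h1 : is_derive x 1 (fun u : R => 1 - u) (- 1).
  by apply: is_derive_eq; ring.
have := @is_derive1_comp R (@ln R) (fun u : R => 1 - u) x _ _ h h1.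
by rewrite mulrN1.
Qed.

Lemma is_derive_xlnx1m x : x < 1 ->
  is_derive x 1 (fun u : R => xlnx (1 - u)) (- ln (1 - x) - 1).
Proof.
move=> x1; have x0 : 0 < 1 - x by rewrite subr_gt0.
have h := is_derive_xlnx x0.
have h1 : is_derive x 1 (fun u : R => 1 - u) (- 1).
  by apply: is_derive_eq; ring.
have := @is_derive1_comp R (@xlnx R) (fun u : R => 1 - u) x _ _ h h1.
by rewrite mulrN1 opprD.
Qed.

Lemma mvt_closed (f df : R -> R) (a b : R) : a < b ->
  (forall x, a <= x <= b -> is_derive x 1 f (df x)) ->
  exists2 c, a < c < b & f b - f a = df c * (b - a).
Proof.
move=> ab fd.
have [x|//|c cab E] := @MVT R f df a b ab.
- by rewrite in_itv /= => /andP[? ?]; apply: fd; rewrite !ltW.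
- apply: derivable_within_continuous => x; rewrite in_itv /= => xab.
  by have [] := fd x xab.
by exists c => //; move: cab; rewrite in_itv.
Qed.

(* Kullback-Leibler divergence of Bernoulli(p + z) from Bernoulli(p). *)
Definition kl p z : R :=
  xlnx (p + z) + xlnx (1 - (p + z)) - (p + z) * ln p - (1 - (p + z)) * ln (1 - p).

Lemma xlnx_le0 x : 0 <= x <= 1 -> xlnx x <= 0.
Proof. by move=> /andP[x0 x1]; rewrite mulr_ge0_le0 // ln_le0. Qed.

Lemma kl_le p z : 0 < p < 1 -> 0 <= p + z <= 1 -> kl p z <= - ln p - ln (1 - p).
Proof.
move=> /andP[p0 p1] /andP[q0 q1]; rewrite /kl.
have h1 : xlnx (p + z) <= 0 by apply: xlnx_le0; rewrite q0.
have h2 : xlnx (1 - (p + z)) <= 0 by apply: xlnx_le0; apply/andP; split; lra.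
have l1 : ln p <= 0 by apply: ln_le0; exact: ltW.
have l2 : ln (1 - p) <= 0 by apply: ln_le0; lra.
by set q := p + z in q0 q1 h1 h2 *; nra.
Qed.

(** The difference of the two sides, as a function of [q], vanishes at [p] together with its
    derivative, and its second derivative [1 / (s (1 - s)) - 2 tau] is nonnegative between [p] and
    [q]. *)
Lemma kl_lower_interior p q (tau : R) : 0 < p < 1 -> 0 < q < 1 ->
  (forall s, Num.min p q <= s <= Num.max p q -> 2 * tau * (s * (1 - s)) <= 1) ->
  tau * (q - p) ^+ 2 <= kl p (q - p).
Proof.
move=> /andP[p0 p1] /andP[q0 q1] htau.
pose f (s : R) := xlnx s + xlnx (1 - s) - s * ln p - (1 - s) * ln (1 - p) - tau * (s - p) ^+ 2.
pose f1 (s : R) := ln s - ln (1 - s) - ln p + ln (1 - p) - 2 * tau * (s - p).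
pose f2 (s : R) := s^-1 + (1 - s)^-1 - 2 * tau.
have fd (s : R) : 0 < s < 1 -> is_derive s 1 f (f1 s).
  move=> /andP[s0 s1]; have h1 := is_derive_xlnx s0; have h2 := is_derive_xlnx1m s1.
  rewrite /f; apply: is_derive_eq; rewrite /f1 /GRing.scale /=.
  ring.
have f1d (s : R) : 0 < s < 1 -> is_derive s 1 f1 (f2 s).
  move=> /andP[s0 s1]; have h1 := is_derive1_ln s0; have h2 := is_derive_ln1m s1.
  rewrite /f1; apply: is_derive_eq; rewrite /f2 /GRing.scale /=.
  ring.
have f2p (s : R) : 0 < s < 1 -> Num.min p q <= s <= Num.max p q -> 0 <= f2 s.
  move=> /andP[s0 s1] /htau hs.
  have -> : f2 s = (1 - 2 * tau * (s * (1 - s))) / (s * (1 - s)).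
    by rewrite /f2; field; rewrite !gt_eqF //; lra.
  by rewrite divr_ge0 ?subr_ge0 // mulr_ge0 ?ltW // subr_gt0.
have fp : f p = 0 by rewrite /f /xlnx subrr; ring.
have f1p : f1 p = 0 by rewrite /f1 subrr; ring.
suff : 0 <= f q.
  have E : f q = kl p (q - p) - tau * (q - p) ^+ 2 by rewrite /f /kl (addrC p) subrK.
  by rewrite E subr_ge0.
have [pq|qp|pq] := ltgtP p q; last by rewrite -pq fp.
- have mm (s : R) : p <= s <= q -> Num.min p q <= s <= Num.max p q.
    by rewrite minEle maxEle (ltW pq).
  have [|c /andP[c1 c2] E] := mvt_closed (f := f) (df := f1) pq.
    by move=> x /andP[? ?]; apply: fd; apply/andP; split; lra.
  have [|d /andP[d1 d2] E1] := mvt_closed (f := f1) (df := f2) c1.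
    by move=> x /andP[? ?]; apply: f1d; apply/andP; split; lra.
  have h2 : 0 <= f2 d by apply: f2p; [|apply: mm]; apply/andP; split; lra.
  have h1 : 0 <= f1 c by move: E1; rewrite f1p subr0 => ->; rewrite mulr_ge0 // subr_ge0 ltW.
  have : 0 <= f q - f p by rewrite E mulr_ge0 // subr_ge0 ltW.
  by rewrite fp subr0.
- have mm (s : R) : q <= s <= p -> Num.min p q <= s <= Num.max p q.
    by rewrite minEle maxEle (lt_geF qp).
  have [|c /andP[c1 c2] E] := mvt_closed (f := f) (df := f1) qp.
    by move=> x /andP[? ?]; apply: fd; apply/andP; split; lra.
  have [|d /andP[d1 d2] E1] := mvt_closed (f := f1) (df := f2) c2.
    by move=> x /andP[? ?]; apply: f1d; apply/andP; split; lra.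
  have h2 : 0 <= f2 d by apply: f2p; [|apply: mm]; apply/andP; split; lra.
  have h1 : f1 c <= 0.
    by move: E1; rewrite f1p sub0r => E1; rewrite -oppr_ge0 E1 mulr_ge0 // subr_ge0 ltW.
  have : f p - f q <= 0 by rewrite E mulr_le0_ge0 // subr_ge0 ltW.
  by rewrite fp sub0r oppr_le0.
Qed.

(* At the endpoints xlnx vanishes and is nonpositive nearby, so the interior bound passes to the limit. *)
Lemma kl_lower_at0 p (tau : R) : 0 < p < 1 -> 0 <= tau ->
  (forall q, 0 < q <= p -> tau * (q - p) ^+ 2 <= kl p (q - p)) ->
  tau * p ^+ 2 <= - ln (1 - p).
Proof.
move=> /andP[p0 p1] tau0 h.
apply/ler_addgt0Pr => e e0.
(* Replacing the endpoint 0 by [q] loses at most [q (2 tau p - ln p)]; the extra 1 makes [C]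
   positive. *)
pose C := 2 * tau * p - ln p + 1.
have lp : ln p <= 0 by apply: ln_le0; exact: ltW.
have C0 : 0 < C by have := mulr_ge0 tau0 (ltW p0); rewrite /C; lra.
pose q := Num.min p (e / C).
have q0 : 0 < q by rewrite lt_min p0 divr_gt0.
have qp : q <= p by rewrite ge_min lexx.
have qe : q * C <= e by rewrite -ler_pdivlMr // ge_min lexx orbT.
have := h q; rewrite q0 qp => /(_ isT); rewrite /kl (addrC p) subrK.
have h1 : xlnx q <= 0 by apply: xlnx_le0; apply/andP; split; lra.
have h2 : xlnx (1 - q) <= 0 by apply: xlnx_le0; apply/andP; split; lra.
have l2 : ln (1 - p) <= 0 by apply: ln_le0; lra.
have t1 : 0 <= tau * q ^+ 2 by rewrite mulr_ge0 ?sqr_ge0.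
have t2 : q * ln (1 - p) <= 0 by rewrite mulr_ge0_le0 // ltW.
move: qe; rewrite /C; lra.
Qed.

Lemma kl_sym p z : kl (1 - p) (- z) = kl p z.
Proof.
rewrite /kl; have -> : 1 - p - z = 1 - (p + z) by ring.
have -> : 1 - (1 - (p + z)) = p + z by ring.
have -> : 1 - (1 - p) = p by ring.
ring.
Qed.

Lemma kl_lower p q (tau : R) : 0 < p < 1 -> 0 <= q <= 1 -> 0 <= tau ->
  (forall s, 0 < s < 1 -> Num.min p q <= s <= Num.max p q -> 2 * tau * (s * (1 - s)) <= 1) ->
  tau * (q - p) ^+ 2 <= kl p (q - p).
Proof.
move=> p01 /andP[q0 q1] tau0 h; have /andP[p0 p1] := p01.
have inner (q' : R) : 0 < q' < 1 -> Num.min p q <= q' <= Num.max p q ->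
    tau * (q' - p) ^+ 2 <= kl p (q' - p).
  move=> /andP[q'0 q'1] /andP[m1 m2]; apply: kl_lower_interior => // [|s /andP[s1 s2]].
    by rewrite q'0.
  have a1 : Num.min p q <= p by rewrite ge_min lexx.
  have a2 : p <= Num.max p q by rewrite le_max lexx.
  apply: h; apply/andP; split.
  - by apply: lt_le_trans s1; rewrite lt_min p0.
  - by apply: le_lt_trans s2 _; rewrite gt_max p1.
  - by apply: le_trans s1; rewrite le_min a1.
  - by apply: (le_trans s2); rewrite ge_max a2.
case: (ltgtP q 0) q0 => // [q0' _|qE _].
  case: (ltgtP q 1) q1 => // [q1' _|qE _].
    by apply: inner; rewrite ?q0' // ge_min le_max !lexx !orbT.
  have E1 : 1 - p = 1 - p by [].
  have -> : kl p (q - p) = - ln p.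
    by rewrite /kl qE (addrC p) subrK /xlnx ln1 subrr !mul0r; ring.
  have -> : q - p = 1 - p by rewrite qE.
  have := @kl_lower_at0 (1 - p) tau; rewrite (_ : 1 - (1 - p) = p); last by ring.
  apply => //; first by apply/andP; split; lra.
  move=> s /andP[s0 s1].
  have -> : s - (1 - p) = - ((1 - s) - p) by ring.
  rewrite sqrrN kl_sym; apply: inner; first by apply/andP; split; lra.
  by rewrite ge_min le_max qE; apply/andP; split; apply/orP; [left|right]; lra.
have -> : kl p (q - p) = - ln (1 - p).
  by rewrite /kl qE (addrC p) subrK /xlnx subr0 ln1 !mul0r; ring.
rewrite qE sub0r sqrrN; apply: kl_lower_at0 => // s /andP[s0 s1].
apply: inner; first by apply/andP; split; lra.
by rewrite ge_min le_max qE; apply/andP; split; apply/orP; [right|left]; lra.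
Qed.

Lemma pinsker p z : 0 < p < 1 -> 0 <= p + z <= 1 -> 2 * z ^+ 2 <= kl p z.
Proof.
move=> p01 q01; have := @kl_lower p (p + z) 2 p01 q01 _ _.
rewrite (addrC p) addrK; apply => // s _ _.
by have := sqr_ge0 (2 * s - 1); lra.
Qed.

(** [1 / (2 p (1 - p))] is half the second derivative of [kl] at 0. The radius [rho] keeps
    [2 tau s (1 - s) <= 1], by [s (1 - s) <= p (1 - p) + |s - p|]. *)
Lemma kl_local p (tau : R) : 0 < p < 1 -> 0 <= tau -> tau < (2 * (p * (1 - p)))^-1 ->
  exists2 rho : R, 0 < rho & forall z, 0 <= p + z <= 1 -> `|z| <= rho -> tau * z ^+ 2 <= kl p z.
Proof.
move=> p01 tau0 htau; have /andP[p0 p1] := p01.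
have pp : 0 < p * (1 - p) by rewrite mulr_gt0 // subr_gt0.
have gap : 0 < 1 - 2 * tau * (p * (1 - p)).
  by move: htau; rewrite -[X in _ < X]mul1r ltr_pdivlMr ?mulr_gt0 //; lra.
pose rho := (1 - 2 * tau * (p * (1 - p))) / (2 * tau + 1) / 2.
have r0 : 0 < rho by rewrite !divr_gt0 //; lra.
have rE : rho * (2 * (2 * tau + 1)) = 1 - 2 * tau * (p * (1 - p)).
  by rewrite /rho; field; rewrite gt_eqF //; lra.
exists rho => // z q01 zr.
have := @kl_lower p (p + z) tau p01 q01 tau0; rewrite (addrC p) addrK; apply => s s01 ms.
have sp : `|s - p| <= rho.
  move: zr ms; rewrite !ler_norml => /andP[z1 z2].
  rewrite minEle maxEle; case: ifP => _ /andP[? ?]; apply/andP; split; lra.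
have E : s * (1 - s) - p * (1 - p) = (s - p) * (1 - s - p) by ring.
have : (s - p) * (1 - s - p) <= rho * 1.
  apply: (le_trans (ler_norm _)); rewrite normrM ler_pM //.
  by case/andP: s01 => ? ?; rewrite ler_norml; apply/andP; split; lra.
rewrite -E mulr1 => h.
have : 2 * tau * (s * (1 - s)) <= 2 * tau * (p * (1 - p) + rho).
  by rewrite ler_wpM2l ?mulr_ge0 //; lra.
by have := mulr_ge0 tau0 (ltW r0); nra.
Qed.

End Divergence.

Section Optimum.
Variables (R : realType) (K : nat) (v : 'I_K.+1 -> nat)
  (E : forall i : 'I_K.+1, {set {set 'I_(v i)}}) (beta : 'I_K.+1 -> R) (p : R).
Hypothesis pU : in_Ubeta R K v E beta p.
Local Notation L := (Lbeta R K v E beta).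
Local Notation r i := #|E i|.

Lemma LbetaE q : L q = \sum_i beta i * q ^+ r i - 2^-1 * xlnx q - 2^-1 * xlnx (1 - q).
Proof. by []. Qed.

Lemma L_max q : 0 <= q <= 1 -> L q <= L p.
Proof. by case: pU => _ h _; apply: h. Qed.

Lemma exists_ln (M : R) : 0 < M -> exists t : R, [/\ 0 < t, t < 1 & ln t = - M].
Proof.
move=> M0; exists (expR (- M)); split; first exact: expR_gt0.
  by rewrite -[ltRHS]expR0 ltr_expR oppr_lt0.
by rewrite expRK.
Qed.

(** At an endpoint the entropy has infinite slope: with [ln t = - (2 m + 1)] it gains at least
    [(m + 1/2) t], while the polynomial part loses at most [m t]. So neither endpoint can be a
    maximiser. *)
Lemma boundary_gain (m t S0 St w : R) : 0 < t -> S0 - m * t <= St -> w <= 0 ->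
  St - 2^-1 * (t * - (2 * m + 1)) - 2^-1 * w <= S0 -> False.
Proof. by move=> t0 h w0; lra. Qed.

Lemma optimum_gt0 : 0 < p.
Proof.
case: (pU) => /andP[p0 _] _ _; rewrite lt_neqAle p0 andbT; apply/eqP => pE.
have m0 : 0 <= \sum_i `|beta i| by apply: sumr_ge0.
have [|t [t0 t1 lnt]] := @exists_ln (2 * (\sum_i `|beta i|) + 1); first by lra.
have tle : 0 <= t <= 1 by rewrite !ltW.
have := L_max tle; rewrite -pE !LbetaE subr0 /xlnx ln1 lnt mul0r !mulr0 !subr0.
have h : \sum_i beta i * 0 ^+ r i - (\sum_i `|beta i|) * t <= \sum_i beta i * t ^+ r i.
  rewrite mulr_suml -sumrB; apply: ler_sum => i _.
  have [->|ri] := posnP (r i); first by rewrite !expr0 lerBlDr lerDl mulr_ge0 // ltW.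
  rewrite expr0n gtn_eqF // mulr0 sub0r.
  have : t ^+ r i <= t by rewrite -[leRHS]expr1 ler_wiXn2l // ltW.
  have : 0 <= t ^+ r i by rewrite exprn_ge0 // ltW.
  have := ler_norm (- beta i); rewrite normrN; have := normr_ge0 (beta i).
  by set a := `|_|; set b := t ^+ _; nra.
have h2 : (1 - t) * ln (1 - t) <= 0.
  by rewrite mulr_ge0_le0 // ?ln_le0 //; lra.
exact: boundary_gain t0 h h2.
Qed.

Lemma optimum_lt1 : p < 1.
Proof.
case: (pU) => /andP[_ p1] _ _; rewrite lt_neqAle p1 andbT; apply/eqP => pE.
have m0 : 0 <= \sum_i `|beta i| * (r i)%:R by apply: sumr_ge0 => i _; rewrite mulr_ge0.
have [|t [t0 t1 lnt]] := @exists_ln (2 * (\sum_i `|beta i| * (r i)%:R) + 1); first by lra.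
have t1' : 0 <= 1 - t by rewrite subr_ge0 ltW.
have t2' : 1 - t <= 1 by rewrite gerBl ltW.
have tle : 0 <= 1 - t <= 1 by rewrite t1' t2'.
have := L_max tle.
rewrite pE !LbetaE subrr /xlnx ln1 mulr0 mul0r !mulr0 !subr0 (_ : 1 - (1 - t) = t); last by ring.
rewrite lnt.
have h : \sum_i beta i * 1 ^+ r i - (\sum_i `|beta i| * (r i)%:R) * t <=
    \sum_i beta i * (1 - t) ^+ r i.
  rewrite mulr_suml -sumrB; apply: ler_sum => i _; rewrite expr1n mulr1.
  have bern : 1 - (1 - t) ^+ r i <= (r i)%:R * t.
    have := pow_tangent (r i) ler01 t1'; rewrite !expr1n mulr1.
    by set a := (r i)%:R; set b := (1 - t) ^+ _; lra.
  have le1 : (1 - t) ^+ r i <= 1 := exprn_ile1 (r i) t1' t2'.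
  have := ler_wpM2r (_ : 0 <= 1 - (1 - t) ^+ r i) (ler_norm (beta i)).
  rewrite subr_ge0 => /(_ le1) e1.
  have e2 := ler_wpM2l (normr_ge0 (beta i)) bern.
  rewrite lerBlDr -lerBlDl -[X in X - _]mulr1 -mulrBr -mulrA.
  exact: le_trans e1 e2.
have h2 : (1 - t) * ln (1 - t) <= 0 by rewrite mulr_ge0_le0 // ln_le0.
rewrite addrAC.
exact: boundary_gain t0 h h2.
Qed.

Let p0 := optimum_gt0.
Let p1 := optimum_lt1.

Definition L1 (q : R) : R := \sum_i beta i * ((r i)%:R * q ^+ (r i).-1) - 2^-1 * (ln q - ln (1 - q)).
Definition L2 (q : R) : R :=
  \sum_i beta i * ((r i)%:R * ((r i).-1%:R * q ^+ (r i).-2)) - 2^-1 * (q^-1 + (1 - q)^-1).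

Lemma is_derive_power_sum (k : 'I_K.+1 -> nat) (c : 'I_K.+1 -> R) (q : R) :
  is_derive q 1 (fun s : R => \sum_i c i * s ^+ k i) (\sum_i c i * ((k i)%:R * q ^+ (k i).-1)).
Proof.
have -> : (fun s : R => \sum_i c i * s ^+ k i) = \sum_i (fun s : R => c i * s ^+ k i).
  by apply/funext => s; rewrite fct_sumE.
apply: is_derive_sum => i.
have h : is_derive q 1 (fun s : R => s ^+ k i) ((k i)%:R * q ^+ (k i).-1).
  have -> : (fun s : R => s ^+ k i) = (id : R -> R) ^+ k i by rewrite exprfctE.
  by apply: is_derive_eq; rewrite /GRing.scale /= mulr1.
by apply: is_derive_eq; rewrite /GRing.scale /=; ring.
Qed.

Lemma is_derive_L (q : R) : 0 < q < 1 -> is_derive q 1 L (L1 q).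
Proof.
move=> /andP[q0 q1]; have h1 := is_derive_xlnx q0; have h2 := is_derive_xlnx1m q1.
have h3 := is_derive_power_sum (fun i => r i) beta q.
have -> : L = (fun s => \sum_i beta i * s ^+ r i - 2^-1 * xlnx s - 2^-1 * xlnx (1 - s)) by [].
apply: is_derive_eq; rewrite /L1 /GRing.scale /=; ring.
Qed.

Lemma is_derive_L1 (q : R) : 0 < q < 1 -> is_derive q 1 L1 (L2 q).
Proof.
move=> /andP[q0 q1]; have h1 := is_derive1_ln q0; have h2 := is_derive_ln1m q1.
have h3 := is_derive_power_sum (fun i => (r i).-1) (fun i => beta i * (r i)%:R) q.
have -> : L1 = (fun s => \sum_i beta i * (r i)%:R * s ^+ (r i).-1 - 2^-1 * (ln s - ln (1 - s))).
  by apply/funext => s; rewrite /L1; congr (_ - _); apply: eq_bigr => i _; rewrite mulrA.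
apply: is_derive_eq; rewrite /L2 /GRing.scale /=; congr (_ - _); last by ring.
by apply: eq_bigr => i _; rewrite !mulrA.
Qed.

Lemma stationary : L1 p = 0.
Proof.
have D1 (x : R) : x \in `]0, 1[%R -> derivable L x 1.
  by rewrite in_itv /= => /is_derive_L [].
have pI : p \in `]0, 1[%R by rewrite in_itv /= p0 p1.
have pM (x : R) : x \in `]0, 1[%R -> L x <= L p.
  by rewrite in_itv /= => /andP[? ?]; apply: L_max; rewrite !ltW.
have [_ <-] := derive1_at_max ler01 D1 pI pM.
by apply/esym; have [|_ ->] := @is_derive_L p; rewrite ?p0 ?p1.
Qed.

Lemma curvature : L2 p < 0.
Proof.
case: pU => _ _; suff -> : derive1 (derive1 L) p = L2 p by [].
have h : \forall q \near p, L1 q = derive1 L q.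
  near=> q; rewrite derive1E; apply/esym; have q01 : 0 < q < 1.
    by near: q; have := @near_in_itvoo R 0 1 p; rewrite in_itv /= p0 p1 => /(_ isT);
       apply: filterS => q; rewrite in_itv.
  by have [_ <-] := is_derive_L q01.
have [_ <-] := near_eq_is_derive h (is_derive_L1 (introT andP (conj p0 p1))).
by rewrite derive1E.
Unshelve. all: by end_near.
Qed.

Definition kappa : R := \sum_i beta i * ((r i)%:R * ((r i).-1%:R * p ^+ (r i).-2)).

(** The condition L'' < 0 solved for the energy part, as [1 / p + 1 / (1 - p) = 1 / (p (1 - p))]. *)
Lemma kappa_lt : kappa < (2 * (p * (1 - p)))^-1.
Proof.
have := curvature; rewrite /L2 -/kappa subr_lt0 => /lt_le_trans; apply.
have p1' : 0 < 1 - p by rewrite subr_gt0.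
by rewrite le_eqVlt; apply/orP; left; apply/eqP; field; rewrite !gt_eqF.
Qed.

(** Global maximality of [p] with the linear terms removed by stationarity: the energy turns into
    Bregman gaps, the entropy into the divergence. *)
Lemma bregman_le_kl z : 0 <= p + z <= 1 ->
  \sum_i beta i * bregman (r i) p (p + z) <= 2^-1 * kl p z.
Proof.
move=> q01; have := L_max q01; rewrite !LbetaE.
have st := stationary; rewrite /L1 in st.
have -> : \sum_i beta i * bregman (r i) p (p + z) =
   \sum_i beta i * (p + z) ^+ r i - \sum_i beta i * p ^+ r i
   - (\sum_i beta i * ((r i)%:R * p ^+ (r i).-1)) * z.
  rewrite mulr_suml -!sumrB; apply: eq_bigr => i _; rewrite /bregman; move: (r i) => k; ring.
move/subr0_eq: st => ->; rewrite /kl /xlnx.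
set A := \sum_i beta i * (p + z) ^+ _; set C := \sum_i _.
move: (ln p) (ln (1 - p)) (ln (p + z)) (ln (1 - (p + z))) => l l' u u'.
lra.
Qed.

End Optimum.

Section GraphPairs.
Variables (R : realType) (V W : finType).
Hypothesis W0 : (0 < #|W|)%N.
Variables (g : nat -> V * V) (r : nat).
Hypothesis gs : simple_edges g r.
Variable p : R.
Hypothesis p01 : 0 < p < 1.
Variables (X A m : W -> W -> R) (eps : R).
Hypothesis XE : forall u w, X u w = A u w + m u w.
Hypotheses (Asym : forall u w, A u w = A w u) (msym : forall u w, m u w = m w u).
Hypotheses (Xb : forall u w, `|X u w| <= 2) (Ab : forall u w, `|A u w| <= 2).
Hypothesis mb : forall u w, `|m u w| <= 1.
Hypotheses (Xpb : forall u w, `|X u w - p| <= 2) (Apb : forall u w, `|A u w - p| <= 2).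

Definition pair_sum : R := \sum_(l < r) \sum_(k < l) pair_average g r X A m k l.

(** Crude bound for configurations whose innovations are not small; these are paid for by
    [four_cycle_moment]. *)
Lemma pair_sum_trivial : `|pair_sum| <= r%:R ^+ 2 * 2 ^+ r.
Proof.
apply: (le_trans (ler_norm_sum _ _ _)).
apply: (@le_trans _ _ (\sum_(l < r) r%:R * 2 ^+ r)); last first.
  by rewrite sumr_const card_ord -[leLHS]mulr_natl mulrA expr2.
apply: ler_sum => l _; apply: (le_trans (ler_norm_sum _ _ _)).
apply: (@le_trans _ _ (\sum_(k < l) 2 ^+ r)); last first.
  by rewrite sumr_const card_ord -[leLHS]mulr_natl ler_wpM2r ?exprn_ge0 // ler_nat ltnW.
apply: ler_sum => k _; apply: av_norm_le => [|s]; first exact: ffun_card_gt0.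
rewrite normr_prod -[r in leRHS]card_ord -prodr_const; apply: ler_prod => j _.
rewrite normr_ge0 /= /ev /pair_weight; case: ifP => _; last by case: ifP.
by apply: (le_trans (mb _ _)); lra.
Qed.

Lemma pair_sum_small : (r <= 1)%N -> pair_sum = 0.
Proof.
move=> r1; rewrite /pair_sum big1 // => l _; rewrite big1 // => k _.
have kl := ltn_ord k; have l0 := leq_trans (ltn_ord l) r1.
by exfalso; move: (leq_trans kl l0).
Qed.

Hypotheses (eps0 : 0 <= eps)
  (Xs : bilinear_small eps (fun u w => X u w - p))
  (As : bilinear_small eps (fun u w => A u w - p)).

Lemma pair_sum_bound :
  pair_sum <= av (fun b => star_sum g r p (row m b))
    + (disjoint_pairs g r)%:R * p ^+ (r - 2) * av (row m) ^+ 2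
    + r%:R ^+ 3 * 4 ^+ r * (eps * energy m)
    + r%:R ^+ 3 * 2 ^+ r * av (fun b => `|noise p A b| * `|row m b|).
Proof.
have p01' : 0 <= p <= 1 by have /andP[? ?] := p01; rewrite !ltW.
pose e1 := r%:R * (eps * 4 ^+ r * energy m).
pose e2 := r%:R * (2 ^+ r * av (fun b => `|noise p A b| * `|row m b|)).
have en0 : 0 <= energy m.
  by apply: av_ge0 => // u; apply: av_ge0 => // w; exact: sqr_ge0.
have e10 : 0 <= e1 by rewrite /e1 !mulr_ge0 ?exprn_ge0.
have e20 : 0 <= e2.
  by rewrite /e2 !mulr_ge0 ?exprn_ge0 //; apply: av_ge0 => // b; rewrite mulr_ge0.
pose F (l : 'I_r) (k : 'I_l) := av (fun b => \sum_c star_term g r p k l c (row m b))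
    + (~~ shares g k l)%:R * (p ^+ (r - 2) * av (row m) ^+ 2).
have step (l : 'I_r) (k : 'I_l) : pair_average g r X A m k l <= F l k + (e1 + e2).
  have kl := ltn_ord k; have lr := ltn_ord l.
  apply: (le_trans (pair_average_bound W0 gs p01' XE Asym msym Xb Ab mb Xpb Apb eps0 Xs As kl lr)).
  rewrite -/e1 -/e2 -addrA lerD2r /F; case: ifPn => [_|nsh]; first by rewrite mul0r addr0.
  have -> : av (fun b => \sum_c star_term g r p k l c (row m b)) = 0.
    rewrite (eq_av (G := fun=> 0)) ?av_cst // => b.
    by rewrite star_term_disjoint // (ltn_trans kl).
  by rewrite mul1r add0r.
apply: (@le_trans _ _ (\sum_(l < r) \sum_(k < l) (F l k + (e1 + e2)))).
  by apply: ler_sum => l _; apply: ler_sum => k _; apply: step.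
under eq_bigr do rewrite big_split /=.
rewrite big_split /= -!addrA addrA; apply: lerD; last first.
  apply: (@le_trans _ _ (\sum_(l < r) r%:R * (e1 + e2))).
    apply: ler_sum => l _; rewrite sumr_const card_ord -[leLHS]mulr_natl.
    by rewrite ler_wpM2r ?addr_ge0 // ler_nat ltnW.
  rewrite sumr_const card_ord -[leLHS]mulr_natl /e1 /e2 le_eqVlt; apply/orP; left; apply/eqP; ring.
rewrite /F; under eq_bigr do rewrite big_split /=.
rewrite big_split /= /star_sum /disjoint_pairs natr_sum -mulrA mulr_suml; apply: lerD.
  rewrite {1}/av {1}/Ex -/(Ex _ _).
  have -> : \sum_(l < r) \sum_(k < l) av (fun b => \sum_c star_term g r p k l c (row m b)) =
     av (fun b => \sum_(l < r) \sum_(k < l) \sum_c star_term g r p k l c (row m b)).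
    by rewrite [RHS]Ex_sum; apply: eq_bigr => l _; rewrite Ex_sum.
  by [].
by apply: ler_sum => l _; rewrite natr_sum mulr_suml.
Qed.

End GraphPairs.

Section Constants.
Variables (R : realType) (K : nat) (V : 'I_K.+1 -> finType)
  (g : forall i, nat -> V i * V i) (r : 'I_K.+1 -> nat) (beta : 'I_K.+1 -> R) (p : R).
Hypothesis gs : forall i, simple_edges (@g i) (r i).
Hypothesis r0 : r ord0 = 1%N.
Hypothesis beta0 : forall i, i != ord0 -> 0 <= beta i.
Hypothesis p01 : 0 < p < 1.

Definition kappa_of : R := \sum_i beta i * ((r i)%:R * ((r i).-1%:R * p ^+ (r i).-2)).
Definition star_energy (t : R) : R := \sum_i beta i * star_sum (@g i) (r i) p t.
Definition disjoint_energy : R :=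
  \sum_i beta i * ((disjoint_pairs (@g i) (r i))%:R * p ^+ (r i - 2)).

Hypothesis kap : kappa_of < (2 * (p * (1 - p)))^-1.
Hypothesis breg : forall z, 0 <= p + z <= 1 ->
  \sum_i beta i * bregman (r i) p (p + z) <= 2^-1 * kl p z.

Let pp0 : 0 < p. Proof. by case/andP: p01. Qed.
Let pp1 : p < 1. Proof. by case/andP: p01. Qed.

(* The single edge G_0, whose coefficient has no sign, contributes nothing of second order. *)
Lemma case_beta (i : 'I_K.+1) : 0 <= beta i \/ r i = 1%N.
Proof. by have [->|/beta0] := eqVneq i ord0; [right|left]. Qed.

Lemma kappa_ge0 : 0 <= kappa_of.
Proof.
apply: sumr_ge0 => i _; case: (case_beta i) => [b|->]; last by rewrite /= mul0r !mulr0.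
by rewrite !mulr_ge0 // exprn_ge0 // ltW.
Qed.

Lemma disjoint_energy_ge0 : 0 <= disjoint_energy.
Proof.
apply: sumr_ge0 => i _; case: (case_beta i) => [b|ri].
  by rewrite !mulr_ge0 // exprn_ge0 // ltW.
have := pair_count (@g i) (r i); rewrite ri /= => /eqP; rewrite addn_eq0 => /andP[_ /eqP ->].
by rewrite mul0r mulr0.
Qed.

Lemma star_energy_tangent y : 0 <= p + y ->
  exists a, forall z, 0 <= p + z -> star_energy y + a * (z - y) <= star_energy z.
Proof.
move=> y0.
have h i : {a | forall z, 0 <= p + z ->
    beta i * star_sum (@g i) (r i) p y + a * (z - y) <= beta i * star_sum (@g i) (r i) p z}.
  apply: cid; case: (case_beta i) => [b|ri].
    have [a ha] := star_sum_tangent (@g i) (r i) p01 y0; exists (beta i * a) => z z0.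
    by rewrite -mulrA -mulrDr ler_wpM2l //; apply: ha.
  by exists 0 => z _; rewrite !star_sum_small ?ri // mul0r addr0.
exists (\sum_i sval (h i)) => z z0.
rewrite /star_energy mulr_suml -big_split /=; apply: ler_sum => i _.
exact: (svalP (h i)).
Qed.

(** [B] exceeds every [r i - 1], so [star_sum_global] bounds the star energy by [2 - 1 / B] times
    the Bregman sum, hence by [(1 - 1 / (2 B)) kl]. Pinsker's inequality turns the remaining
    [kl / (2 B)] into [z^2 / B]. *)
Lemma star_energy_lt_kl : exists2 rho, 0 < rho &
  forall z, 0 <= p + z <= 1 -> star_energy z + rho * z ^+ 2 <= kl p z.
Proof.
pose B : R := (\sum_i r i)%N%:R + 1.
have B0 : 0 < B by rewrite ltr_wpDl.
exists B^-1; first by rewrite invr_gt0.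
move=> z q01; have /andP[q0 q1] := q01.
have star_le : star_energy z <= (2 - B^-1) * \sum_i beta i * bregman (r i) p (p + z).
  rewrite /star_energy mulr_sumr; apply: ler_sum => i _.
  have [ri|ri] := leqP (r i) 1.
    rewrite star_sum_small // mulr0; case: (case_beta i) => [b|rE].
      rewrite !mulr_ge0 //; last by apply: bregman_ge0; rewrite // ltW.
      by rewrite subr_ge0 -[X in _ <= X]invrK lef_pV2 ?posrE ?invr_gt0 // /B; have : 0 <= (\sum_i r i)%N%:R :> R by []; lra.
    by rewrite rE /bregman !expr1 expr0; rewrite le_eqVlt; apply/orP; left; apply/eqP; ring.
  case: (case_beta i) => [b|rE]; last by rewrite rE in ri.
  rewrite mulrCA ler_wpM2l //.
  have := star_sum_global (gs i) p01 ri q0.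
  have bg : 0 <= bregman (r i) p (p + z) by apply: bregman_ge0; rewrite // ltW.
  have rB : (r i).-1%:R <= B.
    rewrite /B natr1 ler_nat; apply: leq_trans (leq_pred _) _; apply: leqW.
    by rewrite (bigD1 i) //= leq_addr.
  have r1 : 0 < (r i).-1%:R :> R by rewrite ltr0n -subn1 subn_gt0.
  have -> : (2 * r i - 3)%N%:R = 2 * (r i).-1%:R - 1 :> R.
    move: ri; move: (r i) => k; clear => k1.
    have -> : (2 * k - 3 = 2 * k.-1 - 1)%N by lia.
    by rewrite natrB ?natrM //; lia.
  move: (star_sum _ _ _ _) (bregman _ _ _) bg => s b' b'0.
  move: ((r i).-1%:R : R) r1 rB => a a0 aB h.
  have iB : B^-1 <= a^-1 by rewrite lef_pV2 ?posrE.
  have h2 : s <= (2 - a^-1) * b'.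
    by rewrite -(ler_pM2l a0) (le_trans h) // mulrA mulrBr divff ?gt_eqF // [a * 2]mulrC.
  by apply: (le_trans h2); rewrite ler_wpM2r //; lra.
have iB1 : B^-1 <= 1.
  by rewrite invf_le1 // /B lerDr.
have kl2 := pinsker p01 q01.
have h := breg q01.
have : (2 - B^-1) * \sum_i beta i * bregman (r i) p (p + z) <= (2 - B^-1) * (2^-1 * kl p z).
  by rewrite ler_wpM2l //; lra.
have iB0 : 0 < B^-1 by rewrite invr_gt0.
have : B^-1 * (2 * z ^+ 2) <= B^-1 * kl p z by rewrite ler_wpM2l // ltW.
lra.
Qed.

Let slack : R := \sum_i `|beta i| * ('C(r i, 2)%:R * ((r i)%:R * 2 ^+ r i)).

(** At second order a pair of edges contributes [p^(r-2) y^2] whether it is shared or disjoint, and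
    all C(r,2) of them together make [kappa_of / 2]; [slack] bounds the growth of [(p + |y|)^(r-2)]
    in [|y|]. *)
Lemma star_energy_local y : `|y| <= 1 ->
  star_energy y + disjoint_energy * y ^+ 2 <= (kappa_of / 2 + `|y| * slack) * y ^+ 2.
Proof.
move=> y1; rewrite /star_energy /disjoint_energy /kappa_of /slack.
rewrite mulr_suml mulr_suml mulr_sumr -!big_split /= mulr_suml; apply: ler_sum => i _.
have y0 := normr_ge0 y.
have pc := pair_count (@g i) (r i).
case: (case_beta i) => [b|ri]; last first.
  rewrite ri /= in pc *; move/eqP: pc; rewrite addn_eq0 => /andP[_ /eqP ->].
  rewrite star_sum_small ?ri // ?(mul0r, mulr0, addr0, add0r).
  by rewrite ?lexx ?mulr_ge0 ?sqr_ge0.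
rewrite (ger0_norm b).
have loc := star_sum_local (gs i) p01 y.
have pw : (p + `|y|) ^+ (r i - 2) <= p ^+ (r i - 2) + `|y| * ((r i)%:R * 2 ^+ r i).
  have py : 0 <= p + `|y| by rewrite addr_ge0 // ltW.
  have := pow_tangent (r i - 2) py (ltW pp0).
  have -> : p - (p + `|y|) = - `|y| by ring.
  have : (r i - 2)%:R * (p + `|y|) ^+ (r i - 2).-1 <= (r i)%:R * 2 ^+ r i.
    rewrite ler_pM ?exprn_ge0 // ?ler_nat ?leq_subr //.
    apply: (@le_trans _ _ (2 ^+ (r i - 2).-1)).
      by have := pp1; move=> p1; apply: lerXn2r; rewrite ?nnegrE //; lra.
    by rewrite ler_weXn2l ?ler1n //; lia.
  move: (_ * (p + _) ^+ _) (_ * 2 ^+ _) => a c ac h.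
  have := ler_wpM2l y0 ac; lra.
have C2 : 'C(r i, 2)%:R * 2 = (r i)%:R * (r i).-1%:R :> R.
  by rewrite -!natrM; have := bin_ffact (r i) 2; rewrite ffactnS ffactn1 => <-.
rewrite subn2 in loc pw *.
have sq := sqr_ge0 y.
have -> : beta i * ((r i)%:R * ((r i).-1%:R * p ^+ (r i).-2)) / 2 =
    beta i * ('C(r i, 2)%:R * p ^+ (r i).-2).
  by rewrite [in LHS](mulrA (r i)%:R) -C2; field.
rewrite -pc natrD; set c := (r i)%:R * 2 ^+ r i in pw *.
have c0 : 0 <= c by rewrite /c mulr_ge0 ?exprn_ge0.
have sh0 : 0 <= (shared_pairs (@g i) (r i))%:R :> R by [].
have dj0 : 0 <= (disjoint_pairs (@g i) (r i))%:R :> R by [].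
move: (star_sum _ _ _ _) (shared_pairs _ _)%:R (disjoint_pairs _ _)%:R ((p + `|y|) ^+ _) (p ^+ _)
  loc pw sh0 dj0 => s sh dj Q P loc pw sh0 dj0.
have -> : (beta i * ((sh + dj) * P) + `|y| * (beta i * ((sh + dj) * c))) * y ^+ 2 =
  beta i * ((sh + dj) * (P + `|y| * c) * y ^+ 2) by ring.
have -> : beta i * s + beta i * (dj * P) * y ^+ 2 = beta i * (s + dj * P * y ^+ 2) by ring.
rewrite ler_wpM2l //.
have h1 : sh * Q * y ^+ 2 <= sh * (P + `|y| * c) * y ^+ 2 by rewrite ler_wpM2r // ler_wpM2l.
have h2 : dj * P * y ^+ 2 <= dj * (P + `|y| * c) * y ^+ 2.
  by rewrite ler_wpM2r // ler_wpM2l // lerDl mulr_ge0.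
lra.
Qed.

(* The constants needed by divergence_dominates, for the divergence kl diminished by a multiple of z^2. *)
Lemma convexity_constants : exists c tau d e' : R,
  [/\ 0 < c, 0 <= tau, 0 < d <= 2^-1 & 0 < e'] /\
  [/\ forall z, 0 <= p + z <= 1 -> star_energy z + c * z ^+ 2 <= kl p z - 2 * d * z ^+ 2,
      forall y z : R, `|y| <= e' -> 0 <= p + z <= 1 ->
        tau * (2 * y * z - y ^+ 2) <= kl p z - 2 * d * z ^+ 2 &
      forall y, 0 <= p + y <= 1 -> `|y| <= e' ->
        star_energy y + disjoint_energy * y ^+ 2 <= (tau / 2 - c) * y ^+ 2].
Proof.
pose Lam : R := (2 * (p * (1 - p)))^-1; pose gam := Lam - kappa_of.
have gam0 : 0 < gam by rewrite subr_gt0.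
have k0 := kappa_ge0.
have [rho0 rho00 GI] := star_energy_lt_kl.
have slack0 : 0 <= slack by apply: sumr_ge0 => i _; rewrite !mulr_ge0 ?exprn_ge0.
have [rho rhop kll] : exists2 rho : R, 0 < rho & forall z, 0 <= p + z <= 1 -> `|z| <= rho ->
    (kappa_of + gam / 2) * z ^+ 2 <= kl p z.
  by apply: kl_local => //; rewrite -/Lam; move: gam0; rewrite /gam; lra.
(* [gam] is the curvature gap. [d] sets aside divergence for later errors: as [d <= 1/2], Pinsker
   still leaves [z^2] after [2 d z^2] is removed, and [tau] is lowered by the same [2 d]. *)
pose d := Num.min (rho0 / 4) (Num.min 2^-1 (gam / 16)).
pose c := Num.min (rho0 / 2) (gam / 16).
pose tau := kappa_of + gam / 2 - 2 * d.
have d0 : 0 < d by rewrite !lt_min; apply/and3P; split; lra.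
have d1 : d <= rho0 / 4 by rewrite ge_min lexx.
have d2 : d <= 2^-1 by rewrite !ge_min lexx !orbT.
have d3 : d <= gam / 16 by rewrite !ge_min lexx !orbT.
have c0 : 0 < c by rewrite lt_min; apply/andP; split; lra.
have c1 : c <= rho0 / 2 by rewrite ge_min lexx.
have c2 : c <= gam / 16 by rewrite ge_min lexx orbT.
have tau0 : 0 <= tau by rewrite /tau; lra.
(* The first entry keeps the error of [star_energy_local] below [gam / 8]. The second keeps the
   tangent parabola below [z^2] for [|z| > rho]. *)
pose e' := Num.min (gam / 8 / (slack + 1)) (Num.min (rho / 2 / (tau + 1)) 1).
have e'0 : 0 < e'.
  by rewrite !lt_min ltr01 andbT !divr_gt0 //; lra.
have e1 : e' * slack <= gam / 8.
  have : e' <= gam / 8 / (slack + 1) by rewrite ge_min lexx.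
  by rewrite ler_pdivlMr; [|lra]; lra.
have e2 : 2 * tau * e' <= rho.
  have : e' <= rho / 2 / (tau + 1) by rewrite !ge_min lexx !orbT.
  by rewrite ler_pdivlMr; [|lra]; lra.
have e3 : e' <= 1 by rewrite !ge_min lexx !orbT.
exists c, tau, d, e'; split; first by split => //; rewrite d0.
split=> [z q01|y z ye q01|y q01 ye].
- have := GI z q01; have := sqr_ge0 z; move: (star_energy z) (kl p z) (z ^+ 2) => s k z2 z20.
  have : (c + 2 * d) * z2 <= rho0 * z2 by rewrite ler_wpM2r //; lra.
  lra.
- have [zr|zr] := leP `|z| rho.
    have := kll z q01 zr; have : 0 <= tau * (z - y) ^+ 2 by rewrite mulr_ge0 ?sqr_ge0.
    by rewrite /tau; move: (kl p z) => k; lra.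
  have pk := pinsker p01 q01.
  have : tau * (2 * y * z - y ^+ 2) <= z ^+ 2.
    have h1 : tau * (2 * (y * z)) <= 2 * tau * e' * `|z|.
      have : y * z <= e' * `|z|.
        by apply: (le_trans (ler_norm _)); rewrite normrM ler_wpM2r.
      by move=> h; have := ler_wpM2l tau0 h; lra.
    have h2 : 2 * tau * e' * `|z| <= rho * `|z| by rewrite ler_wpM2r.
    have h3 : rho * `|z| <= `|z| * `|z| by rewrite ler_wpM2r // ltW.
    have h4 : `|z| * `|z| = z ^+ 2 by rewrite -expr2 real_normK ?num_real.
    have h5 : 0 <= tau * y ^+ 2 by rewrite mulr_ge0 ?sqr_ge0.
    lra.
  have : 2 * d * z ^+ 2 <= 1 * z ^+ 2 by rewrite ler_wpM2r ?sqr_ge0 //; lra.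
  move: (kl p z) (z ^+ 2) pk => k z2 pk; lra.
- apply: le_trans (star_energy_local _) _; first exact: le_trans e3.
  rewrite ler_wpM2r ?sqr_ge0 //.
  have : `|y| * slack <= e' * slack by rewrite ler_wpM2r.
  by rewrite /tau; lra.
Qed.

End Constants.

(** * The degree variance *)

Section DegreeVariance.
Variables (R : realType) (K : nat) (V : 'I_K.+1 -> finType)
  (g : forall i, nat -> V i * V i) (r : 'I_K.+1 -> nat) (beta : 'I_K.+1 -> R) (p : R).
Hypothesis gs : forall i, simple_edges (@g i) (r i).
Hypothesis r0 : r ord0 = 1%N.
Hypothesis beta0 : forall i, i != ord0 -> 0 <= beta i.
Hypothesis p01 : 0 < p < 1.
Hypothesis kap : kappa_of r beta p < (2 * (p * (1 - p)))^-1.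
Hypothesis breg : forall z, 0 <= p + z <= 1 ->
  \sum_i beta i * bregman (r i) p (p + z) <= 2^-1 * kl p z.
Hypothesis stat : \sum_i beta i * ((r i)%:R * p ^+ (r i).-1) - 2^-1 * (ln p - ln (1 - p)) = 0.

Definition graph_pair_sum n theta (x : {set {set 'I_n}}) (i : 'I_K.+1) : R :=
  pair_sum (@g i) (r i) (adj R x) (base theta p x) (drift theta p x).

Definition mean_kl n (theta : {set 'I_n} -> {set {set 'I_n}} -> R) x : R :=
  av (fun u => av (fun w => kl p (drift theta p x u w))).

(** Holds for each configuration separately, so on the right only the two innovation terms need a
    moment bound. If the innovations have a large four-cycle density, trivial bounds suffice;
    otherwise [adj - p] and [base - p] both have small operator norm and [divergence_dominates]
    applies. The product of noise and row means is split by AM-GM, which turns [c / 2] into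
    [c / 4]. *)
Lemma pointwise_bound : exists eps c d C : R,
  [/\ 0 < eps, 0 < c, 0 < d & 0 <= C] /\
  forall n theta (x : {set {set 'I_n}}), (0 < n)%N -> (forall e y, 0 <= theta e y <= 1) ->
    x \in Omega n -> four_cycle (fun u w => adj R x u w - p) <= eps ^+ 4 ->
    c * av (fun b => row (drift theta p x) b ^+ 2) + \sum_i beta i * graph_pair_sum theta x i
      + d * energy (drift theta p x)
    <= 2^-1 * mean_kl theta x + C * av (fun b => noise p (base theta p x) b ^+ 2)
      + C * four_cycle (innov theta p x).
Proof.
have [c [tau [d [e' [[c0 tau0 /andP[d0 d2] e'0] [hc1 hc2 hc3]]]]]] :=
  convexity_constants gs r0 beta0 p01 kap breg.
have /andP[p0 p1] := p01.
have d21 : 2 * d <= 1 by lra.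
have d20 : 0 <= 2 * d by lra.
pose B := - ln p - ln (1 - p).
pose kd := disjoint_energy g r beta p.
have kd0 : 0 <= kd := disjoint_energy_ge0 g r0 beta0 p01.
have B0 : 0 <= B.
  have l1 : ln (1 - p) <= 0 by apply: ln_le0; lra.
  by have := ln_le0 (ltW p1); rewrite /B; lra.
pose C2 := \sum_i `|beta i| * ((r i)%:R ^+ 3 * 4 ^+ r i).
pose C3 := \sum_i `|beta i| * ((r i)%:R ^+ 3 * 2 ^+ r i).
pose C4 := \sum_i `|beta i| * ((r i)%:R ^+ 2 * 2 ^+ r i).
have C20 : 0 <= C2 by apply: sumr_ge0 => i _; rewrite !mulr_ge0 ?exprn_ge0.
have C30 : 0 <= C3 by apply: sumr_ge0 => i _; rewrite !mulr_ge0 ?exprn_ge0.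
have C40 : 0 <= C4 by apply: sumr_ge0 => i _; rewrite !mulr_ge0 ?exprn_ge0.
pose Q := 2^-1 * B / e' + tau + 2 * kd.
have Q0 : 0 <= Q by rewrite /Q !addr_ge0 ?mulr_ge0 ?invr_ge0 // ltW.
(* First entry: the pair errors [C2 eps] use at most half of the spare energy [d]. Second entry: the
   smallness hypothesis of [divergence_dominates], at [2 eps] since the drift is a difference of two
   kernels whose row means have size [eps]. *)
pose eps := Num.min (d / 2 / (C2 + 1)) (c / 2 * e' ^+ 2 / 2 / (Q + 1)).
have eps0 : 0 < eps.
  by rewrite lt_min !divr_gt0 ?mulr_gt0 ?exprn_gt0 //; lra.
have epsC : C2 * eps <= d / 2.
  have : eps <= d / 2 / (C2 + 1) by rewrite ge_min lexx.
  by rewrite ler_pdivlMr; [|lra]; lra.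
have epsQ : Q * (2 * eps) <= c / 2 * e' ^+ 2.
  have : eps <= c / 2 * e' ^+ 2 / 2 / (Q + 1) by rewrite ge_min lexx orbT.
  by rewrite ler_pdivlMr; [|lra]; move: (c / 2 * e' ^+ 2) => ce; lra.
(* Trivial bound for the left-hand side, used when the four-cycle density of the innovations exceeds
   [eps ^+ 4]. *)
pose C5 := c / 4 + C4 + d / 2.
have C50 : 0 <= C5 by rewrite /C5; lra.
pose C := C3 ^+ 2 / c + C5 / eps ^+ 4.
have Ca : 0 <= C3 ^+ 2 / c by rewrite divr_ge0 ?exprn_ge0 // ltW.
have Cb : 0 <= C5 / eps ^+ 4 by rewrite divr_ge0 ?exprn_ge0 // ltW.
exists eps, (c / 4), (d / 2), C; split; first by split => //; rewrite ?divr_gt0 ?addr_ge0.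
move=> n theta x n0 th01 xO Xs4.
have W0 : (0 < #|'I_n|)%N by rewrite card_ord.
set m := drift theta p x; set A := base theta p x; set X := adj R x.
have mI u w : - p <= m u w <= 1 - p := drift_range th01 p01 x u w.
have m1 u w : `|m u w| <= 1.
  by have /andP[h1 h2] := mI u w; rewrite ler_norml; clear -h1 h2 p0 p1 gs r0 beta0 p01 kap breg stat; apply/andP; split; lra.
have qI u w : 0 <= p + m u w <= 1.
  by have /andP[h1 h2] := mI u w; clear -h1 h2 gs r0 beta0 p01 kap breg stat; apply/andP; split; lra.
have XE u w : X u w = A u w + m u w by rewrite /A /base /m subrK.
have Xb u w : `|X u w| <= 2.
  have := adj01 R x u w; rewrite ler_norml /X; move: (adj _ _ _ _) => k; clear -gs r0 beta0 p01 kap breg stat => /andP[? ?].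
  by apply/andP; split; lra.
have Xpb u w : `|X u w - p| <= 2.
  have := adj01 R x u w; rewrite ler_norml /X; move: (adj _ _ _ _) => k; clear -p0 p1 gs r0 beta0 p01 kap breg stat => /andP[? ?].
  by apply/andP; split; lra.
have Ab u w : `|A u w| <= 2 := base_le2 th01 p01 x u w.
have Apb u w : `|A u w - p| <= 2 := innov_le2 th01 p01 x u w.
have msym u w : m u w = m w u := drift_sym theta p x u w.
have Asym u w : A u w = A w u := base_sym theta p x u w.
have ypos (F : 'I_n -> R) : 0 <= av (fun b => F b ^+ 2).
  by apply: av_ge0 => // b; exact: sqr_ge0.
have en0 : 0 <= energy m.
  by apply: av_ge0 => // u; apply: av_ge0 => // w; exact: sqr_ge0.
have sq1 (t : R) : `|t| <= 1 -> t ^+ 2 <= 1.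
  by move=> t1; rewrite -real_normK ?num_real // exprn_ile1.
have en1 : energy m <= 1.
  rewrite -[leRHS](@av_cst R 'I_n) //; apply: ler_av => // u.
  rewrite -[leRHS](@av_cst R 'I_n) //; apply: ler_av => // w; exact: sq1.
have row1 : av (fun b => row m b ^+ 2) <= 1.
  rewrite -[leRHS](@av_cst R 'I_n) //; apply: ler_av => // u; apply: sq1.
  by apply: av_norm_le.
have klpos : 0 <= mean_kl theta x.
  apply: av_ge0 => // u; apply: av_ge0 => // w.
  by apply: le_trans (pinsker p01 (qI u w)); rewrite mulr_ge0 ?sqr_ge0.
have fc0 : 0 <= four_cycle (innov theta p x).
  by apply: av_ge0 => // u; apply: av_ge0 => // w; exact: sqr_ge0.
have [good|bad] := leP (four_cycle (innov theta p x)) (eps ^+ 4); last first.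
  have ps : \sum_i beta i * graph_pair_sum theta x i <= C4.
    apply: ler_sum => i _; apply: (le_trans (ler_norm _)); rewrite normrM ler_wpM2l //.
    exact: pair_sum_trivial.
  have big : C5 <= C5 / eps ^+ 4 * four_cycle (innov theta p x).
    by rewrite -mulrA ler_peMr // mulrC ler_pdivlMr ?exprn_gt0 // mul1r ltW.
  have t1 : c / 4 * av (fun b => row m b ^+ 2) <= c / 4 by rewrite ler_piMr //; clear -c0 gs r0 beta0 p01 kap breg stat; lra.
  have t2 : d / 2 * energy m <= d / 2 by rewrite ler_piMr //; clear -d0 gs r0 beta0 p01 kap breg stat; lra.
  have t3 : 0 <= C * av (fun b => noise p A b ^+ 2) by rewrite mulr_ge0 ?addr_ge0.
  have t4 : C5 / eps ^+ 4 * four_cycle (innov theta p x) <= C * four_cycle (innov theta p x).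
    by rewrite ler_wpM2r // /C lerDr.
  move: t1 t2 t3 t4 ps big klpos; rewrite /C5.
  move: (c / 4 * _) (d / 2 * _) (C * av _) (C * four_cycle _) (_ * four_cycle _) (\sum_i _) (mean_kl _ _).
  by move=> a1 a2 a3 a4 a5 a6 a7; clear -gs r0 beta0 p01 kap breg stat; lra.
have Xs : bilinear_small eps (fun u w => X u w - p).
  by apply: (bilinear_of_four_cycle n0 (ltW eps0)) => // u w; rewrite /X adj_sym.
have As : bilinear_small eps (fun u w => A u w - p).
  by apply: (bilinear_of_four_cycle n0 (ltW eps0)) => // u w; rewrite Asym.
have rowe : av (fun b => `|av (m b)|) <= 2 * eps.
  have h1 := small_row_means n0 (ltW eps0) Xs.
  have h2 := small_row_means n0 (ltW eps0) As.
  apply: (@le_trans _ _ (av (fun b => `|av (fun w => X b w - p)|) + av (fun b => `|av (fun w => A b w - p)|))).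
    rewrite -avD; apply: ler_av => // b.
    have -> : av (m b) = av (fun w => X b w - p) - av (fun w => A b w - p).
      by rewrite -avB; apply: eq_av => w; rewrite XE; ring.
    exact: ler_normB.
  by lra.
have rowI u : 0 <= p + av (m u) <= 1.
  have -> : p + av (m u) = av (fun w => p + m u w) by rewrite avD av_cst.
  apply/andP; split; first by apply: av_ge0 => // w; case/andP: (qI u w).
  by rewrite -[leRHS](@av_cst R 'I_n) //; apply: ler_av => // w; case/andP: (qI u w).
have I1 z : 0 <= p + z <= 1 -> `|z| <= 1.
  by clear -p0 p1 gs r0 beta0 p01 kap breg stat => /andP[? ?]; rewrite ler_norml; apply/andP; split; lra.
have DB z : 0 <= p + z <= 1 -> 0 <= kl p z - 2 * d * z ^+ 2 <= B.
  move=> q01; have k1 := pinsker p01 q01; have k2 := kl_le p01 q01.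
  have z0 := sqr_ge0 z; have h := mulr_ge0 d20 z0; have h' := ler_wpM2r z0 d21.
  apply/andP; split; last by rewrite lerBlDr; apply: (le_trans k2); rewrite lerDl.
  by rewrite subr_ge0; apply: (le_trans h'); apply: le_trans k1; rewrite ler_wpM2r // ler1n.
have tan z : 0 <= p + z <= 1 -> exists a, forall t, 0 <= p + t <= 1 ->
    star_energy g r beta p z + a * (t - z) <= star_energy g r beta p t.
  move=> /andP[z0 _]; have [a ha] := star_energy_tangent g r0 beta0 p01 z0.
  by exists a => t /andP[t0 _]; apply: ha.
have eps2 : 0 <= 2 * eps by rewrite mulr_ge0 // ltW.
have DL := @divergence_dominates R 'I_n m (fun z => 0 <= p + z <= 1)
   (fun z => kl p z - 2 * d * z ^+ 2) (star_energy g r beta p) c tau kd B e' (2 * eps)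
   W0 msym qI rowI.
have DLf := DL I1 c0 tau0 kd0 e'0 eps2 DB hc1 tan hc2 hc3 epsQ rowe.
have E : av (fun u => av (fun w => kl p (m u w) - 2 * d * m u w ^+ 2)) =
    mean_kl theta x - 2 * d * energy m.
  by rewrite /mean_kl /energy -avZ -avB; apply: eq_av => u; rewrite -avZ -avB.
rewrite E in DLf.
pose nr := av (fun b => `|noise p A b| * `|row m b|).
have nr0 : 0 <= nr by apply: av_ge0 => // b; rewrite mulr_ge0.
have PS : \sum_i beta i * graph_pair_sum theta x i <=
   av (fun b => star_energy g r beta p (row m b)) + kd * av (row m) ^+ 2
   + C2 * (eps * energy m) + C3 * nr.
  have -> : av (fun b => star_energy g r beta p (row m b)) =
     \sum_i beta i * av (fun b => star_sum (@g i) (r i) p (row m b)).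
    by rewrite /star_energy [LHS]Ex_sum; apply: eq_bigr => i _; rewrite ExZ.
  rewrite /kd /disjoint_energy /C2 /C3 !mulr_suml -!big_split /=; apply: ler_sum => i _.
  have e1 : 0 <= eps * energy m by rewrite mulr_ge0 // ltW.
  case: (case_beta r0 beta0 i) => [b|ri].
    rewrite (ger0_norm b) -!mulrA -!mulrDr ler_wpM2l //.
    have := pair_sum_bound W0 (gs i) p01 XE Asym msym Xb Ab m1 Xpb Apb (ltW eps0) Xs As.
    by rewrite -/nr -!mulrA.
  rewrite /graph_pair_sum pair_sum_small ?ri // mulr0.
  have dj0 : disjoint_pairs (@g i) (r i) = 0%N.
    have := pair_count (@g i) (r i); rewrite [in X in _ = X]ri /= => /eqP.
    by rewrite addn_eq0 => /andP[_ /eqP].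
  have s0 : av (fun b => star_sum (@g i) (r i) p (row m b)) = 0.
    by rewrite (eq_av (G := fun=> 0)) ?av_cst // => b'; rewrite star_sum_small // ri.
  rewrite ri in dj0 s0 *.
  rewrite dj0 s0 !mul0r !mulr0 !mul0r !add0r.
  by apply: addr_ge0; rewrite mulr_ge0 // mulr_ge0 // mulr_ge0 ?exprn_ge0.
have AG : C3 * nr <= c / 4 * av (fun b => row m b ^+ 2) + C3 ^+ 2 / c * av (fun b => noise p A b ^+ 2).
  rewrite /nr -!avZ -avD; apply: ler_av => // b.
  rewrite -[row m b ^+ 2]real_normK ?num_real // -[noise p A b ^+ 2]real_normK ?num_real //.
  move: `|noise p A b| `|row m b| => s t; rewrite -subr_ge0.
  have -> : c / 4 * t ^+ 2 + C3 ^+ 2 / c * s ^+ 2 - C3 * (s * t) = c * (t / 2 - C3 * s / c) ^+ 2.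
    by field; rewrite gt_eqF.
  by rewrite mulr_ge0 ?sqr_ge0 // ltW.
have EC : C2 * (eps * energy m) <= d / 2 * energy m by rewrite mulrA ler_wpM2r.
have NC : C3 ^+ 2 / c * av (fun b => noise p A b ^+ 2) <= C * av (fun b => noise p A b ^+ 2).
  by rewrite ler_wpM2r // /C lerDl.
have FC : 0 <= C * four_cycle (innov theta p x) by rewrite mulr_ge0 ?addr_ge0.
move: DLf PS AG EC NC FC.
move: (av (fun b => star_energy _ _ _ _ _)) (kd * _) (C3 * nr) (C3 ^+ 2 / c * _) (C * av _) (C * _)
  (C2 * _) (\sum_i _) (mean_kl _ _) => a1 a2 a3 a4 a5 a6 a7 a8 a9.
rewrite /row; move: (av (fun b => av (m b) ^+ 2)) (energy m) => b1 b2; clear -gs r0 beta0 p01 kap breg stat; lra.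
Qed.

End DegreeVariance.

Section DensityMean.
Variables (R : realType) (n : nat).
Hypothesis n0 : (0 < n)%N.
Local Notation T := {set 'I_n}.
Variables (mu : {set T} -> R) (theta : T -> {set T} -> R) (p : R).
Hypothesis pm : is_pmf mu.
Hypothesis muO : forall x, mu x != 0 -> x \in Omega n.
Hypothesis th01 : forall e x, 0 <= theta e x <= 1.
Hypothesis unc : uncorrelated mu (fun e x => (e \in x)%:R - theta e x).
Hypothesis p01 : 0 < p < 1.
Variables (V : finType) (g : nat -> V * V) (r : nat).
Hypothesis gs : simple_edges g r.

Lemma density_expand (x : {set T}) :
  density R g r x =
  av (fun s => \prod_(j < r) ev g (base theta p x) j s)
  + \sum_(l < r) av (fun s => \prod_(j < r)
       (if j == l :> nat then ev g (drift theta p x) j s else ev g (base theta p x) j s))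
  + pair_sum g r (adj R x) (base theta p x) (drift theta p x).
Proof.
rewrite /density /pair_sum /pair_average.
rewrite (eq_av (G := fun s => \prod_(j < r) ev g (base theta p x) j s
  + \sum_(l < r) \prod_(j < r)
       (if j == l :> nat then ev g (drift theta p x) j s else ev g (base theta p x) j s)
  + \sum_(l < r) \sum_(k < l) \prod_(j < r) ev g
      (pair_weight k l (fun=> adj R x) (fun=> base theta p x) (fun=> drift theta p x) j) j s)).
  rewrite !avD !av_sum; congr (_ + _); apply: eq_bigr => l _.
  by rewrite av_sum.
move=> s; rewrite (@pair_telescope R (fun j => ev g (adj R x) j s) (fun j => ev g (base theta p x) j s)
   (fun j => ev g (drift theta p x) j s)); last by move=> j; rewrite /ev /base subrK.
congr (_ + _); apply: eq_bigr => l _; apply: eq_bigr => k _; apply: eq_bigr => j _.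
by rewrite /pair_weight; case: ifP => // _; case: ifP.
Qed.

Definition mean_drift (x : {set T}) : R := av (fun u => av (drift theta p x u)).

Definition density_error (delta : R) : R :=
  (2 ^+ r + 1) * (#|V| ^ 2)%N%:R +
  r%:R * ((2 ^+ r + 1) ^+ 2 * (1 + 4 * #|V| + 3 * #|V| ^ 2)%N%:R / (4 * delta)).

(** [pair_sum] is deliberately left unevaluated: it is compared with the divergence pointwise, in
    [pointwise_bound], before any mean is taken. *)
Lemma density_mean (delta : R) : 0 < delta ->
  `|Ex mu (fun x => density R g r x)
    - Ex mu (fun x => pair_sum g r (adj R x) (base theta p x) (drift theta p x))
    - p ^+ r - r%:R * p ^+ r.-1 * Ex mu mean_drift|
  <= r%:R * (delta * Ex mu (fun x => energy (drift theta p x))) + density_error delta * n%:R^-1.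
Proof.
move=> d0.
pose Z := Ex mu (fun x => av (fun s => \prod_(j < r) ev g (base theta p x) j s)).
pose F (l : nat) := Ex mu (fun x => av (fun s => \prod_(j < r)
       (if j == l :> nat then ev g (drift theta p x) j s else ev g (base theta p x) j s))).
pose PS := Ex mu (fun x => pair_sum g r (adj R x) (base theta p x) (drift theta p x)).
have -> : Ex mu (fun x => density R g r x) = Z + \sum_(l < r) F l + PS.
  by rewrite (eq_Ex density_expand) !ExD; congr (_ + _ + _); rewrite Ex_sum.
rewrite -/PS.
have hZ : `|Z - p ^+ r| <= (2 ^+ r + 1) * (#|V| ^ 2)%N%:R * n%:R^-1 :=
  zeroth_order n0 pm muO th01 unc p01 gs.
have -> : Z + \sum_(l < r) F l + PS - PS - p ^+ r - r%:R * p ^+ r.-1 * Ex mu mean_drift =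
  (Z - p ^+ r) + \sum_(l < r) (F l - p ^+ r.-1 * Ex mu mean_drift).
  by rewrite sumrB sumr_const card_ord -[X in _ = _ + (_ - X)]mulr_natl; ring.
apply: (le_trans (ler_normD _ _)).
have hF : `|\sum_(l < r) (F l - p ^+ r.-1 * Ex mu mean_drift)| <=
   r%:R * (delta * Ex mu (fun x => energy (drift theta p x)) +
     (2 ^+ r + 1) ^+ 2 * (1 + 4 * #|V| + 3 * #|V| ^ 2)%N%:R * n%:R^-1 / (4 * delta)).
  apply: (le_trans (ler_norm_sum _ _ _)).
  have cst (a : R) : r%:R * a = \sum_(l < r) a by rewrite sumr_const card_ord mulr_natl.
  rewrite cst; apply: ler_sum => l _.
  exact: (first_order n0 pm muO th01 unc p01 gs (ltn_ord l) d0).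
apply: (le_trans (lerD hZ hF)); rewrite /density_error le_eqVlt; apply/orP; left; apply/eqP.
move: (Ex mu _) (2 ^+ r) (#|V| ^ 2)%N%:R (1 + 4 * #|V| + 3 * #|V| ^ 2)%N%:R (n%:R^-1) => a b c e f.
by field; rewrite gt_eqF.
Qed.

End DensityMean.

Section DegreeVariance.
Variables (R : realType) (K : nat) (V : 'I_K.+1 -> finType)
  (g : forall i, nat -> V i * V i) (r : 'I_K.+1 -> nat) (beta : 'I_K.+1 -> R) (p : R).
Hypothesis gs : forall i, simple_edges (@g i) (r i).
Hypothesis r0 : r ord0 = 1%N.
Hypothesis beta0 : forall i, i != ord0 -> 0 <= beta i.
Hypothesis p01 : 0 < p < 1.
Hypothesis kap : kappa_of r beta p < (2 * (p * (1 - p)))^-1.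
Hypothesis breg : forall z, 0 <= p + z <= 1 ->
  \sum_i beta i * bregman (r i) p (p + z) <= 2^-1 * kl p z.
Hypothesis stat : \sum_i beta i * ((r i)%:R * p ^+ (r i).-1) = 2^-1 * (ln p - ln (1 - p)).

(** The last hypothesis on [mu] says that it is optimal in the variational formula up to [C0 / n].
    After inserting the mean densities, [stat] cancels the terms linear in the drift, and
    [pointwise_bound] leaves [c] times the squared row means of the drift. Adding the innovations
    back costs another O(1/n). *)
Lemma degree_variance : exists eps C : R, [/\ 0 < eps, 0 <= C &
  forall n (mu : {set {set 'I_n}} -> R) theta (C0 : R), (0 < n)%N -> 0 <= C0 ->
    is_pmf mu -> (forall x, mu x != 0 -> x \in Omega n) -> (forall e y, 0 <= theta e y <= 1) ->
    uncorrelated mu (fun e x => (e \in x)%:R - theta e x) ->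
    (forall x, mu x != 0 -> four_cycle (fun u w => adj R x u w - p) <= eps ^+ 4) ->
    \sum_i beta i * p ^+ r i - C0 * n%:R^-1 <=
      Ex mu (fun x => \sum_i beta i * density R (@g i) (r i) x)
      + 2^-1 * (ln (1 - p) - ln p) * Ex mu (mean_drift theta p)
      - 2^-1 * Ex mu (mean_kl p theta) ->
    Ex mu (fun x => av (fun b => av (fun w => adj R x b w - p) ^+ 2)) <= C * (1 + C0) * n%:R^-1].
Proof.
have [eps [c [d [C [[eps0 c0 d0 C0] main]]]]] := pointwise_bound gs r0 beta0 p01 kap breg.
pose B := \sum_i `|beta i| * (r i)%:R.
have B0 : 0 <= B by apply: sumr_ge0 => i _; rewrite mulr_ge0.
(* Makes the energy lost in [first_order], summed over all edges and graphs, at most the [d] left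
   over by [pointwise_bound]. *)
pose delta := d / (B + 1).
have delta0 : 0 < delta by rewrite divr_gt0 //; lra.
have dB : B * delta <= d by rewrite /delta mulrCA ler_piMr ?(ltW d0) // ler_pdivrMr; lra.
pose D := \sum_i `|beta i| * density_error (V i) (r i) delta.
have D0 : 0 <= D.
  apply: sumr_ge0 => i _; rewrite mulr_ge0 // /density_error addr_ge0 // ?mulr_ge0 ?addr_ge0 ?exprn_ge0 //.
  by rewrite invr_ge0 mulr_ge0 // ltW.
(* [9 = 3 + 6] comes from [noise_moment] and [four_cycle_moment]; the last 3 is the noise again,
   through [(s + t)^2 <= 2 s^2 + 2 t^2]. *)
pose C' := 2 * ((D + 9 * C + 1) / c + 3).
have C'0 : 0 <= C' by rewrite /C' mulr_ge0 // addr_ge0 // divr_ge0 ?(ltW c0) //; lra.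
exists eps, C'; split => // n mu theta Ce n0 Ce0 pm muO th01 unc small ent.
have W0 : (0 < #|'I_n|)%N by rewrite card_ord.
pose S := Ex mu (fun x => energy (drift theta p x)).
pose PS i := Ex mu (fun x => graph_pair_sum g r p theta x i).
pose y := Ex mu (mean_drift theta p).
pose KL := Ex mu (mean_kl p theta).
pose Y := Ex mu (fun x => av (fun b => row (drift theta p x) b ^+ 2)).
pose N := Ex mu (fun x => av (fun b => noise p (base theta p x) b ^+ 2)).
pose Q := Ex mu (fun x => four_cycle (innov theta p x)).
pose ni : R := n%:R^-1.
have ni0 : 0 <= ni by rewrite invr_ge0.
have S0 : 0 <= S.
  by apply: Ex_ge0 => // x; apply: av_ge0 => // u; apply: av_ge0 => // w; exact: sqr_ge0.
have N3 : N <= 3 * ni := noise_moment n0 pm muO th01 unc p01.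
have Q6 : Q <= 6 * ni := four_cycle_moment n0 pm muO th01 unc p01.
have point : c * Y + \sum_i beta i * PS i + d * S <= 2^-1 * KL + C * N + C * Q.
  have -> : \sum_i beta i * PS i = Ex mu (fun x => \sum_i beta i * graph_pair_sum g r p theta x i).
    by rewrite Ex_sum; apply: eq_bigr => i _; rewrite ExZ.
  rewrite /Y /S /KL /N /Q -!ExZ -!ExD; apply: ler_Ex => // x mx.
  by apply: main => //; [exact: muO|exact: small].
have dens : Ex mu (fun x => \sum_i beta i * density R (@g i) (r i) x) <=
   \sum_i beta i * PS i + \sum_i beta i * p ^+ r i
    + 2^-1 * (ln p - ln (1 - p)) * y + B * (delta * S) + D * ni.
  rewrite Ex_sum -stat /B /D !mulr_suml -!big_split /=; apply: ler_sum => i _.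
  rewrite ExZ.
  have := density_mean n0 pm muO th01 unc p01 (gs i) delta0.
  rewrite -/S -/y -/(PS i) => h.
  have : `|beta i * (Ex mu (fun x => density R (@g i) (r i) x) - PS i - p ^+ r i
      - (r i)%:R * p ^+ (r i).-1 * y)| <=
     `|beta i| * ((r i)%:R * (delta * S) + density_error (V i) (r i) delta * ni).
    by rewrite normrM ler_wpM2l.
  rewrite ler_norml => /andP[_]; move: (Ex mu _) (PS i) (p ^+ r i) (p ^+ _.-1) (density_error _ _ _) (beta i) `|beta i|.
  move: ((r i)%:R : R) => a1 a2 a3 a4 a5 a6 a7 a8 h'.
  by clear - h'; lra.
have dBS : B * (delta * S) <= d * S by rewrite mulrA ler_wpM2r.
have hY : c * Y <= (D + 9 * C + Ce) * ni.
  have CN := ler_wpM2l C0 N3; have CQ := ler_wpM2l C0 Q6.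
  move: ent point dens dBS CN CQ; rewrite -/y -/KL -/ni.
  move: (\sum_i beta i * p ^+ r i) (\sum_i beta i * PS i) (Ex mu _) (B * _) (d * S).
  move: (ln p) (ln (1 - p)) => l l' a1 a2 a3 a4 a5; clear -C0; lra.
have Yle : Y <= (D + 9 * C + Ce) / c * ni by rewrite mulrAC ler_pdivlMr // mulrC.
apply: (@le_trans _ _ (2 * Y + 2 * N)).
  rewrite /Y /N -!ExZ -ExD; apply: ler_Ex => // x _; rewrite -!avZ -avD; apply: ler_av => // b.
  have -> : av (fun w => adj R x b w - p) = row (drift theta p x) b + noise p (base theta p x) b.
    by rewrite /row /noise -avD; apply: eq_av => w; rewrite /base; ring.
  move: (row _ _) (noise _ _ _) => s t; have := sqr_ge0 (s - t); lra.
have : (D + 9 * C + Ce) / c <= (D + 9 * C + 1) / c * (1 + Ce).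
  rewrite mulrAC ler_pM2r ?invr_gt0 //.
  by have := mulr_ge0 D0 Ce0; have := mulr_ge0 C0 Ce0; lra.
move=> h; have h2 := ler_wpM2r ni0 h; rewrite -/ni /C'.
have h3 : 0 <= Ce * ni by rewrite mulr_ge0.
move: Yle h2; move: ((D + 9 * C + Ce) / c * ni) ((D + 9 * C + 1) / c) => a b Yle h2; lra.
Qed.

End DegreeVariance.

(** * The product measure and the lower bound for the partition function *)

Lemma sum_edges (R : realType) (n : nat) (F : {set 'I_n} -> R) :
  \sum_(e in edges n) F e = 2^-1 * \sum_(u < n) \sum_(w < n | u != w) F [set u; w]%SET.
Proof.
rewrite pair_big_dep /=.
rewrite (partition_big (fun q : 'I_n * 'I_n => [set q.1; q.2]%SET) (mem (edges n))) /=; last first.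
  by move=> [u w] /= uw; rewrite /edges inE cards2 uw.
rewrite mulr_sumr; apply: eq_bigr => e; rewrite /edges inE => /cards2P[a [b [ab eE]]].
rewrite (eq_bigr (fun=> F e)); last by move=> q /andP[_ /eqP ->].
rewrite sumr_const; suff -> : #|[pred q : 'I_n * 'I_n | (q.1 != q.2) && ([set q.1; q.2]%SET == e)]| = 2%N.
  by rewrite mulrnAr -mulr_natl mulrA divff ?mul1r.
rewrite (eq_card (B := pred2 (a, b) (b, a))).
  by rewrite card2 xpair_eqE (negbTE ab).
move=> [u w]; rewrite !inE /= !xpair_eqE eE; apply/andP/orP.
  move=> [uw /eqP E].
  have : u \in [set a; b]%SET by rewrite -E !inE eqxx.
  have : w \in [set a; b]%SET by rewrite -E !inE eqxx orbT.
  rewrite !inE; case/orP => /eqP wE; case/orP => /eqP uE; subst u w; rewrite ?eqxx in uw *;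
    by [|right|left].
by case=> /andP[/eqP -> /eqP ->]; rewrite ?eqxx ?ab // eq_sym ab finset.setUC.
Qed.

Section EdgeProduct.
Variables (R : realType) (n : nat) (p : R).
Hypothesis n0 : (0 < n)%N.
Hypothesis p01 : 0 < p < 1.
Local Notation T := {set 'I_n}.

(** The coordinates are all vertex sets, so those that are not edges get probability 0. The dummy
    argument gives it the type of [theta]; the drift is then 0, and the moment lemmas apply with
    [base] equal to [adj]. *)
Definition edge_prob (e : T) (_ : {set T}) : R := if e \in edges n then p else 0.
Definition edge_product : {set T} -> R := prod_pmf (fun e => edge_prob e finset.set0).

Let p0 : 0 < p. Proof. by case/andP: p01. Qed.
Let p1 : p < 1. Proof. by case/andP: p01. Qed.

Lemma edge_prob01 e x : 0 <= edge_prob e x <= 1.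
Proof. by rewrite /edge_prob; case: ifP => _; rewrite ?lexx ?ler01 // !ltW. Qed.

Lemma edge_product_pmf : is_pmf edge_product.
Proof. by apply: prod_pmf_is_pmf => e; apply: edge_prob01. Qed.

Lemma edge_product_unc : uncorrelated edge_product (fun e x => (e \in x)%:R - edge_prob e x).
Proof. exact: prod_pmf_uncorrelated. Qed.

Lemma edge_product_gt0 x : x \in Omega n -> 0 < edge_product x.
Proof.
rewrite /Omega inE => /fintype.subsetP xO; apply: prodr_gt0 => e _; rewrite /edge_prob.
case: (boolP (e \in x)) => [/xO ->//|_]; case: ifP => _; first by rewrite subr_gt0.
by rewrite subr0.
Qed.

Lemma edge_product_Omega x : edge_product x != 0 -> x \in Omega n.
Proof.
move=> Px; rewrite /Omega inE; apply/fintype.subsetP => e ex; apply: contraNT Px => en.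
by rewrite /edge_product /prod_pmf (bigD1 e) //= ex /edge_prob (negbTE en) mul0r.
Qed.

Lemma edge_drift x u w : drift edge_prob p x u w = 0.
Proof.
rewrite /drift /edge_prob; case: eqP => // /eqP uw.
by rewrite /edges inE cards2 uw subrr.
Qed.

Lemma edge_base x u w : base edge_prob p x u w = adj R x u w.
Proof. by rewrite /base edge_drift subr0. Qed.

Lemma edge_four_cycle :
  Ex edge_product (fun x => four_cycle (fun u w => adj R x u w - p)) <= 6 * n%:R^-1.
Proof.
rewrite -(eq_Ex (f := fun x => four_cycle (innov edge_prob p x))).
  by apply: four_cycle_moment => //; [exact: edge_product_pmf|exact: edge_product_Omega|
    exact: edge_prob01|exact: edge_product_unc].
move=> x; rewrite /four_cycle; apply: eq_av => u; apply: eq_av => w; congr (_ ^+ 2).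
by apply: eq_av => c; rewrite /innov !edge_base.
Qed.

Lemma edge_density (V : finType) (g : nat -> V * V) (r : nat) : simple_edges g r ->
  `|Ex edge_product (fun x => density R g r x) - p ^+ r| <= (2 ^+ r + 1) * (#|V| ^ 2)%N%:R * n%:R^-1.
Proof.
move=> gs.
rewrite (eq_Ex (g := fun x => av (fun s => \prod_(j < r) ev g (base edge_prob p x) j s))).
  by apply: zeroth_order => //; [exact: edge_product_pmf|exact: edge_product_Omega|
    exact: edge_prob01|exact: edge_product_unc].
move=> x; apply: eq_av => s; apply: eq_bigr => j _; by rewrite /ev edge_base.
Qed.

Definition bern_entropy : R := - xlnx p - xlnx (1 - p).

Lemma ln_edge_product x : x \in Omega n ->
  ln (edge_product x) = \sum_(e in edges n) ((e \in x)%:R * ln p + (1 - (e \in x)%:R) * ln (1 - p)).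
Proof.
rewrite /Omega inE => /fintype.subsetP xO.
have fpos (e : T) : 0 < (if e \in x then edge_prob e finset.set0 else 1 - edge_prob e finset.set0).
  rewrite /edge_prob; case: (boolP (e \in x)) => [/xO ->//|_]; case: ifP => _; first by rewrite subr_gt0.
  by rewrite subr0.
rewrite /edge_product /prod_pmf.
have [_ ->] : 0 < \prod_e (if e \in x then edge_prob e finset.set0 else 1 - edge_prob e finset.set0) /\
   ln (\prod_e (if e \in x then edge_prob e finset.set0 else 1 - edge_prob e finset.set0)) =
   \sum_e ln (if e \in x then edge_prob e finset.set0 else 1 - edge_prob e finset.set0).
  elim/big_rec2: _ => [|e a b _ [b0 <-]]; first by rewrite ltr01 ln1.
  by split; [rewrite mulr_gt0|rewrite lnM ?posrE].
rewrite [RHS]big_mkcond /=; apply: eq_bigr => e _; rewrite /edge_prob.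
case: (boolP (e \in x)) => [ex|_].
  by rewrite xO // mul1r subrr mul0r addr0.
by case: ifP => _; rewrite ?mul0r ?add0r ?subr0 ?mul1r ?ln1.
Qed.

Lemma edge_product_entropy :
  Ex edge_product (fun x => ln (edge_product x)) = - (#|edges n|%:R * bern_entropy).
Proof.
rewrite (eq_Ex_supp (g := fun x : {set {set 'I_n}} => \sum_(e in edges n)
   ((e \in x)%:R * (ln p - ln (1 - p)) + ln (1 - p)))); last first.
  move=> x Px; rewrite ln_edge_product; last exact: edge_product_Omega.
  by apply: eq_bigr => e _; ring.
rewrite Ex_sum mulr_natl -mulNrn -sumr_const; apply: eq_bigr => e eE.
rewrite ExD ExZr Ex_cst; last exact: edge_product_pmf.
have -> : Ex edge_product (fun x : {set T} => (e \in x)%:R) = p.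
  have := edge_product_unc p (isT : uniq [:: e]).
  rewrite /= expr1 => <-; apply: eq_Ex => x; rewrite big_seq1 /edge_prob eE; ring.
rewrite /bern_entropy /xlnx; ring.
Qed.

Lemma ln_edge_product_bound x : x \in Omega n ->
  `|ln (edge_product x)| <= n%:R ^+ 2 * (- ln p - ln (1 - p)).
Proof.
move=> xO; rewrite ln_edge_product //; apply: (le_trans (ler_norm_sum _ _ _)).
have l1 : ln p <= 0 by apply: ln_le0; exact: ltW.
have l2 : ln (1 - p) <= 0 by apply: ln_le0; have := p0; lra.
apply: (@le_trans _ _ (\sum_(e in edges n) (- ln p - ln (1 - p)))).
  apply: ler_sum => e _; case: (e \in x) => /=.
    by rewrite subrr mul0r addr0 mul1r ler0_norm //; lra.
  by rewrite mul0r add0r subr0 mul1r ler0_norm //; lra.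
rewrite sum_edges; have L0 : 0 <= - ln p - ln (1 - p) by lra.
apply: (@le_trans _ _ (2^-1 * \sum_(u < n) \sum_(w < n) (- ln p - ln (1 - p)))).
  rewrite ler_wpM2l ?invr_ge0 //; apply: ler_sum => u _; rewrite big_mkcond /=.
  by apply: ler_sum => w _; case: ifP.
rewrite !sumr_const !card_ord -mulrnA -[X in 2^-1 * X]mulr_natl natrM -expr2 mulrA.
by rewrite ler_wpM2r // ler_piMl ?exprn_ge0 // invf_le1 // ler1n.
Qed.

End EdgeProduct.

(** Jensen's inequality restricted to [B]: on [B] the exponential lies above its tangent at [a], and
    off [B] the tangent is removed at a cost proportional to [q]. With [F] of order [n^2] and [q] of
    order [1 / n], the loss [4 F q + 1] is O(n). *)
Lemma gibbs_lower (R : realType) (T : finType) (P f : T -> R) (B : {set T}) (F q : R) :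
  is_pmf P -> (forall x, P x != 0 -> `|f x| <= F) -> 0 <= F ->
  Ex P (fun x => (x \notin B)%:R) <= q -> q <= 2^-1 ->
  expR (Ex P f - (4 * F * q + 1)) <= Ex P (fun x => (x \in B)%:R * expR (f x)).
Proof.
move=> pm fF F0 hq q2; set a := _ - _.
have q0 : 0 <= q by apply: le_trans hq; apply: Ex_ge0.
have fE : `|Ex P f| <= F.
  apply: (le_trans (ler_norm_Ex _ pm)); rewrite -[leRHS](Ex_cst F pm).
  exact: ler_Ex.
have aF : `|a| <= F + (4 * F * q + 1).
  rewrite /a; apply: (le_trans (ler_normB _ _)); rewrite lerD // ger0_norm //.
  by rewrite addr_ge0 // mulr_ge0 // mulr_ge0.
have step : Ex P (fun x => expR a * ((1 + f x - a) - (x \notin B)%:R * (1 + 2 * F + (4 * F * q + 1))))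
   <= Ex P (fun x => (x \in B)%:R * expR (f x)).
  apply: ler_Ex => // x Px; have := fF x Px; move: aF; rewrite !ler_norml => /andP[a1 a2] /andP[b1 b2].
  case: (x \in B); rewrite /= ?mul1r ?mul0r.
    have -> : expR (f x) = expR a * expR (f x - a) by rewrite -expRD addrC subrK.
    rewrite ler_pM2l ?expR_gt0 //; have := expR_ge1Dx (f x - a); lra.
  by rewrite pmulr_rle0 ?expR_gt0 //; lra.
apply: le_trans step; rewrite ExZ ler_pMr ?expR_gt0 // ExB ExB ExD ExZr !Ex_cst //.
have Fq : 0 <= F * q by rewrite mulr_ge0.
set b := Ex P _ in hq *.
have h1 : b * (1 + 2 * F + (4 * F * q + 1)) <= q * (1 + 2 * F + (4 * F * q + 1)).
  by apply: ler_wpM2r => //; lra.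
have h2 : q * (F * q) <= 2^-1 * (F * q) by apply: ler_wpM2r.
by rewrite /a; lra.
Qed.

Section EntropyIdentity.
Variables (R : realType) (n : nat) (p : R).
Hypothesis n0 : (0 < n)%N.

(** For an edge, [xlnx t + xlnx (1 - t)] equals [kl p (t - p)] plus a multiple of [t - p] minus
    [bern_entropy p]; non-edges contribute 0, and so does the diagonal of the averages. *)
Lemma entropy_sum (theta : {set 'I_n} -> {set {set 'I_n}} -> R) x :
  (forall e, e \notin edges n -> theta e x = 0) ->
  \sum_e (xlnx (theta e x) + xlnx (1 - theta e x)) =
  n%:R ^+ 2 * (2^-1 * (mean_kl p theta x + (ln p - ln (1 - p)) * mean_drift theta p x))
  - #|edges n|%:R * bern_entropy p.
Proof.
move=> th0.
rewrite (bigID (mem (edges n))) /= [X in _ + X]big1 ?addr0; last first.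
  by move=> e /th0 ->; rewrite /xlnx mul0r subr0 ln1 mulr0 addr0.
have -> : #|edges n|%:R * bern_entropy p = \sum_(e in edges n) bern_entropy p.
  by rewrite sumr_const mulr_natl.
apply: (@addIr _ (\sum_(e in edges n) bern_entropy p)); rewrite subrK -big_split /= sum_edges.
rewrite mulrCA; congr (_ * _).
have n1 : n%:R != 0 :> R by rewrite pnatr_eq0 -lt0n.
have dbl (F : 'I_n -> 'I_n -> R) : n%:R ^+ 2 * av (fun u => av (F u)) = \sum_u \sum_w F u w.
  rewrite avE card_ord expr2 -mulrA mulVKf // mulr_sumr; apply: eq_bigr => u _.
  by rewrite avE card_ord mulVKf.
rewrite /mean_kl /mean_drift -avZ -avD.
rewrite (eq_av (G := fun u => av (fun w => kl p (drift theta p x u w)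
    + (ln p - ln (1 - p)) * drift theta p x u w))); last by move=> u; rewrite -avZ -avD.
rewrite dbl; apply: eq_bigr => u _; rewrite big_mkcond /=; apply: eq_bigr => w _.
rewrite /drift; case: eqP => _ /=.
  by rewrite /kl /xlnx addr0; ring.
move: (theta _ x) => t; rewrite /kl /bern_entropy; have -> : p + (t - p) = t by ring.
by rewrite /xlnx; ring.
Qed.

End EntropyIdentity.

Section ErgmDegreeVariance.
Variables (R : realType) (K : nat) (v : 'I_K.+1 -> nat)
  (E : forall i : 'I_K.+1, {set {set 'I_(v i)}}) (beta : 'I_K.+1 -> R) (p : R).
Variable g : forall i : 'I_K.+1, nat -> 'I_(v i).-1.+1 * 'I_(v i).-1.+1.
Hypothesis gs : forall i, simple_edges (@g i) #|E i|.
Hypothesis gE : forall i n (x : {set {set 'I_n}}), (0 < n)%N ->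
  (hom_count (v i) (E i) n x)%:R = n%:R ^+ (v i) * density R (@g i) #|E i| x.
Hypothesis p01 : 0 < p < 1.

Let p0 : 0 < p. Proof. by case/andP: p01. Qed.
Let p1 : p < 1. Proof. by case/andP: p01. Qed.
Let p01' : 0 <= p <= 1. Proof. by rewrite !ltW. Qed.

Let psi n (x : {set {set 'I_n}}) : R := \sum_i beta i * density R (@g i) #|E i| x.
Let Z n eta : R := \sum_(y in cut_ball R n eta p) expR (hamiltonian R K v E beta n y).

Lemma density01 (V : finType) (h : nat -> V * V) k n (x : {set {set 'I_n}}) : (0 < n)%N ->
  `|density R h k x| <= 1.
Proof.
move=> n0; apply: av_norm_le => [|s]; first by apply: ffun_card_gt0; rewrite card_ord.
rewrite normr_prod; apply: prodr_ile1 => j _; rewrite normr_ge0 /ev.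
by have /andP[h0 h1] := adj01 R x (s (h j).1) (s (h j).2); rewrite ger0_norm.
Qed.

(** Gibbs variational bound with the product measure as trial measure; [edge_density] gives its mean
    energy up to O(n). *)
Lemma partition_lower eta : 0 < eta -> exists C n1, 0 <= C /\ forall n, (0 < n)%N -> (n1 <= n)%N ->
  expR (n%:R ^+ 2 * (\sum_i beta i * p ^+ #|E i|) + #|edges n|%:R * bern_entropy p - C * n%:R)
    <= Z n eta.
Proof.
move=> eta0.
have l1 : ln p <= 0 by apply: ln_le0; exact: ltW.
have l2 : ln (1 - p) <= 0 by apply: ln_le0; have := p0; lra.
pose M := \sum_i `|beta i| + (- ln p - ln (1 - p)).
have M0 : 0 <= M by rewrite addr_ge0 ?sumr_ge0 //; lra.
(* Markov's inequality: outside the ball the four-cycle density exceeds [(eta / 2) ^+ 4], while its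
   mean under the product measure is at most [6 / n]. *)
pose c := 6 / (eta / 2) ^+ 4.
have c0 : 0 < c by rewrite divr_gt0 // exprn_gt0 // divr_gt0.
pose D := \sum_i `|beta i| * ((2 ^+ #|E i| + 1) * (#|'I_(v i).-1.+1| ^ 2)%N%:R).
have D0 : 0 <= D.
  by apply: sumr_ge0 => i _; rewrite mulr_ge0 // mulr_ge0 // addr_ge0 // exprn_ge0.
(* [D] is the error in the mean energy, the rest is the loss in [gibbs_lower] with [F = n^2 M] and
   [q = c / n]; the threshold on [n] ensures [q <= 1/2]. *)
exists (D + 4 * M * c + 1), (Num.truncn (2 * c)).+1; split.
  by rewrite addr_ge0 // addr_ge0 // mulr_ge0 ?(ltW c0) // mulr_ge0.
move=> n n0 n1; have nR : 0 < n%:R :> R by rewrite ltr0n.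
have W0 : (0 < #|'I_n|)%N by rewrite card_ord.
have nc : 2 * c <= n%:R.
  apply: ltW; apply: (lt_le_trans (truncnS_gt _)); by rewrite ler_nat.
pose P := @edge_product R n p.
have pm : is_pmf P := edge_product_pmf n p01.
pose f x := hamiltonian R K v E beta n x - ln (P x).
have fM x : P x != 0 -> `|f x| <= n%:R ^+ 2 * M.
  move=> Px; apply: (le_trans (ler_normB _ _)); rewrite mulrDr lerD //.
    rewrite (hamiltonian_density _ gE) // normrM ger0_norm ?exprn_ge0 // ler_wpM2l ?exprn_ge0 //.
    apply: (le_trans (ler_norm_sum _ _ _)); apply: ler_sum => i _.
    by rewrite normrM ler_piMr // density01.
  by apply: ln_edge_product_bound => //; exact: edge_product_Omega Px.
have out : Ex P (fun x => (x \notin cut_ball R n eta p)%:R) <= c / n%:R.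
  have e4 : 0 < (eta / 2) ^+ 4 by rewrite exprn_gt0 // divr_gt0.
  apply: (@le_trans _ _ (Ex P (fun x => four_cycle (fun u w => adj R x u w - p)) / (eta / 2) ^+ 4)).
    rewrite -ExZr; apply: ler_Ex => // x Px.
    case: (boolP (x \in cut_ball R n eta p)) => /= xB.
      by rewrite divr_ge0 ?(ltW e4) // /four_cycle; apply: av_ge0 => // u; apply: av_ge0 => // w; apply: sqr_ge0.
    rewrite ler_pdivlMr // mul1r; case: leP => // /ltW h; case/negP: xB.
    rewrite /cut_ball finset.in_set (edge_product_Omega Px) /=.
    apply: le_lt_trans (cut_of_four_cycle n0 _ h) _; first by rewrite divr_ge0 // ltW.
    by have := eta0; lra.
  rewrite /c -mulrA [_^-1 * _]mulrC mulrA ler_pM2r ?invr_gt0 //.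
  exact: edge_four_cycle.
have q2 : c / n%:R <= 2^-1.
  by rewrite ler_pdivrMr //; have := nc; lra.
have := gibbs_lower pm fM _ out q2; rewrite mulr_ge0 ?exprn_ge0 // => /(_ isT) h.
have -> : Z n eta = Ex P (fun x => (x \in cut_ball R n eta p)%:R * expR (f x)).
  rewrite /Z big_mkcond; apply: eq_bigr => x _.
  case: (boolP (x \in cut_ball R n eta p)) => /= xB; last by rewrite mul0r mulr0.
  have xO : x \in Omega n by move: xB; rewrite /cut_ball finset.in_set => /andP[].
  have Px := edge_product_gt0 p01 xO.
  by rewrite mul1r /f expRB lnK ?posrE // mulrCA mulfV ?gt_eqF // mulr1.
apply: le_trans h; rewrite ler_expR.
have EH : n%:R ^+ 2 * (\sum_i beta i * p ^+ #|E i|) - D * n%:R <= Ex P (hamiltonian R K v E beta n).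
  rewrite (eq_Ex (g := fun x => n%:R ^+ 2 * psi x)); last by move=> x; apply: hamiltonian_density.
  have -> : n%:R ^+ 2 * (\sum_i beta i * p ^+ #|E i|) - D * n%:R =
     n%:R ^+ 2 * (\sum_i beta i * p ^+ #|E i| - D * n%:R^-1).
    by field; rewrite gt_eqF.
  rewrite ExZ ler_wpM2l ?exprn_ge0 // /psi Ex_sum /D mulr_suml -sumrB; apply: ler_sum => i _.
  rewrite ExZ lerBlDr addrC -lerBlDr -mulrBr.
  have := edge_density n0 p01 (gs i); rewrite distrC => hd.
  rewrite -mulrA; apply: (le_trans (ler_norm _)); rewrite normrM; exact: ler_wpM2l.
rewrite /f ExB edge_product_entropy //.
have -> : 4 * (n%:R ^+ 2 * M) * (c / n%:R) = 4 * M * c * n%:R by field; rewrite gt_eqF.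
have n1' : 1 <= n%:R :> R by rewrite ler1n.
move: EH; rewrite -/P; move: (#|edges n|%:R * _) (Ex P _) (\sum_i _) (n%:R ^+ 2) => a b d e EH.
by have := EH; lra.
Qed.

End ErgmDegreeVariance.

(** * Degree variance of the conditioned measure *)

Section ErgmDegreeVariance.
Variables (R : realType) (K : nat) (v : 'I_K.+1 -> nat)
  (E : forall i : 'I_K.+1, {set {set 'I_(v i)}}) (beta : 'I_K.+1 -> R) (p : R).
Variable g : forall i : 'I_K.+1, nat -> 'I_(v i).-1.+1 * 'I_(v i).-1.+1.
Hypothesis gs : forall i, simple_edges (@g i) #|E i|.
Hypothesis gE : forall i n (x : {set {set 'I_n}}), (0 < n)%N ->
  (hom_count (v i) (E i) n x)%:R = n%:R ^+ (v i) * density R (@g i) #|E i| x.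
Hypothesis r0 : #|E ord0| = 1%N.
Hypothesis beta0 : forall i, i != ord0 -> 0 <= beta i.
Hypothesis pU : in_Ubeta R K v E beta p.

Let p0 : 0 < p := optimum_gt0 pU.
Let p1 : p < 1 := optimum_lt1 pU.
Let p01 : 0 < p < 1. Proof. by rewrite p0 p1. Qed.
Let p01' : 0 <= p <= 1. Proof. by rewrite !ltW. Qed.

Lemma cond_ergm_pmf n eta : 0 < \sum_(y in cut_ball R n eta p) expR (hamiltonian R K v E beta n y) ->
  is_pmf (cond_ergm R K v E beta n eta p).
Proof.
move=> Z0; split=> [x|].
  by rewrite /cond_ergm divr_ge0 ?(ltW Z0) // mulr_ge0 // expR_ge0.
rewrite /cond_ergm -mulr_suml.
have -> : \sum_(x : {set {set 'I_n}}) (x \in cut_ball R n eta p)%:R * expR (hamiltonian R K v E beta n x) =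
   \sum_(y in cut_ball R n eta p) expR (hamiltonian R K v E beta n y).
  rewrite [RHS]big_mkcond; apply: eq_bigr => x _.
  by case: (x \in _); rewrite ?mul1r ?mul0r.
by rewrite mulfV // gt_eqF.
Qed.

Lemma cond_ergm_ball n eta x : cond_ergm R K v E beta n eta p x != 0 -> x \in cut_ball R n eta p.
Proof. by apply: contraNT => xB; rewrite /cond_ergm (negbTE xB) !mul0r. Qed.

(** The mean of [ln (mu x)] is computed twice: from the Gibbs form as [n^2] times the mean of [psi]
    minus [ln Z], and from the chain rule through divergence and drift. Equating the two, with the
    lower bound for [ln Z], gives the near-optimality required by [degree_variance]. *)
Lemma ergm_degree_variance : exists eta C n1, [/\ 0 < eta, 0 <= C &
  forall n, (0 < n)%N -> (n1 <= n)%N ->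
    is_pmf (cond_ergm R K v E beta n eta p) /\
    Ex (cond_ergm R K v E beta n eta p)
       (fun x => av (fun b => av (fun w => adj R x b w - p) ^+ 2)) <= C * n%:R^-1].
Proof.
have stat : \sum_i beta i * (#|E i|%:R * p ^+ #|E i|.-1) = 2^-1 * (ln p - ln (1 - p)).
  by apply/eqP; rewrite -subr_eq0; apply/eqP; exact: stationary pU.
have [eps [C [eps0 C0 main]]] :=
  @degree_variance R K _ g (fun i => #|E i|) beta p gs r0 beta0 p01 (kappa_lt pU) (bregman_le_kl pU) stat.
(* Matches the factor 4 in [four_cycle_of_cut]. *)
pose eta := eps ^+ 4 / 4.
have eta0 : 0 < eta by rewrite divr_gt0 // exprn_gt0.
have [D [n1 [D0 low]]] := partition_lower beta gs gE p01 eta0.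
exists eta, (C * (1 + D)), n1; split => //; first by rewrite mulr_ge0 // addr_ge0.
move=> n n0 nn1; have nR : 0 < n%:R :> R by rewrite ltr0n.
set mu := cond_ergm R K v E beta n eta p.
set Z : R := \sum_(y in cut_ball R n eta p) expR (hamiltonian R K v E beta n y).
have {}low := low n n0 nn1; rewrite -/Z in low.
have Z0 : 0 < Z := lt_le_trans (expR_gt0 _) low.
have pm : is_pmf mu := cond_ergm_pmf Z0.
split=> //.
have muO x : mu x != 0 -> x \in Omega n.
  by move=> /cond_ergm_ball; rewrite /cut_ball finset.in_set => /andP[].
pose theta := cprob mu.
apply: (main n mu theta D n0 D0 pm muO).
- by move=> e y; rewrite cprob_ge0 // cprob_le1.
- exact: cprob_uncorrelated.
- move=> x /cond_ergm_ball; rewrite /cut_ball finset.in_set => /andP[_ h].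
  apply: (le_trans (four_cycle_of_cut n0 x p01')).
  by rewrite -ler_pdivlMl // mulrC ltW.
have th0 e x : e \notin edges n -> theta e x = 0.
  move=> eE; apply: cprob_eq0 => y /muO; rewrite /Omega inE => /fintype.subsetP yE.
  by apply: contra eE; apply: yE.
pose psi (x : {set {set 'I_n}}) : R := \sum_i beta i * density R (@g i) #|E i| x.
have lnmu : Ex mu (fun x => ln (mu x)) = n%:R ^+ 2 * Ex mu psi - ln Z.
  rewrite -ExZ -(Ex_cst (ln Z) pm) -ExB; apply: eq_Ex_supp => x mx.
  have xB := cond_ergm_ball mx.
  by rewrite /mu /cond_ergm xB mul1r lnM ?posrE ?expR_gt0 ?invr_gt0 // lnV ?posrE // expRK
    (hamiltonian_density _ gE).
have chain : Ex mu (fun x => ln (mu x)) =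
   n%:R ^+ 2 * (2^-1 * (Ex mu (mean_kl p theta) + (ln p - ln (1 - p)) * Ex mu (mean_drift theta p)))
  - #|edges n|%:R * bern_entropy p.
  rewrite (entropy_chain_rule pm).
  rewrite -[X in _ = _ - X](Ex_cst _ pm) -[(ln p - _) * _]ExZ -ExD -!ExZ -ExB.
  rewrite (eq_bigr (fun e => Ex mu (fun x => xlnx (theta e x) + xlnx (1 - theta e x)))); last first.
    by move=> e _; rewrite ExD.
  by rewrite -Ex_sum; apply: eq_Ex => x; apply: entropy_sum => // e; exact: th0.
have lnZ : n%:R ^+ 2 * (\sum_i beta i * p ^+ #|E i|) + #|edges n|%:R * bern_entropy p - D * n%:R <= ln Z.
  by rewrite -[leLHS]expRK ler_ln ?posrE ?expR_gt0.
have n2 : 0 < n%:R ^+ 2 :> R by rewrite exprn_gt0.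
rewrite -(ler_pM2l n2).
have -> : n%:R ^+ 2 * (\sum_i beta i * p ^+ #|E i| - D * n%:R^-1)
   = n%:R ^+ 2 * (\sum_i beta i * p ^+ #|E i|) - D * n%:R.
  by field; rewrite gt_eqF.
rewrite -/(Ex mu psi); move: lnmu chain lnZ.
move: (Ex mu psi) (Ex mu (mean_kl p theta)) (Ex mu (mean_drift theta p)) (Ex mu _).
move: (#|edges n|%:R * _) (\sum_i _) (n%:R ^+ 2) (ln Z) (ln p) (ln (1 - p)).
move=> a d e l l1 l2 b h k f lnmu chain lnZ.
have : e * b - l = e * (2^-1 * (h + (l1 - l2) * k)) - a by rewrite -lnmu.
by move=> h1; lra.
Qed.

End ErgmDegreeVariance.

(** * Stein functions for the normal law *)

Section StandardNormal.
Variable R : realType.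
Local Notation Phi := (std_normal_cdf R).

Definition std_peak : R := normal_peak 1.

Lemma std_peak_gt0 : 0 < std_peak.
Proof. exact: normal_peak_gt0. Qed.

Lemma std_pdfE (x : R) : normal_pdf 0 1 x = std_peak * expR (- (x ^+ 2 / 2)).
Proof.
rewrite normal_pdfE ?oner_neq0 // /normal_fun subr0 expr1n mulNr.
by rewrite mulr2n.
Qed.

Lemma std_pdf_gt0 (x : R) : 0 < normal_pdf 0 1 x.
Proof. by rewrite std_pdfE mulr_gt0 ?expR_gt0 // std_peak_gt0. Qed.

Lemma is_derive_Phi (x : R) : is_derive x 1 Phi (normal_pdf 0 1 x).
Proof.
have [d e] : derivable Phi x 1 /\ (derive1 Phi x) = normal_pdf 0 1 x.
  apply: (@continuous_FTC1 R (normal_pdf 0 1) -oo%O x (x + 1)) => //.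
  - by rewrite ltrDl.
  - by apply: (integrableS measurableT) => //; exact: integrable_normal_pdf.
  - by rewrite ltNyr.
  - exact: (@continuous_normal_pdf R 0 1 (oner_neq0 R) x).
by split; [exact: d|rewrite -derive1E; exact: e].
Qed.

Lemma Phi_ge0 (x : R) : 0 <= Phi x.
Proof. by rewrite /std_normal_cdf fine_ge0 // measure_ge0. Qed.

Lemma Phi_le1 (x : R) : Phi x <= 1.
Proof.
rewrite /std_normal_cdf -[leRHS]/(fine 1%:E) fine_le // ?fin_num_measure //.
exact: probability_le1.
Qed.

Lemma Phi_lt (x y : R) : x < y -> Phi x < Phi y.
Proof.
move=> xy; have [c _ e] := mvt_closed xy (fun z _ => is_derive_Phi z).
by rewrite -subr_gt0 e mulr_gt0 ?std_pdf_gt0 // subr_gt0.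
Qed.

(** The identity viewed as a random variable under the normal law, so that [Phi] becomes a [cdf] and
    inherits its limits at both infinities. *)
Let idTR : measurableTypeR R -> R := idfun.
#[local] HB.instance Definition _ :=
  @isMeasurableFun.Build _ _ _ _ idTR (@measurable_id _ _ setT).
Let idRV : {RV (@normal_prob R 0 1) >-> R} := idTR.

Lemma Phi_cdf (x : R) : (Phi x)%:E = cdf idRV x.
Proof.
rewrite /std_normal_cdf fineK ?fin_num_measure //.
Qed.

Lemma Phi_tails (eps : R) : 0 < eps -> exists2 M, 0 < M &
  forall x, M <= x -> Phi (- x) < eps /\ 1 - Phi x < eps.
Proof.
move=> eps0.
have PhiE : (fine \o cdf idRV)%FUN = Phi by apply/funext => x; have /= <- := Phi_cdf x.
have up : (Phi x @[x --> +oo%R] --> (1 : R))%classic.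
  by have /fine_cvgP[_] := cvg_cdfy1 idRV; rewrite PhiE.
have lo : (Phi x @[x --> -oo%R] --> (0 : R))%classic.
  by have /fine_cvgP[_] := cvg_cdfNy0 idRV; rewrite PhiE.
have /cvgrPdist_lt/(_ eps eps0)[M1 [_ h1]] := up.
have /cvgrPdist_lt/(_ eps eps0)[M2 [_ h2]] := lo.
exists (`|M1| + `|M2| + 1) => [|x xM]; first by have := normr_ge0 M1; have := normr_ge0 M2; lra.
have := ler_norm M1; have := ler_norm (- M2); rewrite normrN => a1 a2.
have := normr_ge0 M1; have := normr_ge0 M2 => b1 b2.
split.
  have : - x < M2 by lra.
  by move/h2; rewrite sub0r normrN ger0_norm ?Phi_ge0.
have : M1 < x by lra.
by move/h1; rewrite ger0_norm // subr_ge0 Phi_le1.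
Qed.

End StandardNormal.

Section SteinClass.
Variable R : realType.
Local Notation Phi := (std_normal_cdf R).

(** Second-order Taylor bounds without a second derivative, that is C^{1,1} control with derivative
    [D]. The class is closed under products and under taking the squared positive part, which need
    not be twice differentiable. *)
Definition expands (P : R -> bool) (B : R) (f D : R -> R) :=
  forall w z, P w -> P z -> [/\ `|f w| <= B, `|D w| <= B, `|f z - f w| <= B * `|z - w|
    & `|f z - f w - (z - w) * D w| <= B * (z - w) ^+ 2].

Definition expandable (N : R) (f D : R -> R) :=
  exists B, expands (fun w => `|w| <= N) B f D.

Lemma expands_le P B B' f D : B <= B' -> expands P B f D -> expands P B' f D.
Proof.
move=> BB h w z Pw Pz; have [h1 h2 h3 h4] := h w z Pw Pz; split.
- exact: le_trans BB.
- exact: le_trans BB.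
- by apply: le_trans h3 _; rewrite ler_wpM2r.
- by apply: le_trans h4 _; rewrite ler_wpM2r ?sqr_ge0.
Qed.

Lemma expandableP N f D : expandable N f D ->
  exists2 B, 0 <= B & expands (fun w => `|w| <= N) B f D.
Proof.
move=> [B h]; exists `|B| => //; apply: expands_le h; exact: ler_norm.
Qed.

Lemma expandable_cst N c : expandable N (fun=> c) (fun=> 0).
Proof.
exists `|c| => w z _ _; rewrite subrr mulr0 subr0 normr0.
by split=> //; apply: mulr_ge0 => //; exact: sqr_ge0.
Qed.

Lemma expandableD N f D g D' : expandable N f D -> expandable N g D' ->
  expandable N (fun w => f w + g w) (fun w => D w + D' w).
Proof.
move=> [B hf] [C hg]; exists (B + C) => w z Pw Pz.
have [f1 f2 f3 f4] := hf w z Pw Pz; have [g1 g2 g3 g4] := hg w z Pw Pz.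
have tri (a b c d : R) : `|a| <= c -> `|b| <= d -> `|a + b| <= c + d.
  by move=> h1 h2; apply: (le_trans (ler_normD _ _)); rewrite lerD.
rewrite !mulrDl; split; [exact: tri|exact: tri|by rewrite opprD addrACA; exact: tri|].
have -> : f z + g z - (f w + g w) - (z * (D w + D' w) + - w * (D w + D' w)) =
  (f z - f w - (z - w) * D w) + (g z - g w - (z - w) * D' w) by ring.
exact: tri.
Qed.

Lemma expandableM N f D g D' : expandable N f D -> expandable N g D' ->
  expandable N (fun w => f w * g w) (fun w => D w * g w + f w * D' w).
Proof.
move=> /expandableP[B B0 hf] /expandableP[C C0 hg]; exists (3 * (B * C)) => w z Pw Pz.
have [f1 f2 f3 f4] := hf w z Pw Pz; have [g1 g2 g3 g4] := hg w z Pw Pz.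
have [fz _ _ _] := hf z w Pz Pw; have BC : 0 <= B * C by rewrite mulr_ge0.
have mul (a b c d : R) : `|a| <= c -> `|b| <= d -> `|a * b| <= c * d.
  by move=> h1 h2; rewrite normrM ler_pM.
have tri (a b c d : R) : `|a| <= c -> `|b| <= d -> `|a + b| <= c + d.
  by move=> h1 h2; apply: (le_trans (ler_normD _ _)); rewrite lerD.
have zw : 0 <= `|z - w| by [].
have q : `|z - w| * `|z - w| = (z - w) ^+ 2 by rewrite -expr2 real_normK ?num_real.
split.
- by apply: le_trans (mul _ _ _ _ f1 g1) _; lra.
- by apply: le_trans (tri _ _ _ _ (mul _ _ _ _ f2 g1) (mul _ _ _ _ f1 g2)) _; lra.
- have -> : f z * g z - f w * g w = f z * (g z - g w) + (f z - f w) * g w by ring.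
  apply: le_trans (tri _ _ _ _ (mul _ _ _ _ fz g3) (mul _ _ _ _ f3 g1)) _.
  have := mulr_ge0 BC zw; lra.
have -> : f z * g z - f w * g w - (z - w) * (D w * g w + f w * D' w) =
   f z * (g z - g w - (z - w) * D' w) + (f z - f w - (z - w) * D w) * g w
   + (f z - f w) * ((z - w) * D' w) by ring.
have h5 : `|(z - w) * D' w| <= `|z - w| * C by apply: mul.
apply: le_trans (tri _ _ _ _ (tri _ _ _ _ (mul _ _ _ _ fz g4) (mul _ _ _ _ f4 g1)) (mul _ _ _ _ f3 h5)) _.
have -> : B * `|z - w| * (`|z - w| * C) = B * C * (z - w) ^+ 2 by rewrite -q; ring.
by have := mulr_ge0 BC (sqr_ge0 (z - w)); lra.
Qed.

Definition pos (x : R) := Num.max x 0.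

Lemma posP x : (0 <= x /\ pos x = x) \/ (x <= 0 /\ pos x = 0).
Proof.
rewrite /pos; case: (leP x 0) => h; first by right; split.
by left; split=> //; exact: ltW.
Qed.

Lemma pos_sqr_expand (u v : R) : 0 <= pos v ^+ 2 - pos u ^+ 2 - 2 * pos u * (v - u) <= (v - u) ^+ 2.
Proof.
have h1 := sqr_ge0 u; have h2 := sqr_ge0 v; have h3 := sqr_ge0 (v - u).
case: (posP u) => [[u0 ->]|[u0 ->]]; case: (posP v) => [[v0 ->]|[v0 ->]]; rewrite ?expr0n /=.
- by apply/andP; split; lra.
- by have := mulr_ge0_le0 u0 v0; move=> h4; apply/andP; split; lra.
- by have := mulr_le0_ge0 u0 v0; move=> h4; apply/andP; split; lra.
- by apply/andP; split; lra.
Qed.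

Lemma expandable_pos N f D : expandable N f D ->
  expandable N (fun w => pos (f w) ^+ 2) (fun w => 2 * pos (f w) * D w).
Proof.
move=> /expandableP[B B0 hf]; exists (3 * B ^+ 2) => w z Pw Pz.
have [f1 f2 f3 f4] := hf w z Pw Pz; have [fz _ _ _] := hf z w Pz Pw.
have pb x : `|x| <= B -> 0 <= pos x <= B.
  by rewrite ler_norml => /andP[x1 x2]; case: (posP x) => [[? ->]|[? ->]]; rewrite ?lexx ?B0; lra.
have /andP[p1 p2] := pb _ f1; have /andP[q1 q2] := pb _ fz.
have plip : `|pos (f z) - pos (f w)| <= `|f z - f w|.
  case: (posP (f z)) => [[? ->]|[? ->]]; case: (posP (f w)) => [[? ->]|[? ->]]; rewrite ?subrr ?normr0 //.
    by rewrite subr0 ger0_norm // ger0_norm; lra.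
  by rewrite sub0r normrN ger0_norm // ler0_norm; lra.
have z0 : 0 <= `|z - w| by [].
have q : `|z - w| * `|z - w| = (z - w) ^+ 2 by rewrite -expr2 real_normK ?num_real.
split.
- by rewrite ger0_norm ?sqr_ge0 //; have := ler_pM p1 p1 p2 p2; rewrite -!expr2; have := sqr_ge0 B; lra.
- rewrite normrM normrM normr_nat (ger0_norm p1).
  apply: (@le_trans _ _ (2 * B * B)); last by have := sqr_ge0 B; rewrite expr2; lra.
  by apply: ler_pM => //; [exact: mulr_ge0|exact: ler_wpM2l].
- have -> : pos (f z) ^+ 2 - pos (f w) ^+ 2 = (pos (f z) + pos (f w)) * (pos (f z) - pos (f w)) by ring.
  rewrite normrM ger0_norm ?addr_ge0 //.
  apply: (@le_trans _ _ (2 * B * (B * `|z - w|))).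
    by rewrite ler_pM ?addr_ge0 //; [lra|exact: le_trans f3].
  by have := mulr_ge0 (sqr_ge0 B) z0; rewrite expr2; lra.
have -> : pos (f z) ^+ 2 - pos (f w) ^+ 2 - (z - w) * (2 * pos (f w) * D w) =
  (pos (f z) ^+ 2 - pos (f w) ^+ 2 - 2 * pos (f w) * (f z - f w))
   + 2 * pos (f w) * (f z - f w - (z - w) * D w) by ring.
apply: (le_trans (ler_normD _ _)).
have /andP[e1 e2] := pos_sqr_expand (f w) (f z).
have h1 : (f z - f w) ^+ 2 <= B ^+ 2 * (z - w) ^+ 2.
  rewrite -exprMn -[leLHS]real_normK ?num_real // -[leRHS]real_normK ?num_real //.
  by rewrite ler_sqr ?nnegrE // normrM (ger0_norm B0).
have h2 : `|2 * pos (f w) * (f z - f w - (z - w) * D w)| <= 2 * B * (B * (z - w) ^+ 2).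
  rewrite normrM ger0_norm ?mulr_ge0 //.
  by apply: ler_pM => //; [exact: mulr_ge0|exact: ler_wpM2l].
rewrite (ger0_norm e1); move: h2.
have -> : 2 * B * (B * (z - w) ^+ 2) = 2 * (B ^+ 2 * (z - w) ^+ 2) by ring.
by move=> h2; lra.
Qed.

Lemma expandable_derive2 (N : R) (f D D2 : R -> R) (B : R) :
  (forall x : R, is_derive x 1 f (D x)) -> (forall x : R, is_derive x 1 D (D2 x)) ->
  (forall x, `|x| <= N -> [/\ `|f x| <= B, `|D x| <= B & `|D2 x| <= B]) ->
  expandable N f D.
Proof.
move=> df dD bd; exists B => w z Pw Pz.
have [f1 f2 f3] := bd w Pw; have B0 : 0 <= B := le_trans (normr_ge0 _) f1.
have mv (F F' : R -> R) : (forall x : R, is_derive x 1 F (F' x)) -> w != z ->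
    exists c, [/\ `|c| <= N, `|c - w| <= `|z - w| & F z - F w = F' c * (z - w)].
  move=> dF; rewrite neq_lt => /orP[wz|zw].
    have [c /andP[c1 c2] e] := mvt_closed wz (fun x _ => dF x); exists c; split=> //.
      by move: Pw Pz; rewrite !ler_norml => /andP[? ?] /andP[? ?]; apply/andP; split; lra.
    by rewrite !ger0_norm; lra.
  have [c /andP[c1 c2] e] := mvt_closed zw (fun x _ => dF x); exists c; split=> //.
    by move: Pw Pz; rewrite !ler_norml => /andP[? ?] /andP[? ?]; apply/andP; split; lra.
  - by rewrite !ler0_norm; lra.
  - by rewrite -opprB e; ring.
case: (eqVneq w z) => [<-|wz].
  by split=> //; rewrite !subrr ?mul0r ?subrr ?normr0 ?expr0n ?mulr0.
have [c [c1 c2 e]] := mv f D df wz.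
have [_ Dc _] := bd c c1.
split=> //; first by rewrite e normrM ler_wpM2r.
case: (eqVneq w c) => [wc|wc].
  by rewrite e -wc mulrC subrr normr0 mulr_ge0 ?sqr_ge0.
have mvD : `|D c - D w| <= B * `|c - w|.
  have Dmv (a b : R) : `|a| <= N -> `|b| <= N -> a < b -> `|D b - D a| <= B * `|b - a|.
    move=> aN bN ab; have [y /andP[y1 y2] ey] := mvt_closed ab (fun x _ => dD x).
    rewrite ey normrM ler_wpM2r //; have [] // := bd y.
    by move: aN bN; rewrite !ler_norml => /andP[? ?] /andP[? ?]; apply/andP; split; lra.
  move: wc; rewrite neq_lt => /orP[wc|cw]; first exact: Dmv.
  by rewrite distrC [`|c - w|]distrC; exact: Dmv.
have -> : f z - f w - (z - w) * D w = (D c - D w) * (z - w) by rewrite e; ring.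
rewrite normrM -[(z - w) ^+ 2]real_normK ?num_real // expr2 mulrA ler_wpM2r //.
by apply: (le_trans mvD); rewrite ler_wpM2l.
Qed.

End SteinClass.

Section SteinFunctions.
Variable R : realType.
Local Notation Phi := (std_normal_cdf R).

Lemma is_derive_gauss (s x : R) :
  is_derive x 1 (fun w : R => expR (s * (w ^+ 2 / 2))) (s * x * expR (s * (x ^+ 2 / 2))).
Proof.
have h : is_derive x 1 (fun w : R => s * (w ^+ 2 / 2)) (s * x).
  by apply: is_derive_eq; rewrite /GRing.scale /=; field.
have := @is_derive1_comp R expR (fun w : R => s * (w ^+ 2 / 2)) x _ _ (is_derive_expR _) h.
by rewrite mulrC.
Qed.

Lemma is_derive_gauss2 (s x : R) :
  is_derive x 1 (fun w : R => s * w * expR (s * (w ^+ 2 / 2)))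
    ((s + s ^+ 2 * x ^+ 2) * expR (s * (x ^+ 2 / 2))).
Proof.
have h := is_derive_gauss s x; apply: is_derive_eq; rewrite /GRing.scale /=; ring.
Qed.

Lemma expandable_gauss N (s : R) : expandable N (fun w => expR (s * (w ^+ 2 / 2)))
  (fun w => s * w * expR (s * (w ^+ 2 / 2))).
Proof.
apply: (@expandable_derive2 R N (fun w => expR (s * (w ^+ 2 / 2)))
  (fun w => s * w * expR (s * (w ^+ 2 / 2))) (fun w => (s + s ^+ 2 * w ^+ 2) * expR (s * (w ^+ 2 / 2)))
   ((1 + `|s| * N + (`|s| + s ^+ 2 * N ^+ 2)) * expR (`|s| * (N ^+ 2 / 2)))).
- exact: is_derive_gauss.
- exact: is_derive_gauss2.
move=> x xN; have N0 : 0 <= N := le_trans (normr_ge0 _) xN.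
have x2 : x ^+ 2 <= N ^+ 2 by rewrite -[leLHS]real_normK ?num_real // ler_sqr ?nnegrE.
have e1 : expR (s * (x ^+ 2 / 2)) <= expR (`|s| * (N ^+ 2 / 2)).
  rewrite ler_expR; apply: (@le_trans _ _ (`|s| * (x ^+ 2 / 2))).
    by rewrite ler_wpM2r ?ler_norm // divr_ge0 ?sqr_ge0.
  by rewrite ler_wpM2l // ler_wpM2r ?invr_ge0.
have s0 : 0 <= `|s| by []. have ss := sqr_ge0 s.
have sN : 0 <= `|s| * N by rewrite mulr_ge0.
have sN2 : 0 <= s ^+ 2 * N ^+ 2 by rewrite mulr_ge0 ?sqr_ge0.
have mul (a b : R) : 0 <= b -> `|a| <= b -> `|a * expR (s * (x ^+ 2 / 2))| <= b * expR (`|s| * (N ^+ 2 / 2)).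
  by move=> b0 ab; rewrite normrM (ger0_norm (expR_ge0 _)) ler_pM ?expR_ge0.
split.
- by rewrite -[X in `|X|]mul1r; apply: mul; [lra|rewrite normr1; lra].
- apply: mul; first lra.
  rewrite normrM; have := ler_wpM2l s0 xN; lra.
apply: mul; first lra.
apply: (le_trans (ler_normD _ _)); rewrite (ger0_norm (mulr_ge0 ss (sqr_ge0 x))).
have := ler_wpM2l ss x2; lra.
Qed.

Lemma expandable_Phi N : 0 <= N -> expandable N Phi (normal_pdf 0 1).
Proof.
move=> N0; have c0 := std_peak_gt0 R.
have dE (x : R) : normal_pdf 0 1 x = std_peak R * expR (-1 * (x ^+ 2 / 2)).
  by rewrite std_pdfE mulN1r.
have bE (x : R) : expR (-1 * (x ^+ 2 / 2)) <= 1.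
  by rewrite -[leRHS]expR0 ler_expR mulN1r oppr_le0 divr_ge0 ?sqr_ge0.
apply: (@expandable_derive2 R N Phi (normal_pdf 0 1) (fun w => std_peak R * (-1 * w * expR (-1 * (w ^+ 2 / 2))))
   (1 + std_peak R + std_peak R * N)).
- exact: is_derive_Phi.
- move=> x; have h := is_derive_gauss (-1) x.
  have -> : @normal_pdf R 0 1 = (fun w => std_peak R * expR (-1 * (w ^+ 2 / 2))) by apply/funext.
  by apply: is_derive_eq; rewrite /GRing.scale /=; ring.
have cN : 0 <= std_peak R * N by rewrite mulr_ge0 // ltW.
move=> x xN; split.
- rewrite ger0_norm ?Phi_ge0 //; have := Phi_le1 x; lra.
- rewrite dE normrM !ger0_norm ?expR_ge0 ?(ltW c0) //.
  have := ler_wpM2l (ltW c0) (bE x); lra.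
rewrite normrM (ger0_norm (ltW c0)) normrM (ger0_norm (expR_ge0 _)) mulN1r normrN.
have : `|x| * expR (-1 * (x ^+ 2 / 2)) <= N * 1 by rewrite ler_pM ?expR_ge0.
move/(ler_wpM2l (ltW c0)); lra.
Qed.

Definition stein_class (F : R) (f D : R -> R) :=
  forall w h, [/\ `|f w| <= F, `|D w| <= F & `|f (w + h) - f w - h * D w| <= F * h ^+ 2].

(** A step [|h| <= 1] from [|w| <= M + 1] stays in the window, and from farther out both ends lie
    where [f] and [D] vanish. For [|h| > 1] the three terms are at most [2 B + |h| B <= 3 B h^2]. *)
Lemma expandable_stein_class (M : R) (f D : R -> R) : 0 <= M -> expandable (M + 2) f D ->
  (forall w, M <= `|w| -> f w = 0 /\ D w = 0) -> exists F, stein_class F f D.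
Proof.
move=> M0 /expandableP[B B0 hf] vanish; exists (3 * B) => w h.
have bd z : `|f z| <= B /\ `|D z| <= B.
  case: (leP M `|z|) => [/vanish[-> ->]|zM]; first by rewrite normr0.
  by have [] := hf z z; rewrite // (ltW (lt_le_trans zM _)) //; lra.
have [f1 D1] := bd w; have [f2 _] := bd (w + h).
split; [by lra|by lra|].
have h2 : 0 <= h ^+ 2 by exact: sqr_ge0.
case: (leP `|h| 1) => h1; last first.
  have h11 : 1 <= h ^+ 2.
    by rewrite -[h ^+ 2]real_normK ?num_real // expr2; have := ltW h1; nra.
  have hh : `|h| <= h ^+ 2.
    by rewrite -[h ^+ 2]real_normK ?num_real // expr2 ler_peMl // ltW.
  apply: (@le_trans _ _ (B + B + `|h| * B)).
    apply: (le_trans (ler_normB _ _)); rewrite normrM lerD ?ler_wpM2l //.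
    by apply: (le_trans (ler_normB _ _)); rewrite lerD.
  have := ler_wpM2l B0 hh; have := ler_wpM2l B0 h11; lra.
have tri : `|w + h| <= `|w| + `|h| := ler_normD _ _.
case: (leP `|w| (M + 1)) => wM.
  have [||_ _ _] := hf w (w + h); [by lra|by lra|].
  rewrite [w + h - w]addrC addKr => e; apply: (le_trans e).
  by have := mulr_ge0 B0 h2; lra.
have wh : M <= `|w + h|.
  have : `|w| <= `|w + h| + `|h|.
    by have := ler_normB (w + h) h; rewrite addrK.
  lra.
have [|-> ->] := vanish w; first lra.
have [|-> _] := vanish (w + h) => //.
by rewrite subrr mulr0 subr0 normr0 mulr_ge0 // mulr_ge0.
Qed.

End SteinFunctions.

(** * Trapezoids in Phi(W) and convergence in distribution *)

Section Cuts.
Variable R : realType.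
Local Notation Phi := (std_normal_cdf R).
Implicit Types (L : seq (R * R)) (u w : R).

Definition ramps L u : R := \sum_(q <- L) q.1 * pos (u - q.2).

Lemma expandable_ramps N L : 0 <= N ->
  expandable N (fun w => \sum_(q <- L) q.1 * pos (Phi w - q.2) ^+ 2)
    (fun w => 2 * ramps L (Phi w) * normal_pdf 0 1 w).
Proof.
move=> N0; elim: L => [|q L IH].
  have := expandable_cst N (0 : R); congr (expandable _ _ _); apply/funext => w; rewrite /ramps big_nil //.
  by rewrite mulr0 mul0r.
have h1 : expandable N (fun w => Phi w + - q.2) (fun w => normal_pdf 0 1 w + 0).
  by apply: expandableD; [exact: expandable_Phi|exact: expandable_cst].
have := expandableD (expandableM (expandable_cst N q.1) (expandable_pos h1)) IH.
congr (expandable _ _ _); apply/funext => w; rewrite /ramps !big_cons // -/(ramps L _); ring.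
Qed.

(** Left of all cuts [A] vanishes; right of them it is a quadratic polynomial in [Phi w] whose
    coefficients are, up to constants, the three sums assumed to be 0. Hence [f] has compact support
    although the Gaussian factor is unbounded. *)
Lemma stein_of_cuts L (lo hi : R) : 0 < lo -> hi < 1 ->
  (forall q, q \in L -> lo <= q.2 <= hi) ->
  \sum_(q <- L) q.1 = 0 -> \sum_(q <- L) q.1 * q.2 = 0 -> \sum_(q <- L) q.1 * q.2 ^+ 2 = 0 ->
  exists F f D, stein_class F f D /\ forall w, D w - w * f w = ramps L (Phi w).
Proof.
move=> lo0 hi1 Lb S0 S1 S2.
have [|M M0 tails] := @Phi_tails R (Num.min lo (1 - hi)); first by rewrite lt_min lo0 subr_gt0.
have c0 := std_peak_gt0 R.
pose A w : R := \sum_(q <- L) q.1 * pos (Phi w - q.2) ^+ 2.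
(* The Gaussian factor cancels the density that appears in the derivative of [A], so [D w - w * f w]
   is exactly [ramps L (Phi w)]. *)
pose f w := (2 * std_peak R)^-1 * (expR (1 * (w ^+ 2 / 2)) * A w).
pose D w := 0 * (expR (1 * (w ^+ 2 / 2)) * A w) + (2 * std_peak R)^-1 *
   (1 * w * expR (1 * (w ^+ 2 / 2)) * A w +
    expR (1 * (w ^+ 2 / 2)) * (2 * ramps L (Phi w) * normal_pdf 0 1 w)).
have fD : expandable (M + 2) f D.
  apply: expandableM; first exact: expandable_cst.
  apply: expandableM; first exact: expandable_gauss.
  by apply: expandable_ramps; lra.
have DE w : D w - w * f w = ramps L (Phi w).
  rewrite /D /f std_pdfE mul0r add0r !mul1r expRN.
  have e0 := expR_gt0 (w ^+ 2 / 2); move: (expR _) e0 => e e0.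
  by field; rewrite !gt_eqF.
have van w : M <= `|w| -> A w = 0 /\ ramps L (Phi w) = 0.
  move=> wM; rewrite /A /ramps; case: (leP 0 w) => w0.
    move: wM; rewrite ger0_norm // => /tails[_]; rewrite lt_min => /andP[_ h].
    have pq q : q \in L -> pos (Phi w - q.2) = Phi w - q.2.
      move=> /Lb /andP[_ qh]; case: (posP (Phi w - q.2)) => [[_ ->]//|[h2 _]]; lra.
    split.
      rewrite (eq_big_seq (fun q : R * R => q.1 * Phi w ^+ 2 + (-2 * Phi w) * (q.1 * q.2) + q.1 * q.2 ^+ 2)).
        by rewrite !big_split /= -mulr_suml -mulr_sumr S0 S1 S2; ring.
      by move=> q qL; rewrite pq //; ring.
    rewrite (eq_big_seq (fun q : R * R => q.1 * Phi w - q.1 * q.2)); last by move=> q qL; rewrite pq //; ring.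
    by rewrite sumrB -mulr_suml S0 S1; ring.
  move: wM; rewrite ltr0_norm // => /tails[]; rewrite opprK lt_min => /andP[h _] _.
  have pq q : q \in L -> pos (Phi w - q.2) = 0.
    by move=> /Lb /andP[qh _]; case: (posP (Phi w - q.2)) => [[h2 _]|[_ ->]//]; lra.
  by split; rewrite big_seq big1 // => q qL; rewrite pq // ?expr0n /= mulr0.
have [|F hF] := expandable_stein_class (ltW M0) fD.
  move=> w /van[A0 r0]; have e := DE w.
  have f0 : f w = 0 by rewrite /f A0 !mulr0.
  by split=> //; move: e; rewrite f0 r0 mulr0 subr0.
by exists F, f, D.
Qed.

Definition trapezoid (d a b : R) : seq (R * R) :=
  [:: (d^-1, a); (- d^-1, a + d); (- d^-1, b - d); (d^-1, b)].

Lemma trapezoidE (d a b u : R) : 0 < d -> a + 2 * d <= b ->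
  [/\ 0 <= ramps (trapezoid d a b) u <= 1,
      ramps (trapezoid d a b) u != 0 -> a < u < b
    & a + d <= u <= b - d -> ramps (trapezoid d a b) u = 1].
Proof.
move=> d0 ab; rewrite /ramps /trapezoid !big_cons big_nil /=.
have di : 0 < d^-1 by rewrite invr_gt0.
have -> : d^-1 * pos (u - a) + (- d^-1 * pos (u - (a + d)) + (- d^-1 * pos (u - (b - d)) +
   (d^-1 * pos (u - b) + 0))) = (pos (u - a) - pos (u - (a + d)) - pos (u - (b - d)) + pos (u - b)) / d.
  by rewrite mulrC; ring.
rewrite ler_pdivlMr // ler_pdivrMr // mul0r mul1r mulf_eq0 invr_eq0 (gt_eqF d0) orbF.
have posL (x : R) : x <= 0 -> pos x = 0 by case: (posP x) => [[h ->]|[_ ->]] // h'; lra.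
have posR (x : R) : 0 <= x -> pos x = x by case: (posP x) => [[_ ->]|[h ->]] // h'; lra.
split.
- by apply/andP; split; case: (posP (u - a)) => [[h1 ->]|[h1 ->]];
    case: (posP (u - (a + d))) => [[h2 ->]|[h2 ->]];
    case: (posP (u - (b - d))) => [[h3 ->]|[h3 ->]]; case: (posP (u - b)) => [[h4 ->]|[h4 ->]]; lra.
- apply: contraR; rewrite negb_and -!leNgt => /orP[h|h].
    by rewrite !posL; lra.
  by rewrite !posR; lra.
move=> /andP[h1 h2]; apply: (canLR (mulfK _)); first by rewrite gt_eqF.
by rewrite (posR (u - a)) ?(posR (u - (a + d))) ?(posL (u - b)) ?(posL (u - (b - d))); lra.
Qed.

(** The first two sums required by [stein_of_cuts] vanish for every trapezoid, and the third is
    twice its area [b - a - d]. Subtracting the multiple of the wide trapezoid with the same area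
    makes all three vanish. *)
Lemma trapezoid_stein (al d a b : R) : 0 < al -> 0 < d -> al <= a -> a + 2 * d <= b -> b <= 1 - al ->
  exists F f D, stein_class F f D /\ forall w, D w - w * f w =
    ramps (trapezoid d a b) (Phi w)
    - (b - a - d) / (1 - 2 * al - d) * ramps (trapezoid d al (1 - al)) (Phi w).
Proof.
move=> al0 d0 ala ab b1; set lam := _ / _.
have l0 : 1 - 2 * al - d != 0 by rewrite gt_eqF //; lra.
pose L := trapezoid d a b ++ [seq (- lam * q.1, q.2) | q <- trapezoid d al (1 - al)].
have [||q||||F [f [D [h1 h2]]]] := @stein_of_cuts L al (1 - al).
- by [].
- by lra.
- rewrite /L /trapezoid /= !inE.
  by do ?[case/orP]; move/eqP => -> /=; apply/andP; split; lra.
- by rewrite /L /trapezoid /= !big_cons big_nil /=; ring.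
- by rewrite /L /trapezoid /= !big_cons big_nil /= /lam; field; rewrite l0 gt_eqF.
- by rewrite /L /trapezoid /= !big_cons big_nil /= /lam; field; rewrite l0 gt_eqF.
exists F, f, D; split=> // w; rewrite h2 /L /ramps big_cat big_map -[X in _ = _ + X]mulNr [X in _ = _ + X]mulr_sumr.
by congr (_ + _); apply: eq_bigr => q _; rewrite mulrA.
Qed.

Section Approximation.
Variables (T : finType) (mu W : T -> R).
Implicit Types (F del : R).

Definition stein_close F del (mu W : T -> R) := forall f D, stein_class F f D ->
  `|Ex mu (fun x => W x * f (W x)) - Ex mu (fun x => D (W x))| <= del.

End Approximation.

(** Stein closeness compares the trapezoid with [lam] times the wide one, and by Chebyshev the wide
    one equals 1 with probability at least [1 - M^-2]. *)
Lemma trapezoid_mass (M d a b : R) : 0 < M -> 0 < d ->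
  let m := Num.min (Phi (- M)) (1 - Phi M) in d <= m / 2 -> d <= a -> a + 2 * d <= b -> b <= 1 - d ->
  exists F, forall (T : finType) (mu W : T -> R) del, is_pmf mu -> Ex mu (fun x => W x ^+ 2) <= 1 ->
    stein_close F del mu W ->
    b - a - d - M^-2 - del <= Ex mu (fun x => ramps (trapezoid d a b) (Phi (W x))).
Proof.
move=> M0 d0 m dm da ab b1.
have [F [f [D [hf hD]]]] := trapezoid_stein d0 d0 da ab b1.
exists F => T mu W del pm W2 /(_ f D hf) close.
set lam := (b - a - d) / (1 - 2 * d - d) in hD.
pose full x := ramps (trapezoid d d (1 - d)) (Phi (W x)).
have EB : Ex mu (fun x => D (W x)) - Ex mu (fun x => W x * f (W x)) =
   Ex mu (fun x => ramps (trapezoid d a b) (Phi (W x))) - lam * Ex mu full.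
  by rewrite -ExB -ExZ -ExB; apply: eq_Ex => x; rewrite hD.
have [m1 m2] : m <= Phi (- M) /\ m <= 1 - Phi M by rewrite /m !ge_min !lexx orbT.
have fullE u := trapezoidE u d0 (_ : d + 2 * d <= 1 - d).
have h1 : d + 2 * d <= 1 - d by lra.
have fulllow : 1 - M^-2 <= Ex mu full.
  have -> : 1 - M^-2 = 1 - 1 * M^-2 by rewrite mul1r.
  apply: (@le_trans _ _ (1 - Ex mu (fun x => W x ^+ 2) * M^-2)).
    by rewrite lerD2l lerN2 ler_wpM2r // invr_ge0 exprn_ge0 // ltW.
  rewrite -(Ex_cst 1 pm) -ExZr -ExB; apply: ler_Ex => // x _.
  have [/andP[t0 _] _ t1] := trapezoidE (Phi (W x)) d0 h1.
  have M2 : 0 < M ^+ 2 by rewrite exprn_gt0.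
  case: (leP `|W x| M) => WM.
    rewrite /full t1; first by rewrite gerBl divr_ge0 ?sqr_ge0 // ltW.
    have mono y z : y <= z -> Phi y <= Phi z.
      by rewrite le_eqVlt => /orP[/eqP ->//|/Phi_lt/ltW].
    move: WM; rewrite ler_norml => /andP[/mono w1 /mono w2]; apply/andP; split; lra.
  apply: (le_trans _ t0); rewrite subr_le0 ler_pdivlMr // mul1r -[W x ^+ 2]real_normK ?num_real //.
  by rewrite ler_sqr ?nnegrE ?(ltW M0) // ltW.
have l0 : 0 < 1 - 2 * d - d by lra.
have lam0 : 0 <= lam by rewrite divr_ge0 ?(ltW l0) //; lra.
have lam1 : lam <= 1 by rewrite /lam ler_pdivrMr // mul1r; lra.
have lamg : b - a - d <= lam.
  by rewrite /lam ler_pdivlMr // ler_piMr; lra.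
have Mi : 0 <= M^-2 by rewrite invr_ge0 exprn_ge0 // ltW.
move: close; rewrite distrC EB ler_norml => /andP[c1 _].
have := ler_wpM2l lam0 fulllow; have := ler_wpM2r Mi lam1; lra.
Qed.

(** Lower bounds suffice: a trapezoid left of [Phi t] bounds the distribution function from below,
    one right of [Phi t] bounds its complement from below. *)
Lemma normal_approximation (t eps : R) : 0 < eps -> exists F del, 0 < del /\ forall (T : finType) (mu W : T -> R), is_pmf mu -> Ex mu (fun x => W x ^+ 2) <= 1 ->
    stein_close F del mu W ->
    `|Ex mu (fun x => ((W x <= t)%R)%:R) - Phi t| <= eps.
Proof.
move=> eps0.
have P0 : 0 < Phi t by apply: (le_lt_trans (Phi_ge0 _) (Phi_lt (_ : t - 1 < t))); lra.
have P1 : Phi t < 1 by apply: (lt_le_trans (Phi_lt (_ : t < t + 1)) (Phi_le1 _)); lra.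
(* A quarter of [eps] each goes to Chebyshev ([M^-2]), to the Stein error and to the margins [2 d].
   The minimum [m] below puts the image of [[-M, M]] on the plateau of the wide trapezoid. *)
pose M : R := 1 + 4 / eps.
have M0 : 0 < M by rewrite addr_gt0 // divr_gt0.
have Me : M^-2 <= eps / 4.
  have e1 : 4 / eps <= M by rewrite /M; lra.
  have M1 : 1 <= M by rewrite /M lerDl divr_ge0 // ltW.
  apply: (@le_trans _ _ M^-1).
    by rewrite lef_pV2 ?posrE ?exprn_gt0 // expr2 ler_peMl // ltW.
  by rewrite -invf_div lef_pV2 ?posrE ?divr_gt0.
pose m := Num.min (Phi (- M)) (1 - Phi M).
have m0 : 0 < m.
  rewrite lt_min subr_gt0; apply/andP; split.
    by apply: (le_lt_trans (Phi_ge0 _) (Phi_lt (_ : - M - 1 < - M))); lra.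
  by apply: (lt_le_trans (Phi_lt (_ : M < M + 1)) (Phi_le1 _)); lra.
pose d := Num.min (m / 2) (Num.min (Num.min (Phi t / 3) ((1 - Phi t) / 3)) (eps / 8)).
have d0 : 0 < d by rewrite !lt_min !divr_gt0 // subr_gt0.
have [dm dt dt' de] : [/\ d <= m / 2, d <= Phi t / 3, d <= (1 - Phi t) / 3 & d <= eps / 8].
  by rewrite /d !ge_min !lexx ?orbT.
have [||||F1 h1] := @trapezoid_mass M d d (Phi t) M0 d0; rewrite -/m //; try lra.
have [||||F2 h2] := @trapezoid_mass M d (Phi t) (1 - d) M0 d0; rewrite -/m //; try lra.
exists (Num.max F1 F2), (eps / 4); split; first by rewrite divr_gt0.
move=> T mu W pm W2 close.
have mon F : F <= Num.max F1 F2 -> stein_close F (eps / 4) mu W.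
  move=> FF f D hf; apply: close => w h; have [a1 a2 a3] := hf w h; split.
  - exact: le_trans FF.
  - exact: le_trans FF.
  - by apply: le_trans a3 _; rewrite ler_wpM2r ?sqr_ge0.
have {}h1 := h1 T mu W _ pm W2 (mon F1 _); have {}h2 := h2 T mu W _ pm W2 (mon F2 _).
rewrite !le_max !lexx ?orbT in h1 h2; have {}h1 := h1 isT; have {}h2 := h2 isT.
have mono y z : Phi y < Phi z -> y < z.
  by case: (ltP y z) => //; rewrite le_eqVlt => /orP[/eqP ->|/Phi_lt h]; lra.
have lowP : Ex mu (fun x => ramps (trapezoid d d (Phi t)) (Phi (W x))) <= Ex mu (fun x => ((W x <= t)%R)%:R).
  apply: ler_Ex => // x _.
  have [|/andP[t0 t1] t2 _] := @trapezoidE d d (Phi t) (Phi (W x)) d0; first lra.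
  case: (leP (W x) t) => //= Wt; case: (eqVneq (ramps (trapezoid d d (Phi t)) (Phi (W x))) 0) => [->//|/t2 /andP[_ /mono]]; lra.
have uppP : Ex mu (fun x => ramps (trapezoid d (Phi t) (1 - d)) (Phi (W x))) <= 1 - Ex mu (fun x => ((W x <= t)%R)%:R).
  rewrite -[X in _ <= X - _](Ex_cst 1 pm) -ExB; apply: ler_Ex => // x _.
  have [|/andP[t0 t1] t2 _] := @trapezoidE d (Phi t) (1 - d) (Phi (W x)) d0; first lra.
  case: (leP (W x) t) => /= Wt; last by rewrite subr0.
  rewrite subrr; case: (eqVneq (ramps (trapezoid d (Phi t) (1 - d)) (Phi (W x))) 0) => [->//|/t2 /andP[/mono ? _]]; lra.
rewrite ler_norml; apply/andP; split; lra.
Qed.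

End Cuts.

(** * Exchangeable pairs *)

Lemma Ex_norm_le_sqrt (R : realType) (T : finType) (mu Z : T -> R) (b : R) : is_pmf mu -> 0 <= b ->
  Ex mu (fun x => Z x ^+ 2) <= b ^+ 2 -> Ex mu (fun x => `|Z x|) <= b.
Proof.
move=> pm b0 h; rewrite -ler_sqr ?nnegrE //; last by apply: Ex_ge0.
apply: (le_trans (Ex_sqr_le _ pm)); apply: le_trans h; rewrite le_eqVlt; apply/orP; left; apply/eqP.
by apply: eq_Ex => x; rewrite real_normK ?num_real.
Qed.

Section Exchange.
Variables (R : realType) (T : finType) (mu : T -> R).
Hypothesis pm : is_pmf mu.
Variables (m : nat) (J : finType) (X : 'I_m -> T -> R) (X' : J -> T -> R).
Hypothesis J0 : (0 < #|J|)%N.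
Hypothesis X01 : forall i x, 0 <= X i x <= 1 /\ X i x ^+ 2 = X i x.
Hypothesis X'01 : forall j x, 0 <= X' j x <= 1 /\ X' j x ^+ 2 = X' j x.
Hypothesis swap : forall i j, exists f : T -> T, [/\ involutive f, forall x, mu (f x) = mu x,
  forall x, X i (f x) = X' j x, forall x, X' j (f x) = X i x
  & forall k x, k != i -> X k (f x) = X k x].
Variables (p b : R).
Hypothesis b0 : 0 <= b.
Hypothesis p01 : 0 <= p <= 1.

Definition pool_mean (x : T) : R := av (fun j => X' j x).
Definition pool_prob : R := Ex mu pool_mean.
Definition total (x : T) : R := \sum_i X i x.
Definition total_var : R := Ex mu (fun x => (total x - m%:R * pool_prob) ^+ 2).
Local Notation q := pool_prob.
Local Notation Theta := pool_mean.

Hypothesis pool_close : Ex mu (fun x => (Theta x - p) ^+ 2) <= b ^+ 2.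
Hypothesis pair_close : forall i k, i != k -> `|Ex mu (fun x => (X i x - p) * (X k x - p))| <= b ^+ 2.

Lemma Ex_involution (f : T -> T) (F : T -> R) : involutive f -> (forall x, mu (f x) = mu x) ->
  Ex mu (fun x => F (f x)) = Ex mu F.
Proof.
move=> fK mf; rewrite /Ex [RHS](reindex_inj (inv_inj fK)) /=.
by apply: eq_bigr => x _; rewrite mf.
Qed.

Lemma Ex_member i : Ex mu (X i) = q.
Proof.
rewrite /pool_prob /pool_mean Ex_av -[LHS](av_cst J0); apply: eq_av => j.
have [f [fK mf fX _ _]] := swap i j.
by rewrite -(Ex_involution (X i) fK mf); apply: eq_Ex.
Qed.

Lemma Ex_total : Ex mu total = m%:R * q.
Proof.
rewrite /total Ex_sum (eq_bigr (fun=> q)); last by move=> i _; exact: Ex_member.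
by rewrite sumr_const card_ord mulr_natl.
Qed.

Lemma pool_mean01 x : 0 <= Theta x <= 1.
Proof.
apply/andP; split; first by apply: av_ge0 => // j; have [/andP[]] := X'01 j x.
by rewrite -[leRHS](av_cst J0); apply: ler_av => // j; have [/andP[]] := X'01 j x.
Qed.

Lemma pool_prob01 : 0 <= q <= 1.
Proof.
apply/andP; split; first by apply: Ex_ge0 => // x; have /andP[] := pool_mean01 x.
by rewrite -[leRHS](Ex_cst 1 pm); apply: ler_Ex => // x _; have /andP[] := pool_mean01 x.
Qed.

Lemma pool_prob_close : (q - p) ^+ 2 <= b ^+ 2.
Proof.
apply: le_trans pool_close; rewrite -[in leLHS](Ex_cst p pm) -ExB; exact: Ex_sqr_le.
Qed.

Lemma pool_noise : Ex mu (fun x => `|Theta x - q|) <= b.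
Proof.
apply: Ex_norm_le_sqrt => //; apply: le_trans pool_close.
rewrite (eq_Ex (g := fun x => (Theta x - p) ^+ 2 + (-2 * (q - p)) * (Theta x - p) + (q - p) ^+ 2)).
  rewrite !ExD ExZ ExD !Ex_cst // -/q -addrA gerDl.
  by have := sqr_ge0 (q - p); lra.
by move=> x; ring.
Qed.

(** Indicators are idempotent, so the diagonal terms are exactly [q (1 - q)]. Each of the at most
    [m^2] others is a correlation about [p] minus [(q - p)^2], both bounded by [b ^+ 2]. *)
Lemma total_var_close : `|total_var - m%:R * (q * (1 - q))| <= 2 * m%:R ^+ 2 * b ^+ 2.
Proof.
have -> : total_var = \sum_i \sum_k Ex mu (fun x => (X i x - q) * (X k x - q)).
  rewrite /total_var (eq_Ex (g := fun x => \sum_i \sum_k (X i x - q) * (X k x - q))).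
    by rewrite Ex_sum; apply: eq_bigr => i _; rewrite Ex_sum.
  move=> x; rewrite /total.
  have -> : \sum_i X i x - m%:R * q = \sum_i (X i x - q).
    by rewrite sumrB sumr_const card_ord -[q *+ m]mulr_natl.
  by rewrite expr2 mulr_suml; apply: eq_bigr => i _; rewrite mulr_sumr.
have -> : m%:R * (q * (1 - q)) = \sum_(i < m) q * (1 - q).
  by rewrite sumr_const card_ord mulr_natl.
rewrite -sumrB; apply: (le_trans (ler_norm_sum _ _ _)).
have b2 : 0 <= 2 * b ^+ 2 by rewrite mulr_ge0 ?sqr_ge0.
apply: (@le_trans _ _ (\sum_(i < m) m%:R * (2 * b ^+ 2))); last first.
  by rewrite sumr_const card_ord -mulr_natl expr2; lra.
apply: ler_sum => i _; rewrite (bigD1 i) //=.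
have -> : Ex mu (fun x => (X i x - q) * (X i x - q)) = q * (1 - q).
  rewrite (eq_Ex (g := fun x => (1 - 2 * q) * X i x + q ^+ 2)).
    by rewrite ExD ExZ Ex_cst // Ex_member; ring.
  move=> x; have [_ h] := X01 i x.
  have -> : (X i x - q) * (X i x - q) = X i x ^+ 2 - 2 * q * X i x + q ^+ 2 by ring.
  by rewrite h; ring.
rewrite [X in `|X|](_ : _ = \sum_(k | k != i) Ex mu (fun x => (X i x - q) * (X k x - q))); last by ring.
apply: (le_trans (ler_norm_sum _ _ _)).
apply: (@le_trans _ _ (\sum_(k < m) 2 * b ^+ 2)); last by rewrite sumr_const card_ord [leRHS]mulr_natl.
rewrite [leLHS]big_mkcond; apply: ler_sum => k _; case: ifP => // ki.
have -> : Ex mu (fun x => (X i x - q) * (X k x - q)) =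
  Ex mu (fun x => (X i x - p) * (X k x - p)) - (q - p) ^+ 2.
  rewrite (eq_Ex (f := fun x => (X i x - q) * (X k x - q))
     (g := fun x => (X i x - p) * (X k x - p) + (- (q - p)) * X i x + (- (q - p)) * X k x
       + (q ^+ 2 - p ^+ 2))); last by move=> x; ring.
  by rewrite 3!ExD !ExZ !Ex_member Ex_cst //; ring.
apply: (le_trans (ler_normB _ _)); rewrite (ger0_norm (sqr_ge0 _)).
have := pool_prob_close; have := @pair_close i k; rewrite eq_sym ki => /(_ isT); lra.
Qed.

Variables (s F : R) (f D : R -> R).
Hypothesis s0 : 0 < s.
Hypothesis sV : s ^+ 2 = total_var.
Hypothesis fD : stein_class F f D.

Definition standardized (x : T) : R := (total x - m%:R * q) / s.
Local Notation W := standardized.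

Let F0 : 0 <= F. Proof. by have [h _ _] := fD 0 0; exact: le_trans h. Qed.

(** The swap makes [W] and [W + h] an exchangeable pair. Antisymmetrising gives half the mean of
    [(X - X') (f W - f (W + h))], and expanding [f] at [W] produces the second term with an error
    [F h^2]. *)
Lemma swap_expansion i j :
  `|Ex mu (fun x => (X i x - X' j x) * f (W x)) - (2 * s)^-1 * Ex mu (fun x => (X i x - X' j x) ^+ 2 * D (W x))|
    <= F / (2 * s ^+ 2).
Proof.
have [g [gK mg gX gX' gk]] := swap i j.
pose h x := (X' j x - X i x) / s.
have Wg x : W (g x) = W x + h x.
  rewrite /standardized /h -mulrDl; congr (_ / _); rewrite /total (bigD1 i) //= gX.
  rewrite [in RHS](bigD1 i) //= (eq_bigr (fun k => X k x)); last by move=> k ki; rewrite gk.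
  by ring.
pose r x := f (W x + h x) - f (W x) - h x * D (W x).
have e1 : Ex mu (fun x => (X i x - X' j x) * f (W x)) =
    Ex mu (fun x => (X' j x - X i x) * f (W x + h x)).
  rewrite -(Ex_involution (fun x => (X i x - X' j x) * f (W x)) gK mg).
  by apply: eq_Ex => x; rewrite gX gX' Wg.
have -> : Ex mu (fun x => (X i x - X' j x) * f (W x)) - (2 * s)^-1 * Ex mu (fun x => (X i x - X' j x) ^+ 2 * D (W x))
   = Ex mu (fun x => 2^-1 * ((X' j x - X i x) * r x)).
  have -> : Ex mu (fun x => (X i x - X' j x) * f (W x)) =
     2^-1 * (Ex mu (fun x => (X i x - X' j x) * f (W x)) + Ex mu (fun x => (X' j x - X i x) * f (W x + h x))).
    by rewrite -e1; field.
  rewrite -ExD -!ExZ -ExB; apply: eq_Ex => x; rewrite /r /h; field.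
  by rewrite gt_eqF.
have cst : Ex mu (fun=> F / (2 * s ^+ 2)) = F / (2 * s ^+ 2) := Ex_cst _ pm.
apply: (le_trans (ler_norm_Ex _ pm)); rewrite -cst; apply: ler_Ex => // x _.
have [_ _ hr] := fD (W x) (h x); rewrite -/(r x) in hr.
have [/andP[a0 a1] a2] := X01 i x; have [/andP[c0 c1] c2] := X'01 j x.
have d1 : `|X' j x - X i x| <= 1 by rewrite ler_norml; apply/andP; split; lra.
have h2 : h x ^+ 2 <= s^-2.
  rewrite /h exprMn exprVn ler_piMl // ?invr_ge0 ?exprn_ge0 ?(ltW s0) //.
  by rewrite -[leLHS]real_normK ?num_real // exprn_ile1.
rewrite normrM ger0_norm // normrM invfM [leRHS]mulrCA ler_wpM2l //.
apply: (@le_trans _ _ `|r x|); first by rewrite ler_piMl.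
by apply: (le_trans hr); rewrite ler_wpM2l.
Qed.

(** Idempotence turns [(X - X')^2] into [X + X' - 2 X X'], so after summing over [i] and averaging
    over [j] only [total] and the pool mean remain. *)
Lemma pool_expansion :
  `|Ex mu (fun x => (total x - m%:R * Theta x) * f (W x))
    - (2 * s)^-1 * Ex mu (fun x => (total x + m%:R * Theta x - 2 * total x * Theta x) * D (W x))|
    <= m%:R * (F / (2 * s ^+ 2)).
Proof.
have e1 : Ex mu (fun x => (total x - m%:R * Theta x) * f (W x)) =
   \sum_i av (fun j => Ex mu (fun x => (X i x - X' j x) * f (W x))).
  rewrite (eq_Ex (g := fun x => \sum_i av (fun j => (X i x - X' j x) * f (W x)))).
    by rewrite Ex_sum; apply: eq_bigr => i _; rewrite Ex_av.
  move=> x; rewrite /total /pool_mean mulr_natl -[X in _ - _ *+ X](card_ord m) -sumr_const -sumrB mulr_suml.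
  apply: eq_bigr => i _; rewrite -{1}(av_cst J0 (X i x)) -avB -avZr; exact: eq_av.
have e2 : Ex mu (fun x => (total x + m%:R * Theta x - 2 * total x * Theta x) * D (W x)) =
   \sum_i av (fun j => Ex mu (fun x => (X i x - X' j x) ^+ 2 * D (W x))).
  rewrite (eq_Ex (g := fun x => \sum_i av (fun j => (X i x - X' j x) ^+ 2 * D (W x)))).
    by rewrite Ex_sum; apply: eq_bigr => i _; rewrite Ex_av.
  move=> x; transitivity ((\sum_i (X i x + Theta x - 2 * X i x * Theta x)) * D (W x)).
    congr (_ * _); rewrite sumrB big_split /= sumr_const card_ord.
    by rewrite /total -mulr_suml -mulr_sumr [m%:R * _]mulr_natl.
  rewrite mulr_suml; apply: eq_bigr => i _; rewrite avZr; congr (_ * _).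
  rewrite /pool_mean -[X in X + _ - _](av_cst J0) -avD -avZ -avB; apply: eq_av => j.
  have [_ h1] := X01 i x; have [_ h2] := X'01 j x.
  have -> : (X i x - X' j x) ^+ 2 = X i x ^+ 2 + X' j x ^+ 2 - 2 * X i x * X' j x by ring.
  by rewrite h1 h2.
rewrite e1 e2 mulr_sumr -sumrB; apply: (le_trans (ler_norm_sum _ _ _)).
have -> : m%:R * (F / (2 * s ^+ 2)) = \sum_(i < m) F / (2 * s ^+ 2) by rewrite sumr_const card_ord mulr_natl.
apply: ler_sum => i _; rewrite -avZ -avB; apply: av_norm_le => // j; exact: swap_expansion.
Qed.

Lemma Ex_bound_mul (Z G : T -> R) (c : R) : (forall x, `|G x| <= F) -> Ex mu (fun x => `|Z x|) <= c ->
  `|Ex mu (fun x => Z x * G x)| <= F * c.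
Proof.
move=> GF Zc; apply: (le_trans (ler_norm_Ex _ pm)).
apply: (@le_trans _ _ (Ex mu (fun x => F * `|Z x|))); last by rewrite ExZ ler_wpM2l.
by apply: ler_Ex => // x _; rewrite normrM mulrC ler_wpM2r.
Qed.

Lemma total_norm : Ex mu (fun x => `|total x - m%:R * q|) <= s.
Proof. by apply: Ex_norm_le_sqrt => //; rewrite ?(ltW s0) ?sV. Qed.

Lemma standardized_sqr : Ex mu (fun x => W x ^+ 2) = 1.
Proof.
rewrite (eq_Ex (g := fun x => (total x - m%:R * q) ^+ 2 * s^-2)).
  by rewrite ExZr -/total_var -sV divff // expf_eq0 /= gt_eqF.
by move=> x; rewrite /standardized exprMn exprVn.
Qed.

(** The pool mean is replaced by its expectation [q] at cost [b], both in the linear and in the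
    quadratic term; the latter becomes [2 m q (1 - q)] once [total] is replaced by its mean, at cost
    [s]. *)
Lemma standardized_stein :
  `|Ex mu (fun x => W x * f (W x)) - m%:R * (q * (1 - q)) / s ^+ 2 * Ex mu (fun x => D (W x))|
    <= F * ((2 * s)^-1 + m%:R * b / (2 * s ^+ 2) + m%:R / (2 * s ^+ 3) + m%:R * b / s).
Proof.
have fF x : `|f (W x)| <= F by have [] := fD (W x) 0.
have DF x : `|D (W x)| <= F by have [] := fD (W x) 0.
pose A := Ex mu (fun x => (total x - m%:R * Theta x) * f (W x)).
pose B := Ex mu (fun x => (Theta x - q) * f (W x)).
pose Q := Ex mu (fun x => (total x + m%:R * Theta x - 2 * total x * Theta x) * D (W x)).
pose ED := Ex mu (fun x => D (W x)).
have hA : `|A - (2 * s)^-1 * Q| <= m%:R * (F / (2 * s ^+ 2)) := pool_expansion.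
have hB : `|B| <= F * b := Ex_bound_mul fF pool_noise.
have m0 : 0 <= m%:R :> R by [].
have /andP[q0 q1] := pool_prob01.
have hQ : `|Q - 2 * (m%:R * (q * (1 - q))) * ED| <= F * (s + m%:R * b).
  have -> : Q - 2 * (m%:R * (q * (1 - q))) * ED = Ex mu (fun x =>
     ((total x - m%:R * q) * (1 - 2 * Theta x) + m%:R * ((Theta x - q) * (1 - 2 * q))) * D (W x)).
    by rewrite /Q /ED -ExZ -ExB; apply: eq_Ex => x; ring.
  apply: Ex_bound_mul => //.
  apply: (@le_trans _ _ (Ex mu (fun x => `|total x - m%:R * q| + m%:R * `|Theta x - q|))).
    apply: ler_Ex => // x _; apply: (le_trans (ler_normD _ _)).
    have /andP[t0 t1] := pool_mean01 x.
    rewrite !normrM (ger0_norm m0) lerD //.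
      by rewrite ler_piMr // ler_norml; apply/andP; split; lra.
    by rewrite ler_wpM2l // ler_piMr // ler_norml; apply/andP; split; lra.
  by rewrite ExD ExZ lerD ?total_norm // ler_wpM2l // pool_noise.
have -> : Ex mu (fun x => W x * f (W x)) = s^-1 * (A + m%:R * B).
  rewrite /A /B -!ExZ -ExD -ExZ; apply: eq_Ex => x; rewrite {1}/standardized; ring.
rewrite -/ED.
have -> : s^-1 * (A + m%:R * B) - m%:R * (q * (1 - q)) / s ^+ 2 * ED =
  s^-1 * ((A - (2 * s)^-1 * Q) + m%:R * B + (2 * s)^-1 * (Q - 2 * (m%:R * (q * (1 - q))) * ED)).
  by field; rewrite gt_eqF.
have i0 : 0 <= s^-1 by rewrite invr_ge0 ltW.
have i20 : 0 <= (2 * s)^-1 by rewrite invr_ge0 mulr_ge0 // ltW.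
rewrite normrM (ger0_norm i0).
have -> : F * ((2 * s)^-1 + m%:R * b / (2 * s ^+ 2) + m%:R / (2 * s ^+ 3) + m%:R * b / s) =
  s^-1 * (m%:R * (F / (2 * s ^+ 2)) + m%:R * (F * b) + (2 * s)^-1 * (F * (s + m%:R * b))).
  by field; rewrite gt_eqF.
rewrite ler_wpM2l //; apply: (le_trans (ler_normD _ _)); rewrite lerD //.
  by apply: (le_trans (ler_normD _ _)); rewrite lerD // normrM (ger0_norm m0) ler_wpM2l.
by rewrite normrM (ger0_norm i20) ler_wpM2l.
Qed.

End Exchange.

Section ExchangeLimit.
Variables (R : realType) (T : finType) (mu : T -> R).
Hypothesis pm : is_pmf mu.
Variables (m : nat) (J : finType) (X : 'I_m -> T -> R) (X' : J -> T -> R).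
Hypothesis J0 : (0 < #|J|)%N.
Hypothesis X01 : forall i x, 0 <= X i x <= 1 /\ X i x ^+ 2 = X i x.
Hypothesis X'01 : forall j x, 0 <= X' j x <= 1 /\ X' j x ^+ 2 = X' j x.
Hypothesis swap : forall i j, exists f : T -> T, [/\ involutive f, forall x, mu (f x) = mu x,
  forall x, X i (f x) = X' j x, forall x, X' j (f x) = X i x
  & forall k x, k != i -> X k (f x) = X k x].
Variables (p b g : R).
Hypothesis b0 : 0 <= b.
Hypothesis p01 : 0 <= p <= 1.
Hypothesis pool_close : Ex mu (fun x => (pool_mean X' x - p) ^+ 2) <= b ^+ 2.
Hypothesis pair_close : forall i k, i != k -> `|Ex mu (fun x => (X i x - p) * (X k x - p))| <= b ^+ 2.
Hypothesis g0 : 0 <= g.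
Hypothesis m0 : (0 < m)%N.
Hypothesis bg : m%:R * b ^+ 2 <= g ^+ 2.
Hypothesis mg : 1 <= g ^+ 2 * m%:R.
Hypothesis gp : g + 2 * g ^+ 2 <= p * (1 - p) / 2.
Variable r : R.
Hypothesis r0 : 0 < r.
Hypothesis rp : r ^+ 2 = p * (1 - p) / 2.
Local Notation q := (pool_prob mu X').
Local Notation V := (total_var mu X X').

Let M0 : 0 < m%:R :> R. Proof. by rewrite ltr0n. Qed.

Lemma total_var_lower : r ^+ 2 * m%:R <= V.
Proof.
have vc := total_var_close pm J0 X01 swap pool_close pair_close.
have qc := pool_prob_close pm pool_close.
have bg' : b <= g.
  rewrite -ler_sqr ?nnegrE //; apply: le_trans bg; rewrite ler_peMl ?sqr_ge0 //.
  by rewrite ler1n.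
have qp : `|q - p| <= b.
  by rewrite -ler_sqr ?nnegrE // real_normK ?num_real.
have /andP[q0 q1] := pool_prob01 pm J0 X'01.
have /andP[p0 p1] := p01.
have h1 : p * (1 - p) - b <= q * (1 - q).
  have -> : q * (1 - q) = p * (1 - p) + (q - p) * (1 - p - q) by ring.
  rewrite lerD2l; have : `|(q - p) * (1 - p - q)| <= b.
    by rewrite normrM; apply: le_trans qp; rewrite ler_piMr // ler_norml; apply/andP; split; lra.
  by rewrite ler_norml => /andP[].
have h2 : m%:R * (p * (1 - p) - b) <= m%:R * (q * (1 - q)) by rewrite ler_wpM2l // ltW.
have h3 : m%:R * (m%:R * b ^+ 2) <= m%:R * g ^+ 2 by rewrite ler_wpM2l // ltW.
have h4 : m%:R * (g + 2 * g ^+ 2) <= m%:R * (p * (1 - p) / 2) by rewrite ler_wpM2l // ltW.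
have h5 : m%:R * b <= m%:R * g by rewrite ler_wpM2l // ltW.
move: vc; rewrite ler_norml => /andP[vc _]; rewrite rp.
by move: h3 vc; rewrite expr2; lra.
Qed.

(** [g] dominates both [m^(-1/2)] and [m^(1/2) b], and [s >= r m^(1/2)]; each error of
    [standardized_stein] is then [g] times a power of [1 / r]. Replacing [m q (1 - q) / s^2] by 1
    adds [2 g / r^2]. *)
Lemma exchangeable_stein (F : R) :
  stein_close F (F * (g * (3 / (2 * r) + 5 / (2 * r ^+ 2) + (2 * r ^+ 3)^-1)))
    mu (standardized mu X X' (Num.sqrt V)).
Proof.
move=> f D fD; set s := Num.sqrt V; set W := standardized _ _ _ _.
have V0 : 0 < V by apply: lt_le_trans total_var_lower; rewrite mulr_gt0 // exprn_gt0.
have s0 : 0 < s by rewrite sqrtr_gt0.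
have sV : s ^+ 2 = V by rewrite sqr_sqrtr // ltW.
have F0 : 0 <= F by have [h _ _] := fD 0 0; exact: le_trans h.
have main := standardized_stein pm J0 X01 X'01 swap b0 pool_close s0 sV fD.
have vc := total_var_close pm J0 X01 swap pool_close pair_close.
pose a : R := Num.sqrt m%:R.
have a0 : 0 < a by rewrite sqrtr_gt0.
have aa : m%:R = a ^+ 2 by rewrite sqr_sqrtr // ltW.
have ab : a * b <= g.
  by rewrite -ler_sqr ?nnegrE ?mulr_ge0 ?(ltW a0) // exprMn -aa.
have ag : 1 <= g * a.
  by rewrite -ler_sqr ?nnegrE ?mulr_ge0 ?(ltW a0) // expr1n exprMn -aa.
have rs : r * a <= s.
  by rewrite -ler_sqr ?nnegrE ?mulr_ge0 ?(ltW a0) ?(ltW r0) ?(ltW s0) // exprMn -aa sV total_var_lower.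
pose i := s^-1; pose k := a / s; pose e := r^-1.
have i0 : 0 <= i by rewrite invr_ge0 ltW.
have k0 : 0 <= k by rewrite divr_ge0 // ltW.
have e0 : 0 <= e by rewrite invr_ge0 ltW.
have ke : k <= e.
  by rewrite /k /e ler_pdivrMr // mulrC ler_pdivlMr // mulrC.
have ie : i <= g * e.
  rewrite /i /e ler_pdivlMr // -ler_pdivlMl ?invr_gt0 // invrK mulrC.
  apply: le_trans (ler_wpM2l g0 rs); rewrite mulrCA; exact: ler_peMr (ltW r0) ag.
have k2 : k ^+ 2 <= e ^+ 2 by rewrite ler_sqr.
have ab0 : 0 <= a * b by rewrite mulr_ge0 // ltW.
have g1 : g <= 1.
  have /andP[p0 p1] := p01; have := sqr_ge0 g; move: gp; have : p * (1 - p) <= 1 by nra.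
  by lra.
pose ED := Ex mu (fun x => D (W x)).
have hED : `|ED| <= F.
  rewrite -[leRHS](Ex_cst F pm); apply: (le_trans (ler_norm_Ex _ pm)); apply: ler_Ex => // x _.
  by have [] := fD (W x) 0.
have bg' : b <= g.
  rewrite -ler_sqr ?nnegrE //; apply: le_trans bg; rewrite ler_peMl ?sqr_ge0 //.
  by rewrite ler1n.
have h1 : `|(m%:R * (q * (1 - q)) / s ^+ 2 - 1) * ED| <= (2 * (e ^+ 2 * g)) * F.
  rewrite normrM ler_pM //.
  have -> : m%:R * (q * (1 - q)) / s ^+ 2 - 1 = (m%:R * (q * (1 - q)) - V) / s ^+ 2.
    by rewrite -sV; field; rewrite gt_eqF.
  rewrite normrM distrC (@ger0_norm _ (s ^+ 2)^-1) ?invr_ge0 ?exprn_ge0 ?(ltW s0) //.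
  apply: (@le_trans _ _ (2 * m%:R ^+ 2 * b ^+ 2 / s ^+ 2)).
    by rewrite ler_wpM2r // invr_ge0 exprn_ge0 // ltW.
  have -> : 2 * m%:R ^+ 2 * b ^+ 2 / s ^+ 2 = 2 * (k ^+ 2 * (a * b) ^+ 2).
    by rewrite aa /k; field; rewrite gt_eqF.
  rewrite ler_wpM2l // ler_pM ?sqr_ge0 //.
  rewrite expr2; apply: (@le_trans _ _ (g * 1)); last by rewrite mulr1.
  by rewrite ler_pM // (le_trans ab).
have h2 : (2 * s)^-1 + m%:R * b / (2 * s ^+ 2) + m%:R / (2 * s ^+ 3) + m%:R * b / s
   <= 2^-1 * (g * e) + 2^-1 * (e ^+ 2 * g) + 2^-1 * (e ^+ 2 * (g * e)) + e * g.
  have -> : (2 * s)^-1 + m%:R * b / (2 * s ^+ 2) + m%:R / (2 * s ^+ 3) + m%:R * b / s =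
     2^-1 * i + 2^-1 * (k ^+ 2 * b) + 2^-1 * (k ^+ 2 * i) + k * (a * b).
    by rewrite aa /i /k; field; rewrite gt_eqF.
  rewrite lerD ?lerD ?ler_wpM2l // ler_pM ?sqr_ge0 //.
have -> : Ex mu (fun x => W x * f (W x)) - ED =
  (Ex mu (fun x => W x * f (W x)) - m%:R * (q * (1 - q)) / s ^+ 2 * ED)
  + (m%:R * (q * (1 - q)) / s ^+ 2 - 1) * ED by ring.
apply: (le_trans (ler_normD _ _)); apply: (le_trans (lerD main h1)).
have h3 := ler_wpM2l F0 h2; apply: (le_trans (lerD h3 (lexx _))).
rewrite /e le_eqVlt; apply/orP; left; apply/eqP; field; rewrite gt_eqF //.
Qed.

End ExchangeLimit.

(** * Correlations of edges *)

Lemma av_near_const (R : realType) (I : finType) (F : I -> R) (A : {set I}) (c : R) :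
  (0 < #|I|)%N -> (forall i, `|F i| <= 1) -> `|c| <= 1 -> (forall i, i \notin A -> F i = c) ->
  `|c - av F| <= 2 * #|A|%:R * #|I|%:R^-1.
Proof.
move=> I0 F1 c1 FA; have IR : 0 < #|I|%:R :> R by rewrite ltr0n.
rewrite -{1}(av_cst I0 c) -avB avE normrM ger0_norm ?invr_ge0 ?(ltW IR) // mulrC ler_wpM2r ?invr_ge0 ?(ltW IR) //.
apply: (le_trans (ler_norm_sum _ _ _)); rewrite mulr_natr -sumr_const [leRHS]big_mkcond.
apply: ler_sum => i _; case: (boolP (i \in A)) => [_|/FA ->]; last by rewrite subrr normr0.
by apply: (le_trans (ler_normB _ _)); rewrite -[2]/(1 + 1) lerD.
Qed.

Section VertexExchange.
Variables (R : realType) (n : nat).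
Hypothesis n0 : (0 < n)%N.
Variable mu : {set {set 'I_n}} -> R.
Hypothesis pm : is_pmf mu.
Hypothesis inv : forall (f : 'I_n -> 'I_n) x, involutive f -> mu (relabel f x) = mu x.
Variables (p del : R).
Hypothesis p01 : 0 <= p <= 1.
Hypothesis deg : Ex mu (fun x => av (fun b => av (fun w => adj R x b w - p) ^+ 2)) <= del.

Let W0 : (0 < #|'I_n|)%N. Proof. by rewrite card_ord. Qed.

Definition centred (u w : 'I_n) (x : {set {set 'I_n}}) : R := adj R x u w - p.
Definition degree_dev (u : 'I_n) (x : {set {set 'I_n}}) : R := av (fun w => centred u w x).

Lemma centred_le1 u w x : `|centred u w x| <= 1.
Proof.
have /andP[a0 a1] := adj01 R x u w; have /andP[p0 p1] := p01.
by rewrite /centred ler_norml; apply/andP; split; lra.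
Qed.

Lemma degree_dev_le1 u x : `|degree_dev u x| <= 1.
Proof. by apply: av_norm_le => // w; exact: centred_le1. Qed.

Lemma centred_relabel f u w x : involutive f -> centred (f u) (f w) (relabel f x) = centred u w x.
Proof. by move=> fK; rewrite /centred adj_relabel. Qed.

Lemma degree_dev_relabel f u x : involutive f -> degree_dev (f u) (relabel f x) = degree_dev u x.
Proof.
move=> fK; rewrite /degree_dev -(av_relabel fK); apply: eq_av => w; exact: centred_relabel.
Qed.

Lemma Ex_relabel f (F : {set {set 'I_n}} -> R) : involutive f ->
  Ex mu (fun x => F (relabel f x)) = Ex mu F.
Proof. by move=> fK; apply: Ex_involution; [exact: relabelK|move=> x; exact: inv]. Qed.

(** By exchangeability all vertices have the same second moment, so it equals the average in
    [deg]. *)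
Lemma degree_dev_sqr u : Ex mu (fun x => degree_dev u x ^+ 2) <= del.
Proof.
apply: le_trans deg; rewrite Ex_av -[leLHS](av_cst W0) le_eqVlt; apply/orP; left; apply/eqP.
apply: eq_av => b; rewrite -(Ex_relabel _ (@tpermK _ u b)); apply: eq_Ex => x.
by rewrite -[X in degree_dev X _](tpermR u b) degree_dev_relabel //; exact: tpermK.
Qed.

Lemma Ex_mul_le1 (F G : {set {set 'I_n}} -> R) : (forall x, `|F x| <= 1) -> (forall x, `|G x| <= 1) ->
  `|Ex mu (fun x => F x * G x)| <= 1.
Proof.
move=> F1 G1; apply: (le_trans (ler_norm_Ex _ pm)); rewrite -[leRHS](Ex_cst 1 pm); apply: ler_Ex => // x _.
by rewrite normrM -[leRHS]mul1r ler_pM.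
Qed.

(** Transposing [w] with a vertex [z] outside three exceptions changes nothing, so the first edge
    may be averaged into the degree deviation of [u]; likewise for the second edge, with two
    exceptions. The exceptions cost [6 / n] and [4 / n], and two degree deviations correlate by at
    most [del]. The case [u = u'] is allowed, which covers stars. *)
Lemma pair_correlation u w u' w' : w != u -> w != u' -> w != w' -> w' != u -> w' != u' ->
  `|Ex mu (fun x => centred u w x * centred u' w' x)| <= del + 10 * n%:R^-1.
Proof.
move=> wu wu' ww' w'u w'u'.
have swap2 (z z' : 'I_n) : involutive (tperm z z') := @tpermK _ z z'.
have h1 : `|Ex mu (fun x => centred u w x * centred u' w' x)
    - Ex mu (fun x => degree_dev u x * centred u' w' x)| <= 2 * 3%:R * n%:R^-1.
  have -> : Ex mu (fun x => degree_dev u x * centred u' w' x) =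
     av (fun z => Ex mu (fun x => centred u z x * centred u' w' x)).
    by rewrite -Ex_av; apply: eq_Ex => x; rewrite avZr.
  have := @av_near_const R _ (fun z => Ex mu (fun x => centred u z x * centred u' w' x))
    [set u; u'; w']%SET (Ex mu (fun x => centred u w x * centred u' w' x)) W0.
  rewrite card_ord => h.
  have {}h : `|Ex mu (fun x => centred u w x * centred u' w' x)
      - av (fun z => Ex mu (fun x => centred u z x * centred u' w' x))|
      <= 2 * #|[set u; u'; w']%SET|%:R / n%:R.
    apply: h => [z||z]; try by apply: Ex_mul_le1 => x; exact: centred_le1.
    rewrite !inE !negb_or => /andP[/andP[zu zu'] zw'].
    rewrite -(Ex_relabel _ (swap2 w z)); apply: eq_Ex => x.
    have fix1 (s : 'I_n) : s != w -> s != z -> tperm w z s = s.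
      by move=> sw sz; rewrite tpermD // eq_sym.
    rewrite -(centred_relabel u w x (swap2 w z)) -(centred_relabel u' w' x (swap2 w z)) tpermL.
    by rewrite !fix1 // eq_sym.
  apply: (le_trans h); rewrite ler_wpM2r ?invr_ge0 // ler_wpM2l // ler_nat.
  by apply: (leq_trans (leq_card_setU _ _)); rewrite cards1 cards2; case: (_ != _).
have h2 : `|Ex mu (fun x => degree_dev u x * centred u' w' x)
    - Ex mu (fun x => degree_dev u x * degree_dev u' x)| <= 2 * 2%:R * n%:R^-1.
  have -> : Ex mu (fun x => degree_dev u x * degree_dev u' x) =
     av (fun z => Ex mu (fun x => degree_dev u x * centred u' z x)).
    by rewrite -Ex_av; apply: eq_Ex => x; rewrite avZ.
  have := @av_near_const R _ (fun z => Ex mu (fun x => degree_dev u x * centred u' z x))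
    [set u; u']%SET (Ex mu (fun x => degree_dev u x * centred u' w' x)) W0.
  rewrite card_ord => h.
  have {}h : `|Ex mu (fun x => degree_dev u x * centred u' w' x)
      - av (fun z => Ex mu (fun x => degree_dev u x * centred u' z x))|
      <= 2 * #|[set u; u']%SET|%:R / n%:R.
    apply: h => [z||z]; try by apply: Ex_mul_le1 => x; [exact: degree_dev_le1|exact: centred_le1].
    rewrite !inE !negb_or => /andP[zu zu'].
    rewrite -(Ex_relabel _ (swap2 w' z)); apply: eq_Ex => x.
    have fix1 (s : 'I_n) : s != w' -> s != z -> tperm w' z s = s.
      by move=> sw sz; rewrite tpermD // eq_sym.
    rewrite -(degree_dev_relabel u x (swap2 w' z)) -(centred_relabel u' w' x (swap2 w' z)) tpermL.
    by rewrite !fix1 // eq_sym.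
  apply: (le_trans h); rewrite ler_wpM2r ?invr_ge0 // ler_wpM2l // ler_nat.
  by rewrite cards2; case: (_ != _).
have h3 : `|Ex mu (fun x => degree_dev u x * degree_dev u' x)| <= del.
  apply: (le_trans (ler_norm_Ex _ pm)).
  apply: (@le_trans _ _ (2^-1 * (Ex mu (fun x => degree_dev u x ^+ 2) + Ex mu (fun x => degree_dev u' x ^+ 2)))).
    rewrite -ExD -ExZ; apply: ler_Ex => // x _; move: (degree_dev u x) (degree_dev u' x) => s t.
    rewrite ler_norml; have := sqr_ge0 (s - t); have := sqr_ge0 (s + t).
    by move=> q1 q2; apply/andP; split; lra.
  by have := degree_dev_sqr u; have := degree_dev_sqr u'; lra.
move: h1 h2 h3; rewrite !ler_norml => /andP[a1 a2] /andP[a3 a4] /andP[a5 a6].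
by apply/andP; split; lra.
Qed.

(** [pair_correlation] handles two distinct leaves; [1 / #|U|] is the weight of the diagonal, where
    only the trivial bound 1 is used. *)
Lemma star_pool (c : 'I_n) (U : {set 'I_n}) : c \notin U -> (0 < #|U|)%N ->
  Ex mu (fun x => (av (fun v : {v | v \in U} => adj R x c (val v)) - p) ^+ 2)
    <= del + 10 * n%:R^-1 + #|U|%:R^-1.
Proof.
move=> cU U0; have J0 : (0 < #|{: {v | v \in U}}|)%N by rewrite card_sig.
have JE : #|{: {v | v \in U}}| = #|U| by rewrite card_sig.
have k0 : 0 <= del + 10 * n%:R^-1.
  rewrite addr_ge0 ?mulr_ge0 ?invr_ge0 //; apply: le_trans deg; apply: Ex_ge0 => // x.
  by apply: av_ge0 => // b; exact: sqr_ge0.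
rewrite (eq_Ex (g := fun x => av (fun v : {v | v \in U} => av (fun v' : {v | v \in U} =>
   centred c (val v) x * centred c (val v') x)))); last first.
  move=> x; rewrite -[X in _ - X](av_cst J0 p) -avB expr2 -avZr; apply: eq_av => v.
  by rewrite -avZ.
rewrite Ex_av -[leRHS](av_cst J0); apply: ler_av => // v; rewrite Ex_av.
have -> : del + 10 * n%:R^-1 + #|U|%:R^-1 =
   av (fun v' : {v | v \in U} => del + 10 * n%:R^-1 + (v' == v)%:R).
  rewrite avD av_cst //; congr (_ + _); rewrite avE JE (bigD1 v) //= eqxx big1 ?addr0 ?mulr1 //.
  by move=> v' /negbTE ->.
apply: ler_av => // v'; case: (eqVneq v' v) => [_|vv].
  by apply: ler_wpDl k0 _; apply: le_trans (ler_norm _) _; apply: Ex_mul_le1 => x; exact: centred_le1.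
rewrite addr0; apply: le_trans (ler_norm _) _.
have nc (z : {v | v \in U}) : val z != c by apply: contraNneq cU => <-; exact: (valP z).
by apply: pair_correlation => //; rewrite // eq_sym.
Qed.

Variables (m : nat) (a b : 'I_m -> 'I_n) (c : 'I_n) (U : {set 'I_n}).
Hypothesis m0 : (0 < m)%N.
Hypothesis cU : c \notin U.
Hypothesis U0 : (0 < #|U|)%N.
Hypothesis ab : forall i k, b i != a k.
Hypothesis binj : injective b.
Hypothesis exch : forall i v, v \in U -> exists f, [/\ involutive f, f (a i) = c, f (b i) = v &
  forall k, k != i -> f (a k) = a k /\ f (b k) = b k].

Definition member (i : 'I_m) (x : {set {set 'I_n}}) : R := adj R x (a i) (b i).
Definition pool_edge (v : {v | v \in U}) (x : {set {set 'I_n}}) : R := adj R x c (val v).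

Lemma adj_bool (u w : 'I_n) (x : {set {set 'I_n}}) : 0 <= adj R x u w <= 1 /\ adj R x u w ^+ 2 = adj R x u w.
Proof. by split; [exact: adj01|rewrite /adj; case: (_ \in _); rewrite ?expr1n ?expr0n]. Qed.

Lemma edge_swap i (v : {v | v \in U}) : exists f : {set {set 'I_n}} -> {set {set 'I_n}},
  [/\ involutive f, forall x, mu (f x) = mu x,
  forall x, member i (f x) = pool_edge v x, forall x, pool_edge v (f x) = member i x
  & forall k x, k != i -> member k (f x) = member k x].
Proof.
have [f [fK fa fb fk]] := exch i (valP v); exists (relabel f).
have fc : f c = a i by rewrite -fa fK.
have fv : f (val v) = b i by rewrite -fb fK.
split; [exact: relabelK|by move=> x; exact: inv| | |].
- by move=> x; rewrite /member -fc -fv adj_relabel.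
- by move=> x; rewrite /pool_edge -fa -fb adj_relabel.
by move=> k x /fk [ka kb]; rewrite /member -[in LHS]ka -[in LHS]kb adj_relabel.
Qed.

Local Notation V := (total_var mu member pool_edge).

Lemma pool0 : (0 < #|{: {v | v \in U}}|)%N.
Proof. by rewrite card_sig. Qed.

Lemma Ex_edges_total : Ex mu (total member) = m%:R * pool_prob mu pool_edge.
Proof. apply: Ex_total; [exact: pool0|exact: edge_swap]. Qed.

Lemma edges_stein (g r F : R) : 0 <= g -> 0 < r -> r ^+ 2 = p * (1 - p) / 2 ->
  g + 2 * g ^+ 2 <= p * (1 - p) / 2 -> 1 <= g ^+ 2 * m%:R ->
  m%:R * (del + 10 * n%:R^-1 + #|U|%:R^-1) <= g ^+ 2 ->
  r ^+ 2 * m%:R <= V /\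
  stein_close F (F * (g * (3 / (2 * r) + 5 / (2 * r ^+ 2) + (2 * r ^+ 3)^-1)))
    mu (standardized mu member pool_edge (Num.sqrt V)).
Proof.
move=> g0 r0 rp gp mg kg; set kappa := _ + _ in kg.
have U1 : 0 <= #|U|%:R^-1 :> R by rewrite invr_ge0.
have del0 : 0 <= del.
  by apply: le_trans deg; apply: Ex_ge0 => // x; apply: av_ge0 => // u; exact: sqr_ge0.
have n1 : 0 <= n%:R^-1 :> R by rewrite invr_ge0.
have k0 : 0 <= kappa by rewrite /kappa; lra.
pose bb := Num.sqrt kappa; have bb0 : 0 <= bb := sqrtr_ge0 _.
have bE : bb ^+ 2 = kappa by rewrite sqr_sqrtr.
have X01 i x : 0 <= member i x <= 1 /\ member i x ^+ 2 = member i x by exact: adj_bool.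
have X'01 v x : 0 <= pool_edge v x <= 1 /\ pool_edge v x ^+ 2 = pool_edge v x by exact: adj_bool.
have pool_close : Ex mu (fun x => (pool_mean pool_edge x - p) ^+ 2) <= bb ^+ 2.
  by rewrite bE; exact: star_pool.
have pair_close i k : i != k -> `|Ex mu (fun x => (member i x - p) * (member k x - p))| <= bb ^+ 2.
  move=> ik; rewrite bE; apply: (@le_trans _ _ (del + 10 * n%:R^-1)); last by rewrite lerDl.
  have bik : b i != b k by apply: contraNneq ik => /binj ->.
  by apply: pair_correlation.
rewrite -bE in kg.
split.
  exact: (total_var_lower pm pool0 X01 X'01 edge_swap bb0 p01 pool_close pair_close g0 m0 kg gp rp).
exact: (exchangeable_stein pm pool0 X01 X'01 edge_swap bb0 p01 pool_close pair_close g0 m0 kg mg gp r0 rp).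
Qed.

End VertexExchange.

Section Configurations.
Variables (n m : nat) (e : 'I_m -> {set 'I_n}).
Hypothesis eE : forall i, e i \in edges n.
Hypothesis einj : injective e.
Hypothesis nm : (4 * m + 2 <= n)%N.

(** Common form of both cases: oriented edges and a star at [c] with leaves in [U], such that each
    given edge can be carried to each star edge while the ends of the other given edges stay fixed.
    Since [U] contains at least half of the vertices, [1 / #|U|] is at most [2 / n]. *)
Definition exchangeable_config (a b : 'I_m -> 'I_n) (c : 'I_n) (U : {set 'I_n}) : Prop :=
  [/\ forall i, e i = [set a i; b i]%SET, c \notin U, (n <= 2 * #|U|)%N,
    (forall i k, b i != a k) /\ injective b
  & forall i v, v \in U -> exists f : 'I_n -> 'I_n, [/\ involutive f, f (a i) = c, f (b i) = v &
      forall k, k != i -> f (a k) = a k /\ f (b k) = b k]].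

Lemma card_complement (A : {set 'I_n}) : (#|A| <= 2 * m + 1)%N -> (n <= 2 * #|~: A|)%N.
Proof. by move=> h; have := cardsC A; rewrite card_ord; lia. Qed.

Lemma star_config (w : 'I_n) : (forall i, w \in e i) ->
  exists a b c U, exchangeable_config a b c U.
Proof.
move=> we.
have /boolp.choice[b hb] i : exists b, b != w /\ e i = [set w; b]%SET.
  have := eE i; rewrite /edges inE => /cards2P[x [y [xy exy]]].
  have := we i; rewrite exy !inE => /orP[/eqP wx|/eqP wy].
    by exists y; rewrite wx eq_sym xy.
  by exists x; rewrite wy xy finset.setUC.
have binj : injective b.
  by move=> i k bik; apply: einj; rewrite (hb i).2 (hb k).2 bik.
pose A := (w |: [set b i | i in 'I_m])%SET.
exists (fun=> w), b, w, (~: A)%SET; split.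
- by move=> i; rewrite (hb i).2.
- by rewrite !inE eqxx.
- apply: card_complement; apply: (leq_trans (leq_card_setU _ _)).
  by rewrite cards1 card_imset // card_ord; lia.
- by split=> // i k; rewrite (hb i).1.
move=> i v; rewrite !inE negb_or => /andP[vw vb].
exists (tperm (b i) v); split; first exact: tpermK.
- by rewrite tpermD // (hb i).1.
- by rewrite tpermL.
move=> k ki; split; rewrite tpermD // ?(hb i).1 //.
  by apply: contraNneq ki => /binj ->.
by apply: contraNneq vb => ->; rewrite imset_f.
Qed.

Lemma matching_config : (0 < m)%N ->
  (forall i j, i != j -> forall w, w \in e i -> w \notin e j) ->
  exists a b c U, exchangeable_config a b c U.
Proof.
move=> m0 disj.
have /boolp.choice[ab hab] i : exists q : 'I_n * 'I_n, q.1 != q.2 /\ e i = [set q.1; q.2]%SET.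
  by have := eE i; rewrite /edges inE => /cards2P[x [y [xy exy]]]; exists (x, y).
pose a i := (ab i).1; pose b i := (ab i).2.
have abi i : a i != b i := (hab i).1.
have eab i : e i = [set a i; b i]%SET := (hab i).2.
have sep i k : i != k -> [/\ a i != a k, a i != b k, b i != a k & b i != b k].
  move=> ik; have := disj i k ik (a i); have := disj i k ik (b i).
  rewrite !eab !inE !eqxx orbT !negb_or => /(_ isT) /andP[h1 h2] /(_ isT) /andP[h3 h4].
  by split.
pose A := ([set a i | i in 'I_m] :|: [set b i | i in 'I_m])%SET.
have Am : (#|A| <= 2 * m)%N.
  apply: (leq_trans (leq_card_setU _ _)); rewrite mul2n -addnn leq_add //.
    by apply: (leq_trans (leq_imset_card _ _)); rewrite card_ord.
  by apply: (leq_trans (leq_imset_card _ _)); rewrite card_ord.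
have [c cA] : exists c, c \in (~: A)%SET.
  by apply/card_gt0P; have := cardsC A; rewrite card_ord; lia.
exists a, b, c, (~: (c |: A))%SET; split=> //.
- by rewrite !inE eqxx.
- apply: card_complement; apply: (leq_trans (leq_card_setU _ _)); by rewrite cards1 addnC leq_add2r.
- split=> [i k|i k bik].
    by case: (eqVneq i k) => [->|/sep[]//]; rewrite eq_sym.
  by apply/eqP; apply: contraT => /sep[_ _ _]; rewrite bik eqxx.
have notA x : x \notin A -> forall k, x != a k /\ x != b k.
  rewrite !inE negb_or => /andP[h1 h2] k; split.
    by apply: contraNneq h1 => ->; rewrite imset_f.
  by apply: contraNneq h2 => ->; rewrite imset_f.
move: cA; rewrite inE => /notA cA.
move=> i v; rewrite finset.in_setC finset.in_setU1 negb_or => /andP[vc /notA vA].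
have [ca cb] := cA i; have [va vb] := vA i; have abi' := abi i.
have fa : tperm (a i) c (tperm (b i) v (a i)) = c.
  by rewrite [tperm (b i) v _]tpermD ?tpermL // eq_sym.
have fb : tperm (a i) c (tperm (b i) v (b i)) = v by rewrite tpermL tpermD // eq_sym.
have fc : tperm (a i) c (tperm (b i) v c) = a i.
  by rewrite [tperm (b i) v _]tpermD ?tpermR // eq_sym.
have fv : tperm (a i) c (tperm (b i) v v) = b i by rewrite tpermR tpermD // eq_sym.
have fD x : x != a i -> x != b i -> x != c -> x != v -> tperm (a i) c (tperm (b i) v x) = x.
  by move=> *; rewrite ![tperm _ _ x]tpermD // eq_sym.
exists (fun x => tperm (a i) c (tperm (b i) v x)); split=> //.
  move=> x; case: (eqVneq x (a i)) => [->|xa]; first by rewrite fa fc.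
  case: (eqVneq x (b i)) => [->|xb]; first by rewrite fb fv.
  case: (eqVneq x c) => [->|xc]; first by rewrite fc fa.
  case: (eqVneq x v) => [->|xv]; first by rewrite fv fb.
  by rewrite !fD.
move=> k /sep[h1 h2 h3 h4]; have [? ?] := cA k; have [? ?] := vA k.
by split; apply: fD => //; rewrite eq_sym.
Qed.

End Configurations.

(** * Assembly of the central limit theorem *)

Local Open Scope classical_set_scope.
Local Open Scope ring_scope.

Theorem theorem6p6 (R : realType) (K : nat) (v : 'I_K.+1 -> nat)
    (E : forall i : 'I_K.+1, {set {set 'I_(v i)}}) (beta : 'I_K.+1 -> R)
    (pstar : R) :
  (* the G_i are simple graphs: every edge is a 2-subset of V_i *)
  (forall i : 'I_K.+1, E i \subset edges (v i)) ->
  (* G_0 is a single edge *)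
  v ord0 = 2%N -> #|E ord0| = 1%N ->
  (* beta_1, ..., beta_K >= 0 (beta_0 arbitrary) *)
  (forall i : 'I_K.+1, i != ord0 -> 0 <= beta i) ->
  in_Ubeta R K v E beta pstar ->
  exists eta : R, 0 < eta /\
    forall (m : nat -> nat) (e : forall n : nat, 'I_(m n) -> {set 'I_n}),
      ((m n)%:R : R) @[n --> \oo] --> +oo ->
      ((m n)%:R / n%:R : R) @[n --> \oo] --> 0 ->
      (forall (n : nat) (i : 'I_(m n)), e n i \in edges n) ->
      (forall n : nat, injective (e n)) ->
      ((forall (n : nat) (i j : 'I_(m n)), i != j ->
           forall w : 'I_n, w \in e n i -> w \notin e n j)
       \/ (forall n : nat, (0 < m n)%N ->
             exists w : 'I_n, forall i : 'I_(m n), w \in e n i)) ->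
      let Y n := edge_sum R n (m n) (e n) in
      let S n x := (Y n x - Emu R K v E beta n eta pstar (Y n))
                   / Num.sqrt (Varmu R K v E beta n eta pstar (Y n)) in
      forall t : R,
        Pmu_le R K v E beta n eta pstar (S n) t @[n --> \oo]
          --> std_normal_cdf R t.
Proof.
move=> EE v0 E0 beta0 pU.
pose g i := projT1 (cid (hom_count_density R (EE i))).
have gs i : simple_edges (g i) #|E i| by have [] := projT2 (cid (hom_count_density R (EE i))).
have gE i : forall n (x : {set {set 'I_n}}), (0 < n)%N ->
    (hom_count (v i) (E i) n x)%:R = n%:R ^+ (v i) * density R (g i) #|E i| x.
  by have [] := projT2 (cid (hom_count_density R (EE i))).
have [eta [C [n1 [eta0 C0 main]]]] := ergm_degree_variance gs gE E0 beta0 pU.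
exists eta; split=> // m e minf mn0 eE einj cfg Y S t.
have p0 := optimum_gt0 pU; have p1 := optimum_lt1 pU.
have p01 : 0 <= pstar <= 1 by rewrite !ltW.
apply/cvgrPdist_le => eps eps0.
have [F [del [del0 approx]]] := normal_approximation t eps0.
pose c0 := pstar * (1 - pstar) / 2; pose r := Num.sqrt c0.
have c00 : 0 < c0 by rewrite divr_gt0 // mulr_gt0 // subr_gt0.
have r0 : 0 < r by rewrite sqrtr_gt0.
have rE : r ^+ 2 = c0 by rewrite sqr_sqrtr // ltW.
pose A := 3 / (2 * r) + 5 / (2 * r ^+ 2) + (2 * r ^+ 3)^-1.
have A0 : 0 < A.
  by rewrite !addr_gt0 ?divr_gt0 ?invr_gt0 ?mulr_gt0 ?exprn_gt0.
have F1 : 0 < `|F| + 1 by rewrite ltr_wpDl.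
(* The first two entries give [gam + 2 gam^2 <= 3 gam <= c0]; the third makes the Stein error
   [F gam A] at most [del], with [|F| + 1] as a positive denominator. *)
pose gam := Num.min (Num.min 1 (c0 / 3)) (del / ((`|F| + 1) * A)).
have gam0 : 0 < gam.
  have q1 : 0 < c0 / 3 by rewrite divr_gt0.
  have q2 : 0 < del / ((`|F| + 1) * A) by rewrite divr_gt0 // mulr_gt0.
  by rewrite !lt_min ltr01 q1 q2.
have [ga1 ga2 ga3] : [/\ gam <= 1, gam <= c0 / 3 & gam <= del / ((`|F| + 1) * A)].
  by rewrite /gam !ge_min !lexx !orbT.
have gp : gam + 2 * gam ^+ 2 <= c0.
  by have : gam ^+ 2 <= gam by [rewrite expr2 ler_piMl // ltW]; lra.
have FA : F * (gam * A) <= del.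
  apply: (@le_trans _ _ ((`|F| + 1) * (gam * A))).
    by rewrite ler_wpM2r ?mulr_ge0 ?(ltW gam0) ?(ltW A0) //; have := ler_norm F; lra.
  by rewrite mulrCA -ler_pdivlMr ?mulr_gt0.
have g20 : 0 < gam ^+ 2 by rewrite exprn_gt0.
have C12 : 0 < C + 12 by lra.
(* [12 = 10 + 2]: the pair correlation costs [10 / n], and [1 / #|U|] is at most [2 / n]. The bound
   1/6 on [m / n] yields [4 m + 2 <= n] once [m >= 1]. *)
have s0 : 0 < Num.min (6^-1) (gam ^+ 2 / (C + 12)).
  by rewrite lt_min invr_gt0 divr_gt0 // ltr0n.
near=> n.
have n1n : (n1 <= n)%N by near: n; exact: nbhs_infty_ge.
have n0 : (0 < n)%N by near: n; exact: nbhs_infty_gt.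
have nR : 0 < n%:R :> R by rewrite ltr0n.
have ming : (gam ^+ 2)^-1 <= (m n)%:R by near: n; move/cvgryPge: minf; apply.
have small : (m n)%:R / n%:R <= Num.min (6^-1) (gam ^+ 2 / (C + 12)).
  near: n; move/cvgrPdist_le: mn0 => /(_ _ s0); apply: filterS => k.
  by rewrite sub0r normrN ger0_norm // divr_ge0.
have m0 : (0 < m n)%N.
  by rewrite -(ltr0n R); apply: lt_le_trans ming; rewrite invr_gt0.
have mg : 1 <= gam ^+ 2 * (m n)%:R by rewrite -ler_pdivrMl // mulr1.
have /andP[small1 small2] :
    ((m n)%:R / n%:R <= 6^-1 :> R) && ((m n)%:R / n%:R <= gam ^+ 2 / (C + 12)) by rewrite -le_min.
have nm : (4 * m n + 2 <= n)%N.
  have : (6 * m n <= n)%N.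
    by move: small1; rewrite ler_pdivrMr // -(ler_nat R) natrM => h; clear -h; lra.
  by move=> h; clear -h m0; lia.
have [a [b [c [U [eab cU Un [ab binj] exch]]]]] : exists a b c U, exchangeable_config (e n) a b c U.
  case: cfg => [disj|star]; first exact: (matching_config (eE n) nm m0 (disj n)).
  by have [w we] := star n m0; exact: (star_config (eE n) (einj n) nm we).
have U0 : (0 < #|U|)%N.
  by rewrite -(ltn_pmul2l (isT : 0 < 2)%N) muln0; apply: leq_trans Un.
have [pm deg] := main n n0 n1n.
pose mu := cond_ergm R K v E beta n eta pstar.
have inv f x : involutive f -> mu (relabel f x) = mu x.
  by move=> fK; apply: (cond_ergm_relabel _ gE).
have kg : (m n)%:R * (C * n%:R^-1 + 10 * n%:R^-1 + #|U|%:R^-1) <= gam ^+ 2.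
  have Ui : #|U|%:R^-1 <= 2 * n%:R^-1 :> R.
    rewrite -[2 * _]invrK lef_pV2 ?posrE ?ltr0n // ?invr_gt0 ?mulr_gt0 ?invr_gt0 //.
    by rewrite invfM invrK mulrC ler_pdivrMr // -natrM ler_nat mulnC.
  move: small2; rewrite ler_pdivlMr // => h; apply: le_trans h.
  rewrite -mulrA; apply: ler_wpM2l => //; rewrite mulrDr; clear -Ui; lra.
have [Vlow close] := edges_stein n0 pm inv p01 deg m0 cU U0 ab binj exch F (ltW gam0) r0 rE gp mg kg.
have YE : total (member R a b) = Y n.
  by apply/funext => x; rewrite /Y /edge_sum /total; apply: eq_bigr => i _; rewrite /member /adj -eab.
have EY : Emu R K v E beta n eta pstar (Y n) = (m n)%:R * pool_prob mu (pool_edge R c (U:=U)).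
  by rewrite -YE; exact: (Ex_edges_total inv U0 exch).
have SE : S n = standardized mu (member R a b) (pool_edge R c (U:=U))
    (Num.sqrt (total_var mu (member R a b) (pool_edge R c (U:=U)))).
  apply/funext => x; rewrite /S /Varmu EY /standardized YE; congr (_ / Num.sqrt _).
  by rewrite /total_var YE.
have V0 : 0 < total_var mu (member R a b) (pool_edge R c (U:=U)).
  by apply: lt_le_trans Vlow; rewrite mulr_gt0 ?exprn_gt0 // ltr0n.
have -> : Pmu_le R K v E beta n eta pstar (S n) t = Ex mu (fun x => ((S n x <= t)%R)%:R).
  rewrite /Pmu_le /Ex big_mkcond; apply: eq_bigr => x _.
  by case: (S n x <= t); rewrite ?mulr1 ?mulr0.
rewrite distrC; apply: approx => //.
  by rewrite SE standardized_sqr ?sqrtr_gt0 // sqr_sqrtr // ltW.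
move=> f D fD; rewrite SE; apply: le_trans FA; exact: close.
Unshelve. all: by end_near.
Qed.
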